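(* Suppose $\mu\neq0$ and $\sigma^2_{\mu_\perp}>0$. Then, as $n\to\infty$, \[ \psi_n^\mu(\operatorname{hull}\{S_0,S_1,\ldots,S_n\}) \Rightarrow \tilde h_1 \] in the sense of weak convergence on $(\mathcal{K}_2^0,\rho_H)$.
   Context: $Z$ is a random vector in $\mathbb{R}^2$ with $\mathbb{E}[\|Z\|^2]<\infty$; $Z_1,Z_2,\ldots$ are i.i.d. copies of $Z$; $S_0=0$, $S_n=\sum_{k=1}^n Z_k$. $\mu=\mathbb{E}Z$, $\sigma^2=\mathbb{E}[\|Z-\mu\|^2]$; for $\mu\neq0$, $\hat\mu=\mu/\|\mu\|$, $\sigma^2_\mu=\mathbb{E}[((Z-\mu)\cdot\hat\mu)^2]$, $\sigma^2_{\mu_\perp}=\sigma^2-\sigma^2_\mu$, and $\hat\mu_\perp$ is the unit vector obtained by rotating $\hat\mu$ by $\pi/2$ anticlockwise. $\psi_n^\mu:\mathbb{R}^2\to\mathbb{R}^2$ is $\psi_n^\mu(x)=\big(\frac{x\cdot\hat\mu}{n\|\mu\|},\frac{x\cdot\hat\mu_\perp}{\sqrt{n\sigma^2_{\mu_\perp}}}\big)$ in Cartesian coordinates. $w$ is standard one-dimensional Brownian motion with $w(0)=0$, $\tilde b(s)=(s,w(s))$ for $s\in[0,1]$, and $\tilde h_1=\operatorname{hull}\tilde b[0,1]$. $\mathcal{K}_2^0$ is the collection of compact convex subsets of $\mathbb{R}^2$ containing the origin, with Hausdorff metric $\rho_H(A,B)=\max\{\sup_{x\in B}\rho(x,A),\sup_{y\in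 A}\rho(y,B)\}$, $\rho(x,A)=\inf_{y\in A}\|x-y\|$. *)

(* Defs.v *)
From HB Require Import structures.
From mathcomp Require Import all_boot all_order all_algebra.
From mathcomp Require Import all_classical all_reals all_analysis.
Set Implicit Arguments. Unset Strict Implicit. Unset Printing Implicit Defensive.
Import Order.TTheory GRing.Theory Num.Theory.
Import numFieldNormedType.Exports.
Local Open Scope classical_set_scope.
Local Open Scope ring_scope.

Definition dot2 {R : realType} (x y : R * R) : R := x.1 * y.1 + x.2 * y.2.
Definition enorm2 {R : realType} (x : R * R) : R := Num.sqrt (dot2 x x).
Definition sub2 {R : realType} (x y : R * R) : R * R := (x.1 - y.1, x.2 - y.2).
Definition edist2 {R : realType} (x y : R * R) : R := enorm2 (sub2 x y).
Definition scale2 {R : realType} (a : R) (x : R * R) : R * R := (a * x.1, a * x.2).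

Definition convex2 {R : realType} (C : set (R * R)) : Prop :=
  forall x y, C x -> C y -> forall t : R, 0 <= t -> t <= 1 ->
    C (t * x.1 + (1 - t) * y.1, t * x.2 + (1 - t) * y.2).
Definition hull2 {R : realType} (A : set (R * R)) : set (R * R) :=
  [set z | forall C, convex2 C -> A `<=` C -> C z].

Definition K20 {R : realType} (A : set (R * R)) : Prop :=
  compact A /\ convex2 A /\ A (0, 0).

Definition dist_set {R : realType} (x : R * R) (A : set (R * R)) : R :=
  inf [set edist2 x y | y in A].
Definition hausdorff {R : realType} (A B : set (R * R)) : R :=
  Num.max (sup [set dist_set x A | x in B]) (sup [set dist_set y B | y in A]).

Definition bounded_continuous_K20 {R : realType} (f : set (R * R) -> R) : Prop :=
  (exists M : R, forall A, K20 A -> `|f A| <= M) /\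
  (forall A, K20 A -> forall e : R, 0 < e -> exists2 d : R, 0 < d &
     forall B, K20 B -> hausdorff A B < d -> `|f A - f B| < e).

Definition weak_cvg_K20 {R : realType} {d d' : measure_display}
  {T : measurableType d} {T' : measurableType d'}
  (P : probability T R) (X : nat -> T -> set (R * R))
  (Q : probability T' R) (Y : T' -> set (R * R)) : Prop :=
  forall f : set (R * R) -> R, bounded_continuous_K20 f ->
    ((fun n => \int[P]_w (f (X n w))%:E) @ \oo --> \int[Q]_w (f (Y w))%:E)%E.

Definition mutually_indep {R : realType} {d d2 : measure_display}
  {T : measurableType d} {U : measurableType d2}
  (P : probability T R) (k : nat) (X : 'I_k -> T -> U) : Prop :=
  forall B : 'I_k -> set U, (forall i, measurable (B i)) ->
    P (\bigcap_i (X i @^-1` B i)) = (\prod_(i < k) P (X i @^-1` B i))%E.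

(* Z 0, Z 1, ... are i.i.d. random vectors in R^2 (Z k plays the role of Z_{k+1}) *)
Definition iid_R2 {R : realType} {d : measure_display} {T : measurableType d}
  (P : probability T R) (Z : nat -> T -> R * R) : Prop :=
  (forall k, measurable_fun setT (Z k)) /\
  (forall n, mutually_indep P (fun i : 'I_n => Z i)) /\
  (forall k (B : set (R * R)), measurable B -> P (Z k @^-1` B) = P (Z 0%N @^-1` B)).

Definition walk {R : realType} {T : Type} (Z : nat -> T -> R * R) (n : nat) (w : T)
  : R * R := (\sum_(k < n) (Z k w).1, \sum_(k < n) (Z k w).2).

Definition mean2 {R : realType} {d : measure_display} {T : measurableType d}
  (P : probability T R) (Z : T -> R * R) : R * R :=
  (fine ('E_P[fun w => (Z w).1]), fine ('E_P[fun w => (Z w).2])).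
Definition sigma2 {R : realType} {d : measure_display} {T : measurableType d}
  (P : probability T R) (Z : T -> R * R) : R :=
  fine ('E_P[fun w => enorm2 (sub2 (Z w) (mean2 P Z)) ^+ 2]).
Definition muhat {R : realType} (mu : R * R) : R * R := scale2 (enorm2 mu)^-1 mu.
Definition muhat_perp {R : realType} (mu : R * R) : R * R :=
  (- (muhat mu).2, (muhat mu).1).
Definition sigma2_mu {R : realType} {d : measure_display} {T : measurableType d}
  (P : probability T R) (Z : T -> R * R) : R :=
  fine ('E_P[fun w => dot2 (sub2 (Z w) (mean2 P Z)) (muhat (mean2 P Z)) ^+ 2]).
Definition sigma2_perp {R : realType} {d : measure_display} {T : measurableType d}
  (P : probability T R) (Z : T -> R * R) : R :=
  sigma2 P Z - sigma2_mu P Z.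

Definition psi {R : realType} (mu : R * R) (s2perp : R) (n : nat) (x : R * R)
  : R * R :=
  (dot2 x (muhat mu) / (n%:R * enorm2 mu),
   dot2 x (muhat_perp mu) / Num.sqrt (n%:R * s2perp)).

Definition std_brownian {R : realType} {d : measure_display} {T : measurableType d}
  (P : probability T R) (w : T -> R -> R) : Prop :=
  (forall t, measurable_fun setT (fun o => w o t)) /\
  (forall o, w o 0 = 0) /\
  (forall o, {within [set t : R | 0 <= t], continuous (w o)}) /\
  (forall (k : nat) (t : nat -> R), 0 <= t 0%N ->
     (forall i, (i < k)%N -> t i < t i.+1) ->
     mutually_indep P (fun (i : 'I_k) o => w o (t i.+1) - w o (t i)) /\
     (forall i, (i < k)%N -> forall B : set R, measurable B ->
        P [set o | B (w o (t i.+1) - w o (t i))] =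
        normal_prob 0 (Num.sqrt (t i.+1 - t i)) B)).

Definition htilde1 {R : realType} {T : Type} (w : T -> R -> R) (o : T)
  : set (R * R) :=
  hull2 [set (s, w o s) | s in [set s : R | 0 <= s <= 1]].

(* Main.v *)
Require Import Defs.
From HB Require Import structures.
From mathcomp Require Import all_boot all_order all_algebra.
From mathcomp Require Import all_classical all_reals all_analysis.
From mathcomp Require Import measurable_realfun ring lra.
Set Implicit Arguments. Unset Strict Implicit. Unset Printing Implicit Defensive.
Import Order.TTheory GRing.Theory Num.Theory.
Import numFieldNormedType.Exports.
Local Open Scope classical_set_scope.
Local Open Scope ring_scope.

(* In the coordinates of psi the rescaled walk is s + (a small mean-zero error)
   in the drift direction and a centred, normalised one-dimensional walk in the
   perpendicular one. Only the values at m of the n times are kept: Ottaviani's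
   maximal inequality controls what happens between them, and the hull is
   Lipschitz in the Hausdorff metric, so the expectation of a bounded Lipschitz
   function of the hull changes little. The m block sums are replaced by Brownian
   increments by Lindeberg's one-step-at-a-time swapping, which is uniform over
   bounded Lipschitz functions; the hull of the sampled Brownian path tends to
   that of the path by uniform continuity. Weak convergence for a merely
   continuous bounded function follows by approximating it from below by its
   largest k-Lipschitz minorants. *)

(** Two obstacles shape the proof. Since [f] is an arbitrary continuous function of convex sets,
    measurability of [f] of a random hull has to be earned. Bounded Lipschitz functions of finitely
    many real variables are measurable and keep their constants when variables are integrated out,
    so expectations are kept inside that class: indicators become Lipschitz cutoffs, and the square
    in Chebyshev's inequality becomes a bounded kernel. The second obstacle is quantitative. Over
    [m] blocks of variance about [1/m], Chebyshev bounds the chance of a large oscillation only by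
    [m * O(1/m)], which does not vanish, and the steps have just two moments. The maximal inequality
    is therefore left in terms of the end value of each block, the central limit theorem carries
    this to Brownian increments, and their fourth moment gives [m * O(1/m^2)]. Uniformity over test
    functions is essential, because the function met by one block depends on [n] and on the other
    blocks; smoothing by averages gives derivative bounds that depend only on the bound, the
    Lipschitz constant and the width. *)

Section expectation.
Context {R : realType} {d : measure_display} {T : measurableType d}.
Variable P : probability T R.

Lemma bounded_integrable (f : T -> R) (M : R) : measurable_fun setT f ->
  (forall x, `|f x| <= M) -> P.-integrable setT (EFin \o f).
Proof.
move=> mf fM; apply: (@le_integrable _ _ _ _ _ _ _ (cst M%:E)) => //.
- exact/measurable_EFinP.
- by move=> x _ /=; rewrite lee_fin (le_trans (fM x))// ler_norm.
- exact: finite_measure_integrable_cst.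
Qed.

Lemma Rintegral_prob_cst (c : R) : \int[P]_w c = c.
Proof. by rewrite Rintegral_cst// -[X in fine X]/(P setT) probability_setT mulr1. Qed.

Lemma le_expectation (f g : T -> R) : P.-integrable setT (EFin \o f) ->
  P.-integrable setT (EFin \o g) -> (forall x, f x <= g x) ->
  \int[P]_w f w <= \int[P]_w g w.
Proof. by move=> fi gi fg; apply: le_Rintegral. Qed.

Lemma expectation_dist (f g : T -> R) (c : R) : P.-integrable setT (EFin \o f) ->
  P.-integrable setT (EFin \o g) -> (forall x, `|f x - g x| <= c) ->
  `|\int[P]_w f w - \int[P]_w g w| <= c.
Proof.
move=> fi gi fg; rewrite -RintegralB//.
have I : P.-integrable setT (EFin \o (fun w => f w - g w)).
  by have := integrableB measurableT fi gi.
apply: (le_trans (le_normr_Rintegral measurableT I)).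
rewrite -[leRHS]Rintegral_prob_cst; apply: le_expectation => //.
- by have := integrable_abse I.
- exact: finite_measure_integrable_cst.
Qed.

Lemma expectation_bound (f : T -> R) (c : R) : measurable_fun setT f ->
  (forall x, `|f x| <= c) -> `|\int[P]_w f w| <= c.
Proof.
move=> mf fc; rewrite -[X in `|X|]subr0 -[X in _ - X](Rintegral_prob_cst 0).
apply: expectation_dist; first exact: bounded_integrable fc.
- exact: finite_measure_integrable_cst.
- by move=> x; rewrite subr0.
Qed.

End expectation.

(** * Bounded Lipschitz functions of finite sequences *)

Definition lip1 {R : realType} (M L : R) (g : R -> R) : Prop :=
  (forall x, `|g x| <= M) /\ (forall x y, `|g x - g y| <= L * `|x - y|).

Fixpoint l1dist {R : realType} (s t : seq R) : R :=
  match s, t with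
  | x :: s', y :: t' => `|x - y| + l1dist s' t'
  | _, _ => 0
  end.

(** Lengths are side conditions on plain sequences, so samples can be consed, split and concatenated
    without casts. The l1 metric is used because it adds up over concatenation. *)
Definition seqlip {R : realType} (n : nat) (M L : R) (H : seq R -> R) : Prop :=
  (forall s, size s = n -> `|H s| <= M) /\
  (forall s t, size s = n -> size t = n -> `|H s - H t| <= L * l1dist s t).

Section seqlip.
Context {R : realType}.
Implicit Types (s t : seq R) (H : seq R -> R) (M L : R).

Lemma l1dist_ge0 s t : 0 <= l1dist s t.
Proof. by elim: s t => [|x s IH] [|y t] //=; rewrite addr_ge0. Qed.

Lemma l1distxx s : l1dist s s = 0.
Proof. by elim: s => //= x s ->; rewrite subrr normr0 addr0. Qed.

Lemma l1dist_cat s s' t t' : size s = size t ->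
  l1dist (s ++ s') (t ++ t') = l1dist s t + l1dist s' t'.
Proof.
elim: s t => [|x s IH] [|y t] //=; first by rewrite add0r.
by move=> [st]; rewrite IH// addrA.
Qed.

Lemma l1dist_map_le (f g : nat -> R) (c : R) (l : seq nat) :
  (forall i, i \in l -> `|f i - g i| <= c) ->
  l1dist (map f l) (map g l) <= c *+ size l.
Proof.
elim: l => [|i l IH] /= h; first by rewrite mulr0n.
rewrite mulrS lerD ?h ?mem_head// IH// => j jl.
by apply: h; rewrite in_cons jl orbT.
Qed.

Lemma l1dist_sum s t : size s = size t ->
  `|\sum_(x <- s) x - \sum_(x <- t) x| <= l1dist s t.
Proof.
elim: s t => [|x s IH] [|y t] //=; first by rewrite !big_nil subrr normr0.
move=> [st]; rewrite !big_cons opprD addrACA (le_trans (ler_normD _ _))//.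
by rewrite lerD2l IH.
Qed.

Lemma seqlip_cons n M L H x : seqlip n.+1 M L H ->
  seqlip n M L (fun s => H (x :: s)).
Proof.
move=> [HM HL]; split=> [s sn|s t sn tn]; first by rewrite HM//= sn.
have := HL (x :: s) (x :: t); rewrite /= sn tn subrr normr0 add0r.
exact.
Qed.

Lemma lip1_seqlip N M L g x : 0 <= L -> lip1 M L g ->
  seqlip N M L (fun s => g (x + \sum_(y <- s) y)).
Proof.
move=> L0 [gM gL]; split=> [s _|s t sn tn]; first exact: gM.
apply: (le_trans (gL _ _)); rewrite ler_wpM2l//.
by rewrite opprD addrACA subrr add0r l1dist_sum// sn tn.
Qed.

Lemma lip1_continuous M L g : lip1 M L g -> continuous g.
Proof.
move=> [gM gL] x; apply/cvgrPdist_le => e e0.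
have K0 : 0 < e / (`|L| + 1) by rewrite divr_gt0// ltr_wpDl.
apply/nbhs_ballP; exists (e / (`|L| + 1)) => //= y xy.
apply: (le_trans (gL _ _)); have := ltW xy; rewrite ler_pdivlMr ?ltr_wpDl// => h.
rewrite (le_trans _ h)// mulrDr mulr1 mulrC.
by have := ler_wpM2l (normr_ge0 (x - y)) (ler_norm L); have := normr_ge0 (x - y); lra.
Qed.

Lemma lip1_measurable M L g : lip1 M L g -> measurable_fun setT g.
Proof. by move=> /lip1_continuous; exact: continuous_measurable_fun. Qed.

(* H is the limit of its values on rational grids, which take countably many values *)
Lemma measurable_seqlip {d : measure_display} {T : measurableType d}
  (X : nat -> T -> R) n M L H : seqlip n M L H ->
  (forall i, (i < n)%N -> measurable_fun setT (X i)) ->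
  measurable_fun setT (fun w => H (mkseq (X ^~ w) n)).
Proof.
move=> [HM HL] mX.
pose q (k : nat) (w : T) : seq int := mkseq (fun i => Num.floor (k.+1%:R * X i w)) n.
pose h (k : nat) (w : T) : R := H [seq x%:~R / k.+1%:R | x <- q k w].
apply: (@measurable_fun_cvg _ _ _ _ h) => [k|w _].
- move=> _ B mB; rewrite setTI.
  have -> : h k @^-1` B = \bigcup_(z : seq int)
      (if H [seq x%:~R / k.+1%:R | x <- z] \in B then [set w | q k w = z] else set0).
    apply/seteqP; split=> w /=.
      by move=> hB; exists (q k w) => //; rewrite ifT//; apply/mem_set.
    by move=> [z _]; case: ifPn => // /set_mem hB /= qz; rewrite /h qz.
  apply: countable_bigcupT_measurable => [|z]; first exact: countableP.
  case: ifP => // _; have [sz|sz] := eqVneq (size z) n; last first.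
    rewrite (_ : [set w | _] = set0)//; apply/seteqP; split=> // w /= qz.
    by move: sz; rewrite -qz size_mkseq eqxx.
  have -> : [set w | q k w = z] = \bigcap_(i in `I_n)
      (fun w => Num.floor (k.+1%:R * X i w)) @^-1` [set nth 0 z i].
    apply/seteqP; split=> w /=.
      by move=> qz i /= ni; rewrite -qz nth_mkseq.
    move=> h'; apply: (@eq_from_nth _ 0); rewrite size_mkseq ?sz// => i ilt.
    by rewrite nth_mkseq//; exact: (h' i ilt).
  apply: fin_bigcap_measurable; first exact: finite_II.
  move=> i /= ni.
  have -> : (fun w => Num.floor (k.+1%:R * X i w)) @^-1` [set nth 0 z i] =
    (fun w => k.+1%:R * X i w) @^-1` `[(nth 0 z i)%:~R, (nth 0 z i + 1)%:~R[.
    apply/seteqP; split=> w /=; rewrite in_itv/= => h'.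
      by rewrite -h' floor_itv.
    by apply: floor_def.
  rewrite -[X in measurable X]setTI.
  by apply: measurable_funM => //; exact: mX.
- apply/cvgrPdist_le => /= e e0; near=> k.
  rewrite /h; apply: (le_trans (HL _ _ _ _)); rewrite ?size_map ?size_iota//.
  rewrite /q /mkseq -map_comp.
  have D : l1dist [seq X i w | i <- iota 0 n]
      [seq ((fun x : int => x%:~R / k.+1%:R) \o (fun i => Num.floor (k.+1%:R * X i w))) i | i <- iota 0 n]
      <= k.+1%:R^-1 *+ n.
    have := @l1dist_map_le (X ^~ w) ((fun x : int => x%:~R / k.+1%:R) \o (fun i => Num.floor (k.+1%:R * X i w))) k.+1%:R^-1 (iota 0 n).
    rewrite size_iota; apply => i _ /=.
    have k0 : 0 < k.+1%:R :> R by rewrite ltr0n.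
    rewrite -(ler_pM2l k0) divff ?gt_eqF// -[X in X * _](gtr0_norm k0) -normrM.
    rewrite mulrBr mulrCA divff ?gt_eqF// mulr1.
    have /andP[] := floor_itv (k.+1%:R * X i w).
    rewrite intrD; set a := _%:~R => h1 h2.
    by rewrite ger0_norm; lra.
  apply: (@le_trans _ _ (`|L| * (k.+1%:R^-1 *+ n))).
    by rewrite (le_trans (ler_wpM2r (l1dist_ge0 _ _) (ler_norm L)))// ler_wpM2l.
  rewrite -(mulr_natl _ n) mulrA ler_pdivrMr ?ltr0n// mulrC -ler_pdivrMl// mulrC.
  near: k.
  exists (Num.truncn (`|L| * n%:R / e)).+1 => // k /= Nk.
  by rewrite ltW// (lt_le_trans (truncnS_gt _))// ler_nat ltnW// mulrC.
Unshelve. all: by end_near. Qed.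

End seqlip.

(** * Independence, Fubini and image laws *)

Section indep.
Context {R : realType} {d : measure_display} {T : measurableType d}.
Variable P : probability T R.

(** Agreement on rectangles makes the law of [(U, V)] the product of the two laws. The second
    variable is integrated over another copy of [T], so no product space appears in the
    conclusion. *)
Lemma independent_Fubini {d1 d2 : measure_display} {T1 : measurableType d1}
  {T2 : measurableType d2} (U : T -> T1) (V : T -> T2) (h : T1 * T2 -> R) (M : R) :
  measurable_fun setT U -> measurable_fun setT V ->
  (forall A B, measurable A -> measurable B ->
     P (U @^-1` A `&` V @^-1` B) = (P (U @^-1` A) * P (V @^-1` B))%E) ->
  measurable_fun setT h -> (forall z, `|h z| <= M) ->
  \int[P]_w h (U w, V w) = \int[P]_w \int[P]_w' h (U w, V w').
Proof.
move=> mU mV UV mh hM.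
pose U' : {mfun T >-> T1} := HB.pack U (isMeasurableFun.Build _ _ _ _ U mU).
pose V' : {mfun T >-> T2} := HB.pack V (isMeasurableFun.Build _ _ _ _ V mV).
have mW : measurable_fun setT (fun w => (U w, V w)) by exact: measurable_fun_pair.
pose W' : {mfun T >-> (T1 * T2)%type} :=
  HB.pack (fun w => (U w, V w)) (isMeasurableFun.Build _ _ _ _ _ mW).
have D X : measurable X -> (distribution P U' \x distribution P V')%E X = distribution P W' X.
  apply: product_measure_unique => A B mA mB.
  by rewrite /distribution /pushforward /= -UV//.
have meh : measurable_fun setT (EFin \o h) by exact/measurable_EFinP.
have ih (m : probability (T1 * T2)%type R) : m.-integrable setT (EFin \o h).
  exact: bounded_integrable hM.
have iP d0 (T0 : measurableType d0) (Q : probability T0 R) (f : T0 -> R) :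
  measurable_fun setT f -> (forall x, `|f x| <= M) ->
    (\int[Q]_x (f x)%:E)%E = (\int[Q]_x f x)%:E.
  move=> mf fM; rewrite /Rintegral fineK//.
  apply: integrable_fin_num => //.
  exact: (bounded_integrable _ mf fM).
have i2 : (distribution P U' \x distribution P V')%E.-integrable setT (EFin \o h).
  apply/integrableP; split=> //.
  have /integrableP[_] := ih (distribution P W').
  by rewrite (eq_measure_integral _ (fun X mX _ => D X mX)).
have m1 x : measurable_fun setT (fun y => h (x, y)) by exact: measurableT_comp.
have FE x : (\int[distribution P V']_y (h (x, y))%:E = (\int[P]_w' h (x, V w'))%:E)%E.
  have := @integral_distribution _ _ _ _ _ P V' (fun y => (h (x, y))%:E).
  move=> ->; last 2 first.
  - exact/measurable_EFinP.
  - apply: (@bounded_integrable _ _ _ P (fun w => h (x, V w)) M) => //.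
    exact: (measurableT_comp (m1 x) mV).
  by rewrite [LHS]iP//; exact: (measurableT_comp (m1 x) mV).
have mF : measurable_fun setT (fun x => (\int[P]_w' h (x, V w'))%:E).
  have := measurable_fubini_F i2; congr (measurable_fun _ _).
  by apply/funext => x; rewrite /fubini_F -FE.
congr fine.
have := @integral_distribution _ _ _ _ _ P W' (EFin \o h).
rewrite /= => <-//; last first.
  by apply: (@bounded_integrable _ _ _ P (fun w => h (U w, V w)) M) => //;
    exact: measurableT_comp.
rewrite (eq_measure_integral (distribution P U' \x distribution P V')%E); last first.
  by move=> X mX _; exact: (esym (D X mX)).
rewrite -integral12_prod_meas1// /fubini_F.
rewrite (eq_integral (fun x => (\int[P]_w' h (x, V w'))%:E)); last first.
  by move=> x _; rewrite -FE.
rewrite integral_distribution//.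
apply: (@bounded_integrable _ _ _ P (fun w => \int[P]_w' h (U w, V w')) M).
  by apply/measurable_EFinP; exact: (measurableT_comp mF mU).
move=> w; apply: expectation_bound => // .
exact: (measurableT_comp (m1 (U w)) mV).
Qed.

Lemma integral_law {d1 : measure_display} {T1 : measurableType d1} (V : T -> T1)
  (m : probability T1 R) (g : T1 -> \bar R) :
  measurable_fun setT V -> (forall B, measurable B -> P (V @^-1` B) = m B) ->
  measurable_fun setT g -> P.-integrable setT (g \o V) ->
  (\int[P]_w g (V w) = \int[m]_y g y)%E.
Proof.
move=> mV Vm mg ig.
pose V' : {mfun T >-> T1} := HB.pack V (isMeasurableFun.Build _ _ _ _ V mV).
rewrite -(@integral_distribution _ _ _ _ _ P V' g mg ig).
by apply: eq_measure_integral => B mB _; exact: Vm.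
Qed.

Lemma ge0_integral_law {d1 : measure_display} {T1 : measurableType d1} (V : T -> T1)
  (m : probability T1 R) (g : T1 -> \bar R) :
  measurable_fun setT V -> (forall B, measurable B -> P (V @^-1` B) = m B) ->
  measurable_fun setT g -> (forall y, 0 <= g y)%E ->
  (\int[P]_w g (V w) = \int[m]_y g y)%E.
Proof.
move=> mV Vm mg g0.
pose V' : {mfun T >-> T1} := HB.pack V (isMeasurableFun.Build _ _ _ _ V mV).
rewrite -(@ge0_integral_distribution _ _ _ _ _ P V' g mg g0).
by apply: eq_measure_integral => B mB _; exact: Vm.
Qed.

Lemma eq_law_Rintegral {d1 : measure_display} {T1 : measurableType d1} (U V : T -> T1)
  (g : T1 -> R) (M : R) :
  measurable_fun setT U -> measurable_fun setT V ->
  (forall B, measurable B -> P (U @^-1` B) = P (V @^-1` B)) ->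
  measurable_fun setT g -> (forall y, `|g y| <= M) ->
  \int[P]_w g (U w) = \int[P]_w g (V w).
Proof.
move=> mU mV UV mg gM.
pose V' : {mfun T >-> T1} := HB.pack V (isMeasurableFun.Build _ _ _ _ V mV).
have mge : measurable_fun setT (EFin \o g) by exact/measurable_EFinP.
have iW (W : T -> T1) : measurable_fun setT W -> P.-integrable setT ((EFin \o g) \o W).
  move=> mW; apply: (@bounded_integrable _ _ _ P (g \o W) M) => [|w].
    exact: (measurableT_comp mg mW).
  exact: gM.
have E1 := @integral_law _ _ U (distribution P V') (EFin \o g) mU UV mge (iW _ mU).
have E2 := @integral_distribution _ _ _ _ _ P V' (EFin \o g) mge (iW _ mV).
by congr fine; rewrite [LHS]E1 E2.
Qed.

End indep.

(** * Expectations over independent samples *)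

(** Every nested integral runs over the same space [T]; this supplies independent copies of [X]
    without building a product of probability spaces. *)
Fixpoint iterE {R : realType} {d : measure_display} {T : measurableType d}
    (P : probability T R) (X : T -> R) (n : nat) (H : seq R -> R) : R :=
  if n is m.+1 then \int[P]_w iterE P X m (fun s => H (X w :: s)) else H [::].

Section iterE.
Context {R : realType} {d : measure_display} {T : measurableType d}.
Variables (P : probability T R) (X : T -> R).
Hypothesis mX : measurable_fun setT X.
Implicit Types H : seq R -> R.
Local Notation iterE := (iterE P X).

Lemma iterE_cat a b H :
  iterE (a + b) H = iterE a (fun s => iterE b (fun t => H (s ++ t))).
Proof. by elim: a H => //= a IH H; apply: eq_Rintegral => w _; rewrite IH. Qed.

Lemma eq_iterE n H H' : (forall s, size s = n -> H s = H' s) ->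
  iterE n H = iterE n H'.
Proof.
elim: n H H' => [|n IH] H H' HH' /=; first exact: HH'.
by apply: eq_Rintegral => w _; apply: IH => s sn; rewrite HH'//= sn.
Qed.

Lemma iterE_rcons n H :
  iterE n.+1 H = iterE n (fun s => \int[P]_w H (rcons s (X w))).
Proof.
elim: n H => //= n IH H; apply: eq_Rintegral => w _.
exact: (IH (fun s => H (X w :: s))).
Qed.

Lemma iterE_cst n (c : R) : iterE n (fun=> c) = c.
Proof.
elim: n => //= n IH; under eq_Rintegral do rewrite IH.
exact: Rintegral_prob_cst.
Qed.

(** Comparing integrals requires the inner ones to be integrable. As functions of the first sample
    they are again bounded and Lipschitz, by this very bound for shorter sequences, so integrability
    is proved inside the induction. *)
Lemma iterE_dist n H H' (M L M' L' c : R) : seqlip n M L H -> seqlip n M' L' H' ->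
  (forall s, size s = n -> `|H s - H' s| <= c) -> `|iterE n H - iterE n H'| <= c.
Proof.
elim: n H H' M L M' L' c => [|n IH] H H' M L M' L' c HL HL' HH' /=; first exact: HH'.
have I (G : seq R -> R) K Q : seqlip n.+1 K Q G ->
    P.-integrable setT (EFin \o (fun w => iterE n (fun s => G (X w :: s)))).
  move=> GK; have GL : lip1 K Q (fun x => iterE n (fun s => G (x :: s))).
    split=> [x|x y].
      rewrite -[X in `|X|]subr0 -(iterE_cst n 0).
      apply: (IH _ _ K Q 0 0); [exact: seqlip_cons| |].
        by split=> *; rewrite ?subrr normr0 ?mul0r.
      by move=> s sn; rewrite subr0; case: GK => + _; apply; rewrite /= sn.
    apply: (IH _ _ K Q K Q); [exact: seqlip_cons|exact: seqlip_cons|].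
    move=> s sn; case: GK => _ /(_ (x :: s) (y :: s)) /=.
    by rewrite l1distxx addr0 sn; exact.
  apply: (@bounded_integrable _ _ _ P
    (fun w => iterE n (fun s => G (X w :: s))) K) => [|w].
    exact: (measurableT_comp (lip1_measurable GL) mX).
  exact: GL.1.
apply: expectation_dist; [exact: I HL|exact: I HL'|move=> w].
apply: IH; [exact: seqlip_cons HL|exact: seqlip_cons HL'|].
by move=> s sn; apply: HH'; rewrite /= sn.
Qed.

Lemma iterE_lip1 n (M L : R) H : seqlip n.+1 M L H ->
  lip1 M L (fun x => iterE n (fun s => H (x :: s))).
Proof.
move=> HL; split=> [x|x y].
  rewrite -[X in `|X|]subr0 -(iterE_cst n 0).
  apply: (iterE_dist (seqlip_cons _ HL) (M' := 0) (L' := 0)).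
    by split=> *; rewrite ?subrr normr0 ?mul0r.
  by move=> s sn; rewrite subr0; case: HL => + _; apply; rewrite /= sn.
apply: (iterE_dist (seqlip_cons _ HL) (seqlip_cons _ HL)).
move=> s sn; case: HL => _ /(_ (x :: s) (y :: s)) /=.
by rewrite l1distxx addr0 sn; exact.
Qed.

Lemma lip1_integrable (g : R -> R) (M L : R) : lip1 M L g ->
  P.-integrable setT (EFin \o (fun w => g (X w))).
Proof.
move=> gL; apply: (@bounded_integrable _ _ _ P (fun w => g (X w)) M) => [|w].
  exact: (measurableT_comp (lip1_measurable gL) mX).
exact: gL.1.
Qed.

Lemma iterE_integrable n (M L : R) H : seqlip n.+1 M L H ->
  P.-integrable setT (EFin \o (fun w => iterE n (fun s => H (X w :: s)))).
Proof. by move=> /iterE_lip1 /lip1_integrable. Qed.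

Lemma le_iterE n H H' (M L M' L' : R) : seqlip n M L H -> seqlip n M' L' H' ->
  (forall s, size s = n -> H s <= H' s) -> iterE n H <= iterE n H'.
Proof.
elim: n H H' M L M' L' => [|n IH] H H' M L M' L' HL HL' HH' /=; first exact: HH'.
apply: le_expectation; [exact: iterE_integrable HL|exact: iterE_integrable HL'|].
move=> w; apply: IH; [exact: seqlip_cons HL|exact: seqlip_cons HL'|].
by move=> s sn; apply: HH'; rewrite /= sn.
Qed.

Lemma iterE_affine n H (M L a c : R) : seqlip n M L H ->
  iterE n (fun s => a * H s + c) = a * iterE n H + c.
Proof.
elim: n H => [|n IH] H HL //=.
have I := iterE_integrable HL.
under eq_Rintegral do rewrite (IH _ (seqlip_cons _ HL)).
rewrite RintegralD//.
- by rewrite RintegralZl// Rintegral_prob_cst.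
- by have := integrableZl measurableT a I.
- exact: finite_measure_integrable_cst.
Qed.

End iterE.

(** * From independent identically distributed sequences to iterated integrals *)

Definition iid {R : realType} {d : measure_display} {T : measurableType d}
    (P : probability T R) (X : nat -> T -> R) : Prop :=
  (forall k, measurable_fun setT (X k)) /\
  (forall n, mutually_indep P (fun i : 'I_n => X i)) /\
  (forall k (B : set R), measurable B -> P (X k @^-1` B) = P (X 0%N @^-1` B)).

Section iid.
Context {R : realType} {d : measure_display} {T : measurableType d}.
Variables (P : probability T R) (X : nat -> T -> R).
Hypothesis XP : iid P X.

(** Product events of the first [n] variables: closed under intersection, and generating the
    sigma-algebra of the past. *)
Definition cylinders n : set (set T) := [set A | exists2 B : nat -> set R,
  (forall i, measurable (B i)) & A = \bigcap_(i in `I_n) X i @^-1` B i].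

Lemma measurable_preimage_iid k (B : set R) : measurable B -> measurable (X k @^-1` B).
Proof. by move=> mB; rewrite -[X in measurable X]setTI; apply: XP.1. Qed.

Lemma cylinders_measurable n : cylinders n `<=` measurable.
Proof.
move=> _ [B mB ->]; apply: fin_bigcap_measurable; first exact: finite_II.
by move=> i _; exact: measurable_preimage_iid.
Qed.

Lemma cylinders_setI n : setI_closed (cylinders n).
Proof.
move=> _ _ [A mA ->] [B mB ->]; exists (fun i => A i `&` B i) => [i|].
  exact: measurableI.
by rewrite -bigcapI; apply: eq_bigcapr => i _; rewrite preimage_setI.
Qed.

Lemma cylindersT n : cylinders n setT.
Proof.
by exists (fun=> setT) => //; apply/esym/seteqP; split.
Qed.

Lemma cylinders_indep n A B : cylinders n A -> measurable B ->
  P (A `&` X n @^-1` B) = (P A * P (X n @^-1` B))%E.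
Proof.
move=> [C mC ->] mB.
have E (D : set R) : measurable D ->
    P (\bigcap_(i in `I_n) X i @^-1` C i `&` X n @^-1` D) =
    (\prod_(i < n) P (X i @^-1` C i) * P (X n @^-1` D))%E.
  move=> mD; have := XP.2.1 n.+1 (fun i => if i == n :> nat then D else C i).
  rewrite big_ord_recr/= eqxx.
  under eq_bigr => i _ do rewrite ltn_eqF//.
  move=> <-; last by move=> i; case: ifP.
    congr (P _); apply/seteqP; split=> [w [wC wD] i _ /=|w wi].
      case: ifPn => [/eqP -> //|ni]; apply: wC.
      by rewrite /= ltn_neqAle ni/= -ltnS ltn_ord.
    split=> [i /= ni|]; last by have := wi ord_max I; rewrite /= eqxx.
    have := wi (widen_ord (leqnSn n) (Ordinal ni)) I; rewrite /= ifN//.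
    by rewrite ltn_eqF.
(* Taking the whole line as the last set factorises the probability of the cylinder itself. *)
have := E setT measurableT; rewrite preimage_setT setIT probability_setT mule1 => ->.
exact: E.
Qed.

(** As functions of [A], the left side is the restriction of [P] to an event and the right side a
    multiple of [P]. Two finite measures that agree on the cylinders agree on the sigma-algebra they
    generate. *)
Lemma sigma_cylinders_indep n A B : <<s cylinders n >> A -> measurable B ->
  P (A `&` X n @^-1` B) = (P A * P (X n @^-1` B))%E.
Proof.
move=> sA mB.
have mXB := measurable_preimage_iid n mB.
have [r Pr] : exists r : {nonneg R}, P (X n @^-1` B) = r%:num%:E.
  have r0 : 0 <= fine (P (X n @^-1` B)) by rewrite fine_ge0.
  by exists (NngNum r0); rewrite /= fineK// fin_num_measure.
suff : mrestr P mXB A = mscale r P A by rewrite /mrestr/= /mscale/= Pr muleC.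
apply: (@g_sigma_algebra_measure_unique _ _ _ (cylinders n) _ (fun=> setT)) => //.
- exact: cylinders_measurable.
- by move=> _; exact: cylindersT.
- by apply/seteqP; split=> // x _; exists 0%N.
- exact: cylinders_setI.
- by move=> C nC; have := cylinders_indep nC mB; rewrite Pr muleC.
- move=> k; change (P (setT `&` X n @^-1` B) < +oo)%E.
  by rewrite setTI Pr ltry.
Qed.

(** The past is encoded as the identity map from [T] to [T] with the cylinder sigma-algebra. It is a
    random variable independent of [X n], so the Fubini lemma applies without a type of random
    vectors. *)
Lemma iid_last n H (M L : R) : seqlip n.+1 M L H ->
  \int[P]_w H (mkseq (X ^~ w) n.+1) =
  \int[P]_w \int[P]_w' H (rcons (mkseq (X ^~ w) n) (X 0%N w')).
Proof.
move=> HL.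
pose Ts : measurableType _ := g_sigma_algebraType (cylinders n).
have mid : measurable_fun setT (id : T -> Ts).
  move=> _ B mB; rewrite setTI preimage_id.
  have : <<s cylinders n >> B by [].
  by apply: smallest_sub; [exact: sigma_algebra_measurable|exact: cylinders_measurable].
have mXs i : (i < n)%N -> measurable_fun setT (X i : Ts -> R).
  move=> ni _ B mB; rewrite setTI; apply: sub_sigma_algebra.
  exists (fun j => if j == i then B else setT) => [j|]; first by case: ifP.
  apply/seteqP; split=> [w wB j _ /=|w /(_ i ni)/=]; last by rewrite eqxx.
  by case: ifP => // /eqP ->.
pose Y (i : nat) (z : Ts * R) := if (i < n)%N then X i z.1 else z.2.
pose h (z : Ts * R) := H (mkseq (Y ^~ z) n.+1).
have mh : measurable_fun setT h.
  apply: (measurable_seqlip HL) => i _; rewrite /Y; case: (boolP (i < n)%N) => ni.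
    exact: (measurableT_comp (mXs _ ni) measurable_fst).
  exact: measurable_snd.
have mkE w y : mkseq (Y ^~ (w, y)) n.+1 = rcons (mkseq (X ^~ w) n) y.
  rewrite mkseqS; congr rcons; last by rewrite /Y ltnn.
  by apply: (@eq_from_nth _ 0); rewrite !size_mkseq// => i ni; rewrite !nth_mkseq// /Y ni.
transitivity (\int[P]_w h (w, X n w)).
  by apply: eq_Rintegral => w _; rewrite /h mkE mkseqS.
have hM z : `|h z| <= M by rewrite /h; case: HL => + _; apply; rewrite size_mkseq.
rewrite (@independent_Fubini _ _ _ P _ _ Ts _ id (X n) h M) //; last 2 first.
- exact: XP.1.
- by move=> A B mA mB; rewrite preimage_id sigma_cylinders_indep.
apply: eq_Rintegral => w _.
under [RHS]eq_Rintegral do rewrite -mkE.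
apply: (@eq_law_Rintegral _ _ _ P _ _ (X n) (X 0%N) (fun y => h (w, y)) M) => //.
- exact: XP.1.
- exact: XP.1.
- exact: XP.2.2.
apply: (measurableT_comp mh); exact: measurable_fun_pair.
Qed.

(** Variables are peeled off from the end, since the last one is independent of the past.
    Integrating it out leaves a bounded Lipschitz function of the others with the same constants. *)
Lemma iid_iterE n H (M L : R) : seqlip n M L H ->
  \int[P]_w H (mkseq (X ^~ w) n) = iterE P (X 0%N) n H.
Proof.
elim: n H => [|n IH] H HL; first exact: (Rintegral_prob_cst P (H [::])).
rewrite (iid_last HL) iterE_rcons.
apply: (IH (fun s => \int[P]_w H (rcons s (X 0%N w)))).
have lipr s : size s = n -> lip1 M L (fun x => H (rcons s x)).
  case: HL => HM HL sn; split=> [x|x y]; first by rewrite HM// size_rcons sn.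
  have := HL (rcons s x) (rcons s y); rewrite !size_rcons sn => /(_ erefl erefl).
  by rewrite -!cats1 l1dist_cat// l1distxx add0r /= addr0.
split=> [s sn|s t sn tn].
  apply: expectation_bound => [|w]; last by case: (lipr s sn) => + _; exact.
  exact: (measurableT_comp (lip1_measurable (lipr s sn)) (XP.1 0%N)).
apply: expectation_dist => [||w].
- exact: (lip1_integrable P (XP.1 0%N) (lipr s sn)).
- exact: (lip1_integrable P (XP.1 0%N) (lipr t tn)).
case: HL => _ /(_ (rcons s (X 0%N w)) (rcons t (X 0%N w))).
rewrite !size_rcons sn tn => /(_ erefl erefl).
by rewrite -!cats1 l1dist_cat ?sn ?tn//= subrr normr0 !addr0.
Qed.

End iid.

(** * Ottaviani's maximal inequality *)

Section truncations.
Context {R : realType}.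
Implicit Types x y c : R.

Definition clamp x : R := Num.min 1 (Num.max 0 x).
(* Lipschitz cutoffs: [far] rises from 0 to 1 on [2 <= |x| <= 3], [medium] on [1/2 <= |x| <= 1] *)
Definition far x : R := clamp (`|x| - 2).
Definition medium x : R := clamp (2 * `|x| - 1).
(** [1 - cauchy_kernel x] is [x^2 / (1 + x^2)]: like the square near 0, yet at most 1. *)
Definition cauchy_kernel x : R := (1 + x ^+ 2)^-1.

Lemma clamp_ge0 x : 0 <= clamp x.
Proof. by rewrite /clamp le_min ler01 le_max lexx. Qed.

Lemma clamp_le1 x : clamp x <= 1.
Proof. by rewrite /clamp ge_min lexx. Qed.

Lemma clamp_norm_le1 x : `|clamp x| <= 1.
Proof. by rewrite ger0_norm ?clamp_ge0 ?clamp_le1. Qed.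

Lemma clamp_eq0 x : x <= 0 -> clamp x = 0.
Proof. by move=> x0; rewrite /clamp max_l// min_r// ler01. Qed.

Lemma clamp_eq1 x : 1 <= x -> clamp x = 1.
Proof. by move=> x1; rewrite /clamp min_l// le_max x1 orbT. Qed.

Lemma max_dist a b a' b' c : `|a - a'| <= c -> `|b - b'| <= c ->
  `|Num.max a b - Num.max a' b'| <= c.
Proof.
rewrite !ler_norml => /andP[h1 h2] /andP[h3 h4].
by case: (leP a b) => ?; case: (leP a' b') => ?; apply/andP; split; lra.
Qed.

Lemma min_dist a b a' b' c : `|a - a'| <= c -> `|b - b'| <= c ->
  `|Num.min a b - Num.min a' b'| <= c.
Proof.
rewrite !ler_norml => /andP[h1 h2] /andP[h3 h4].
by case: (leP a b) => ?; case: (leP a' b') => ?; apply/andP; split; lra.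
Qed.

Lemma clamp_dist x y : `|clamp x - clamp y| <= `|x - y|.
Proof.
by apply: min_dist; [|apply: max_dist => //]; rewrite subrr normr0.
Qed.

Lemma lip1_far c : lip1 1 `|c| (fun x => far (c * x)).
Proof.
split=> [x|x y]; first exact: clamp_norm_le1.
apply: (le_trans (clamp_dist _ _)).
rewrite -normrM mulrBr; apply: le_trans (ler_dist_dist _ _).
by rewrite opprB addrA subrK.
Qed.

Lemma lip1_medium c : lip1 1 (2 * `|c|) (fun x => medium (c * x)).
Proof.
split=> [x|x y]; first exact: clamp_norm_le1.
apply: (le_trans (clamp_dist _ _)).
rewrite -mulrA -normrM mulrBr.
have -> : 2 * `|c * x| - 1 - (2 * `|c * y| - 1) = 2 * (`|c * x| - `|c * y|) by ring.
by rewrite normrM ger0_norm// ler_wpM2l// ler_dist_dist.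
Qed.

Lemma cauchy_kernel_gt0 x : 0 < cauchy_kernel x.
Proof. by rewrite invr_gt0 ltr_pwDl// sqr_ge0. Qed.

Lemma cauchy_kernel_le1 x : cauchy_kernel x <= 1.
Proof. by rewrite invf_le1 ?ltr_pwDl ?sqr_ge0// lerDl sqr_ge0. Qed.

Lemma cauchy_kernelM x : cauchy_kernel x * (1 + x ^+ 2) = 1.
Proof. by rewrite mulVf// gt_eqF// ltr_pwDl// sqr_ge0. Qed.

(* tangent-line bound for the convex function [u |-> 1 / (1 + u)] at [u = x ^+ 2] *)
Lemma cauchy_kernel_tangent x y :
  cauchy_kernel x - 2 * x * cauchy_kernel x ^+ 2 * y - y ^+ 2 <= cauchy_kernel (x + y).
Proof.
have Ex := cauchy_kernelM x; have Ey := cauchy_kernelM (x + y).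
have x0 := cauchy_kernel_gt0 x; have x1 := cauchy_kernel_le1 x.
have y0 := cauchy_kernel_gt0 (x + y).
set a := cauchy_kernel x in Ex x0 x1 *; set b := cauchy_kernel (x + y) in Ey y0 *.
have h : a - a ^+ 2 * ((x + y) ^+ 2 - x ^+ 2) <= b.
  rewrite -subr_ge0.
  have -> : b - (a - a ^+ 2 * ((x + y) ^+ 2 - x ^+ 2)) =
     b * (1 - a * (1 + (x + y) ^+ 2)) ^+ 2.
    have -> : b * (1 - a * (1 + (x + y) ^+ 2)) ^+ 2 =
      b - 2 * a * (b * (1 + (x + y) ^+ 2)) +
      a ^+ 2 * (b * (1 + (x + y) ^+ 2)) * (1 + (x + y) ^+ 2) by ring.
    rewrite Ey.
    have : a ^+ 2 * (1 + x ^+ 2) = a by rewrite expr2 -mulrA Ex mulr1.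
    lra.
  by rewrite mulr_ge0 ?sqr_ge0// ltW.
apply: le_trans h.
have a2 : a ^+ 2 <= 1 by rewrite expr_le1// ltW.
have : a ^+ 2 * y ^+ 2 <= y ^+ 2 by rewrite ler_piMl ?sqr_ge0.
by rewrite sqrrD; lra.
Qed.

Lemma lip1_cauchy_kernel c : lip1 1 `|c| (fun x => cauchy_kernel (c * x)).
Proof.
split=> [x|x y].
  by rewrite ger0_norm ?cauchy_kernel_le1// ltW ?cauchy_kernel_gt0.
rewrite -normrM mulrBr; move: (c * x) (c * y) => {}x {}y.
have Ex := cauchy_kernelM x; have Ey := cauchy_kernelM y.
have x0 := cauchy_kernel_gt0 x; have y0 := cauchy_kernel_gt0 y.
set a := cauchy_kernel x in Ex x0 *; set b := cauchy_kernel y in Ey y0 *.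
have -> : a - b = (a * b) * (y + x) * (y - x).
  transitivity (a * (b * (1 + y ^+ 2)) - b * (a * (1 + x ^+ 2))); last by ring.
  by rewrite Ex Ey !mulr1.
rewrite normrM distrC ler_piMl// normrM gtr0_norm ?mulr_gt0//.
have h : `|y + x| <= (1 + x ^+ 2) * (1 + y ^+ 2).
  rewrite ler_norml; apply/andP; split.
    have := sqr_ge0 (1 + x); have := sqr_ge0 (1 + y); have := mulr_ge0 (sqr_ge0 x) (sqr_ge0 y); nra.
  have := sqr_ge0 (1 - x); have := sqr_ge0 (1 - y); have := mulr_ge0 (sqr_ge0 x) (sqr_ge0 y); nra.
apply: (@le_trans _ _ (a * b * ((1 + x ^+ 2) * (1 + y ^+ 2)))).
  by rewrite ler_wpM2l// mulr_ge0// ltW.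
by rewrite mulrACA Ex Ey mulr1.
Qed.

(** [medium] vanishes for [|x| <= 1/2]; beyond that, [x^2 / (1 + x^2)] is at least [1/5]. *)
Lemma medium_le x : medium x <= 5 * (1 - cauchy_kernel x).
Proof.
have Ex := cauchy_kernelM x; have x1 := cauchy_kernel_le1 x.
have x0 := cauchy_kernel_gt0 x.
have [h|h] := leP (2 * `|x| - 1) 0.
  by rewrite /medium clamp_eq0//; lra.
apply: (le_trans (clamp_le1 _)).
have : 1/4 <= x ^+ 2 by rewrite -real_normK ?num_real//; nra.
nra.
Qed.

(** From beyond 2 a walk ends beyond 1 unless the remaining displacement [y] has size at least 1,
    and then [1 - cauchy_kernel y] is at least [1/2] and the left side is not positive. *)
Lemma medium_shift x y : 2 < `|x| -> 1 - 2 * (1 - cauchy_kernel y) <= medium (x + y).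
Proof.
move=> hx; have Ey := cauchy_kernelM y; have y0 := cauchy_kernel_gt0 y.
have [h|h] := leP 1 `|y|.
  apply: le_trans (clamp_ge0 _).
  have : 1 <= y ^+ 2 by rewrite -real_normK ?num_real// expr_ge1.
  nra.
rewrite /medium clamp_eq1; first by have := cauchy_kernel_le1 y; lra.
by have := ler_normB (x + y) y; rewrite addrK; lra.
Qed.

End truncations.

Section maxwalk.
Context {R : realType}.
Implicit Types (g : R -> R) (s t : seq R).

(** The maximum of [g] over the positions of the walk started at [x], in recursive form so that it
    unfolds one step at a time together with [iterE]. *)
Fixpoint maxwalk g x s : R :=
  if s is y :: s' then Num.max (g x) (maxwalk g (x + y) s') else g x.

Lemma maxwalk_ge0 g x s : (forall y, 0 <= g y) -> 0 <= maxwalk g x s.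
Proof. by move=> g0; case: s => [|y s] //=; rewrite le_max g0. Qed.

Lemma maxwalk_le1 g x s : (forall y, g y <= 1) -> maxwalk g x s <= 1.
Proof. by move=> g1; elim: s x => [|y s IH] x //=; rewrite ge_max g1 IH. Qed.

Lemma le_maxwalk g x s k : g (x + \sum_(y <- take k s) y) <= maxwalk g x s.
Proof.
elim: s x k => [|y s IH] x [|k] /=; rewrite ?big_nil ?addr0// le_max ?lexx//.
by rewrite big_cons addrA IH orbT.
Qed.

Lemma maxwalk_dist (L : R) g x y s t : 0 <= L ->
  (forall x y, `|g x - g y| <= L * `|x - y|) -> size s = size t ->
  `|maxwalk g x s - maxwalk g y t| <= L * (`|x - y| + l1dist s t).
Proof.
move=> L0 gL; elim: s x y t => [|a s IH] x y [|b t] //=; first by rewrite addr0.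
move=> [st]; apply: max_dist.
  apply: (le_trans (gL _ _)); rewrite ler_wpM2l// lerDl addr_ge0//.
  exact: l1dist_ge0.
apply: (le_trans (IH _ _ _ st)); rewrite ler_wpM2l// addrA lerD2r.
by rewrite opprD addrACA ler_normD.
Qed.

Lemma seqlip_maxwalk n (L : R) g x : 0 <= L -> (forall y, 0 <= g y) ->
  lip1 1 L g -> seqlip n 1 L (maxwalk g x).
Proof.
move=> L0 g0 [g1 gL]; split=> [s _|s t sn tn].
  rewrite ger0_norm ?maxwalk_ge0// maxwalk_le1// => y.
  exact: le_trans (ler_norm _) (g1 y).
by have := maxwalk_dist x x L0 gL (etrans sn (esym tn)); rewrite subrr normr0 add0r.
Qed.

End maxwalk.

Section ottaviani.
Context {R : realType} {d : measure_display} {T : measurableType d}.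
Variables (P : probability T R) (X : T -> R) (v c : R).
Hypothesis mX : measurable_fun setT X.
Hypothesis iX : P.-integrable setT (EFin \o X).
Hypothesis EX : \int[P]_w X w = 0.
Hypothesis iX2 : P.-integrable setT (EFin \o (fun w => X w ^+ 2)).
Hypothesis EX2 : \int[P]_w X w ^+ 2 = v.

(* replaces Chebyshev's inequality: unlike the square, this kernel is bounded and Lipschitz *)
Lemma iterE_cauchy_kernel n x : cauchy_kernel (c * x) - n%:R * (c ^+ 2 * v) <=
  iterE P X n (fun s => cauchy_kernel (c * (x + \sum_(y <- s) y))).
Proof.
have kl := lip1_cauchy_kernel c.
elim: n x => [|n IH] x /=; first by rewrite mul0r subr0 big_nil addr0.
set a := 2 * (c * x) * cauchy_kernel (c * x) ^+ 2 * c.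
set b := cauchy_kernel (c * x) - n%:R * (c ^+ 2 * v).
have i1 : P.-integrable setT (EFin \o (fun w => - a * X w)).
  exact: (integrableZl measurableT (- a) iX).
have i2 : P.-integrable setT (EFin \o (fun w => - c ^+ 2 * X w ^+ 2)).
  exact: (integrableZl measurableT (- c ^+ 2) iX2).
have ib : P.-integrable setT (EFin \o (fun _ : T => b)).
  exact: finite_measure_integrable_cst.
have i12 : P.-integrable setT (EFin \o (fun w => - a * X w + - c ^+ 2 * X w ^+ 2)).
  by have := integrableD measurableT i1 i2.
have i12b : P.-integrable setT (EFin \o (fun w => (- a * X w + - c ^+ 2 * X w ^+ 2) + b)).
  by have := integrableD measurableT i12 ib.
apply: (@le_trans _ _ (\int[P]_w ((- a * X w + - c ^+ 2 * X w ^+ 2) + b))).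
  rewrite RintegralD// Rintegral_prob_cst RintegralD// !RintegralZl// EX EX2 /b -natr1; lra.
have HL : seqlip n.+1 1 `|c| (fun s => cauchy_kernel (c * (x + \sum_(y <- s) y))).
  exact: (lip1_seqlip _ _ _ kl).
apply: le_expectation => //.   exact: (iterE_integrable P mX HL).
move=> w.
have -> : (fun s => cauchy_kernel (c * (x + \sum_(y <- X w :: s) y))) =
   (fun s => cauchy_kernel (c * (x + X w + \sum_(y <- s) y))).
  by apply/funext => s; rewrite big_cons addrA.
apply: le_trans (IH _); rewrite /b addrA lerD2r.
have := cauchy_kernel_tangent (c * x) (c * X w); rewrite -mulrDr exprMn /a; lra.
Qed.

Lemma iterE_medium n :
  iterE P X n (fun s => medium (c * \sum_(y <- s) y)) <= 5 * (n%:R * (c ^+ 2 * v)).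
Proof.
have kl : seqlip n 1 `|c| (fun s => cauchy_kernel (c * (0 + \sum_(y <- s) y))).
  exact: (lip1_seqlip _ _ _ (lip1_cauchy_kernel c)).
have ml : seqlip n 1 (2 * `|c|) (fun s => medium (c * (0 + \sum_(y <- s) y))).
  by apply: (lip1_seqlip _ _ _ (lip1_medium c)); rewrite mulr_ge0.
have := iterE_cauchy_kernel n 0.
have := iterE_affine P mX (-5) 5 kl.
set K := iterE _ _ _ (fun s => cauchy_kernel _) => E h.
apply: (@le_trans _ _ (-5 * K + 5)); last first.
  by move: h; rewrite mulr0 /cauchy_kernel expr0n addr0 invr1; lra.
rewrite -E.
under eq_iterE do rewrite -[X in c * X]add0r.
apply: (le_iterE P mX ml (M' := 10) (L' := 5 * `|c|)).
  case: kl => k1 k2; split=> [s sn|s t sn tn].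
    by have := k1 s sn; rewrite !ler_norml; lra.
  by have := k2 s t sn tn; rewrite !ler_norml; lra.
by move=> s _; have := medium_le (c * (0 + \sum_(y <- s) y)); lra.
Qed.

(** Induction on [n] replaces the first passage time. While [|c * x| <= 2] the cutoff [far] vanishes
    at [x] and the maximum passes to the next step; once the threshold is crossed, [big] makes the
    right side at least 1. *)
Lemma ottaviani n x : n%:R * (c ^+ 2 * v) <= 1/4 ->
  iterE P X n (maxwalk (fun x => far (c * x)) x) <=
  2 * iterE P X n (fun s => medium (c * (x + \sum_(y <- s) y))).
Proof.
have v0 : 0 <= v by rewrite -EX2; apply: Rintegral_ge0 => w _; exact: sqr_ge0.
have c2v : 0 <= c ^+ 2 * v by rewrite mulr_ge0// sqr_ge0.
have fl m z : seqlip m 1 `|c| (maxwalk (fun x => far (c * x)) z).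
  apply: seqlip_maxwalk => // [y|]; [exact: clamp_ge0|exact: lip1_far].
have ml m z : seqlip m 1 (2 * `|c|) (fun s => medium (c * (z + \sum_(y <- s) y))).
  by apply: (lip1_seqlip _ _ _ (lip1_medium c)); rewrite mulr_ge0.
(* The remaining displacement is small often enough: by [medium_shift] and the kernel estimate, the
   expectation of [medium] is at least [1 - 2 * (1/4) = 1/2]. This fixes both the hypothesis [1/4]
   and the factor 2. *)
have big m z : m%:R * (c ^+ 2 * v) <= 1/4 -> 2 < `|c * z| ->
    1 <= 2 * iterE P X m (fun s => medium (c * (z + \sum_(y <- s) y))).
  move=> mv hx.
  have kl : seqlip m 1 `|c| (fun s => cauchy_kernel (c * (0 + \sum_(y <- s) y))).
    exact: (lip1_seqlip _ _ _ (lip1_cauchy_kernel c)).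
  have := iterE_cauchy_kernel m 0.
  have := iterE_affine P mX 2 (-1) kl.
  set K := iterE _ _ _ (fun s => cauchy_kernel _) => E h.
  have hK : 2 * K - 1 <= iterE P X m (fun s => medium (c * (z + \sum_(y <- s) y))).
    rewrite -E; apply: (le_iterE P mX _ (ml m z) (M := 3) (L := 2 * `|c|)).
      case: kl => k1 k2; split=> [s sn|s t sn tn].
        by have := k1 s sn; rewrite !ler_norml; lra.
      by have := k2 s t sn tn; rewrite !ler_norml; lra.
    move=> s _; have := medium_shift (c * \sum_(y <- s) y) hx.
    by rewrite add0r (mulrDr c); lra.
  by move: h; rewrite mulr0 /cauchy_kernel expr0n addr0 invr1; lra.
elim: n x => [|n IH] x nv.
  rewrite /= big_nil addr0; have [h|h] := leP `|c * x| 2.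
    by rewrite /far clamp_eq0 ?subr_le0// mulr_ge0// clamp_ge0.
  apply: le_trans (clamp_le1 _) _.
  by have := big 0%N x nv h; rewrite /= big_nil addr0.
have nv' : n%:R * (c ^+ 2 * v) <= 1/4 by move: nv; rewrite -natr1; lra.
have [h|h] := leP `|c * x| 2; last first.
  apply: le_trans (big _ _ nv h).
  rewrite -[leRHS](iterE_cst P X n.+1).
  apply: (le_iterE P mX (fl _ _) (M' := 1) (L' := 0)).
    by split=> *; rewrite ?subrr ?normr0 ?mul0r ?normr1.
  by move=> s _; apply: maxwalk_le1 => y; exact: clamp_le1.
rewrite -RintegralZl//; last exact: (iterE_integrable P mX (ml n.+1 x)).
apply: le_expectation.
- exact: (iterE_integrable P mX (fl n.+1 x)).
- exact: (integrableZl measurableT 2 (iterE_integrable P mX (ml n.+1 x))).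
move=> w.
have -> : (fun s => medium (c * (x + \sum_(y <- X w :: s) y))) =
   (fun s => medium (c * (x + X w + \sum_(y <- s) y))).
  by apply/funext => s; rewrite big_cons addrA.
apply: le_trans (IH _ nv'); rewrite le_eqVlt; apply/orP; left; apply/eqP.
apply: eq_iterE => s sn /=.
rewrite max_r// {1}/far clamp_eq0 ?subr_le0// maxwalk_ge0// => y.
exact: clamp_ge0.
Qed.

End ottaviani.

(** * A central limit theorem uniform over Lipschitz functions *)

Section mean_value.
Context {R : realType}.

Lemma is_derive_MVT (f df : R -> R) (a b : R) :
  (forall x : R, is_derive x 1 f (df x)) ->
  exists c, [/\ Num.min a b <= c, c <= Num.max a b & f b - f a = df c * (b - a)].
Proof.
move=> fd.
have fc : continuous f.
  by move=> x; apply: differentiable_continuous; apply/derivable1_diffP; case: (fd x).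
have cw c d : {within `[c, d], continuous f} by exact: continuous_subspaceT.
have [ab|ba] := leP a b.
  have [c + cE] := @MVT_segment R f df a b ab (fun x _ => fd x) (cw a b).
  by rewrite in_itv/= => /andP[ac cb]; exists c; rewrite ac cb.
have [c + cE] := @MVT_segment R f df b a (ltW ba) (fun x _ => fd x) (cw b a).
rewrite in_itv/= => /andP[ac cb]; exists c; split=> //.
by rewrite -opprB cE -mulrN opprB.
Qed.

Lemma derive_bound_lip (f df : R -> R) (K : R) :
  (forall x : R, is_derive x 1 f (df x)) -> (forall x, `|df x| <= K) ->
  forall x y, `|f x - f y| <= K * `|x - y|.
Proof.
move=> fd dfK x y; have [c [_ _ ->]] := is_derive_MVT y x fd.
by rewrite normrM ler_wpM2r.
Qed.

End mean_value.

(** * Smoothing by moving averages, and Taylor's formula *)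

Section average.
Context {R : realType}.
Variables (g : R -> R) (M L h : R).
Hypotheses (gL : lip1 M L g) (h0 : 0 < h).
Local Notation mu := (@lebesgue_measure R).

(** The Steklov mean of [g]. Each averaging gains one derivative, and that derivative is a
    difference quotient of the averaged function, so it is bounded in terms of [M] or [L] and [h]
    alone. *)
Definition average (x : R) : R := h^-1 * \int[mu]_(t in `[x, x + h]) g t.

Let g_integrable (a b : R) : mu.-integrable `[a, b] (EFin \o g).
Proof.
apply: continuous_compact_integrable; first exact: segment_compact.
by apply: continuous_subspaceT; exact: lip1_continuous gL.
Qed.

Lemma averageE (a x : R) : a <= x -> average x =
  h^-1 * (\int[mu]_(t in `[a, x + h]) g t - \int[mu]_(t in `[a, x]) g t).
Proof.
move=> ax; rewrite /average.
have := @Rintegral_itvB R g (BLeft a) (BRight (x + h)) x (g_integrable _ _).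
rewrite !bnd_simp lerDl => /(_ ax (ltW h0)) ->.
rewrite Rintegral_itv_obnd_cbnd//.
by apply: integrableS (g_integrable x (x + h)) => //; exact: subset_itv_oc_cc.
Qed.

Lemma is_derive_average (x : R) : is_derive x 1 average ((g (x + h) - g x) / h).
Proof.
(* The fundamental theorem of calculus is used at interior points of an interval with fixed left
   end; [x - 1] lies strictly to the left of both [x] and [x + h]. *)
pose F (y : R) := \int[mu]_(t in `[x - 1, y]) g t.
have dF y : x - 1 < y -> is_derive y 1 F (g y).
  move=> xy.
  have [|//||D1 D2] := @continuous_FTC1_closed R g (x - 1) y (y + 1) _ (g_integrable _ _) _ _.
  - by rewrite ltrDl.
  - exact: (lip1_continuous gL).
  by apply: DeriveDef => //; rewrite -derive1E.
apply: (@near_eq_is_derive _ _ _ (fun y => h^-1 * (F (y + h) - F y))).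
  near=> y; rewrite (@averageE (x - 1))//.
  near: y; apply/nbhs_ballP; exists 1 => //= y.
  by rewrite /ball/= ltr_norml => /andP[_]; rewrite ltrBlDr addrC lerBlDr => /ltW.
have d1 : is_derive (x + h) 1 F (g (x + h)) by apply: dF; rewrite ltrBlDr -addrA ltrDl addr_gt0.
have d2 : is_derive x 1 F (g x) by apply: dF; rewrite ltrBlDr ltrDl.
have d3 : is_derive x 1 (fun y => y + h) (1 : R).
  by apply: is_derive_eq; rewrite addr0.
have d4 := @is_derive1_comp _ F (fun y => y + h) x _ _ d1 d3.
by apply: is_derive_eq; rewrite /GRing.scale/= mulr1 mulrC.
Unshelve. all: by end_near. Qed.

Let average_cst (c x : R) : h^-1 * \int[mu]_(t in `[x, x + h]) c = c.
Proof.
rewrite Rintegral_cst//= lebesgue_measure_itv/= lte_fin ltrDl h0.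
by rewrite -EFinD/= addrAC subrr add0r mulrCA mulVf ?mulr1// gt_eqF.
Qed.

Let average_le (f1 f2 : R -> R) (x c : R) :
  mu.-integrable `[x, x + h] (EFin \o f1) -> mu.-integrable `[x, x + h] (EFin \o f2) ->
  (forall t, t \in `[x, x + h] -> `|f1 t - f2 t| <= c) ->
  `|h^-1 * (\int[mu]_(t in `[x, x + h]) f1 t) - h^-1 * \int[mu]_(t in `[x, x + h]) f2 t| <= c.
Proof.
move=> i1 i2 f12; rewrite -mulrBr -RintegralB// normrM gtr0_norm ?invr_gt0//.
have i12 : mu.-integrable `[x, x + h] (EFin \o (fun t => f1 t - f2 t)).
  by have := integrableB _ i1 i2; exact.
rewrite -[leRHS](average_cst c x) ler_pM2l ?invr_gt0//.
apply: (le_trans (le_normr_Rintegral _ i12)) => //.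
apply: le_Rintegral => //; first by have := integrable_abse i12.
apply: (@continuous_compact_integrable _ (cst c)); first exact: segment_compact.
by apply: continuous_subspaceT => ?; exact: cst_continuous.
Qed.

Hypothesis L0 : 0 <= L.

Lemma average_dist (x : R) : `|average x - g x| <= L * h.
Proof.
rewrite -[X in _ - X](average_cst (g x) x); apply: average_le => //.
  apply: (@continuous_compact_integrable _ (cst (g x))); first exact: segment_compact.
  by apply: continuous_subspaceT => ?; exact: cst_continuous.
move=> t; rewrite in_itv/= => /andP[xt th]; apply: (le_trans (gL.2 _ _)).
by rewrite ler_wpM2l// ger0_norm; lra.
Qed.

Lemma lip1_average : lip1 M L average.
Proof.
split=> [x|x y].
  rewrite -[X in `|X|]subr0 -(average_cst 0 x); apply: average_le => //.
    apply: (@continuous_compact_integrable _ (cst 0)); first exact: segment_compact.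
    by apply: continuous_subspaceT => ?; exact: cst_continuous.
  by move=> t _; rewrite subr0; exact: gL.1.
apply: (derive_bound_lip is_derive_average) => {x y}x.
rewrite normrM [X in _ * X]gtr0_norm ?invr_gt0// ler_pdivrMr//.
by apply: (le_trans (gL.2 _ _)); rewrite addrAC subrr add0r gtr0_norm.
Qed.

End average.

Section taylor.
Context {R : realType}.

(** The mean value theorem is applied to [phi], the error of the quadratic approximation, and then
    to [G1]. Of the two bounds the cubic one serves small increments; the quadratic one stays
    integrable when only second moments exist. *)
Lemma taylor2 (G G1 G2 : R -> R) (K K' : R) :
  (forall x : R, is_derive x 1 G (G1 x)) -> (forall x : R, is_derive x 1 G1 (G2 x)) ->
  (forall x, `|G2 x| <= K) -> (forall x y, `|G2 x - G2 y| <= K' * `|x - y|) -> 0 <= K' ->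
  forall x u, `|G (x + u) - (G x + u * G1 x + u ^+ 2 / 2 * G2 x)| <=
    Num.min (2 * K * u ^+ 2) (K' * `|u| ^+ 3).
Proof.
move=> d1 d2 bK lK K0 x u.
pose phi (y : R) := G y - (y - x) * G1 x - (y - x) * (y - x) / 2 * G2 x.
pose dphi (y : R) := G1 y - G1 x - (y - x) * G2 x.
have dd (y : R) : is_derive y 1 phi (dphi y).
  have dG := d1 y.
  have dy : is_derive y 1 (fun y => y - x) (1 : R).
    by apply: is_derive_eq; rewrite subr0.
  rewrite /phi; apply: is_derive_eq; rewrite /dphi /GRing.scale/=.
  by field.
have bnd (a b w z : R) : Num.min a b <= w -> w <= Num.max a b ->
    `|w - a| <= `|b - a|.
  rewrite ge_min le_max => /orP[] h1 /orP[] h2;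
    rewrite !ler_norml; case: (lerP 0 (b - a)) => h3;
    rewrite ?(ger0_norm h3) ?(ltr0_norm h3); apply/andP; split; lra.
have [c [c1 c2 cE]] := is_derive_MVT x (x + u) dd.
have [e [e1 e2 eE]] := is_derive_MVT x c d2.
have hc := bnd _ _ c 0 c1 c2; have he := bnd _ _ e 0 e1 e2.
have E : G (x + u) - (G x + u * G1 x + u ^+ 2 / 2 * G2 x) =
    (G2 e - G2 x) * (c - x) * u.
  transitivity (phi (x + u) - phi x); first by rewrite /phi; field.
  by rewrite cE /dphi eE; ring.
rewrite E !normrM; rewrite addrAC subrr add0r in hc.
have hu : `|c - x| * `|u| <= u ^+ 2.
  by rewrite -(real_normK (num_real u)) expr2 ler_wpM2r.
have u2 : `|u| ^+ 2 = u ^+ 2 by rewrite real_normK ?num_real.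
rewrite -mulrA le_min; apply/andP; split.
  apply: ler_pM => //.
  by rewrite mulr_natl mulr2n (le_trans (ler_normB _ _))// lerD.
rewrite [in leRHS]exprS [in leRHS]mulrA u2; apply: ler_pM => //.
by apply: (le_trans (lK _ _)); rewrite ler_wpM2l// (le_trans he).
Qed.

(** Averaging twice makes the second derivative a second difference of [g] divided by [h ^+ 2]; its
    four values of [g] give the factors 4. [K] and [K'] are chosen before [g], which makes the later
    limit theorem uniform. *)
Lemma smooth_approximation (M L h : R) : 0 <= M -> 0 <= L -> 0 < h ->
  exists K K' : R, [/\ 0 <= K, 0 <= K' & forall g : R -> R, lip1 M L g ->
    exists G G1 G2 : R -> R, [/\ lip1 M L G, forall x, `|G x - g x| <= 2 * L * h,
      forall x, `|G2 x| <= K &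
      forall x u, `|G (x + u) - (G x + u * G1 x + u ^+ 2 / 2 * G2 x)| <=
         Num.min (2 * K * u ^+ 2) (K' * `|u| ^+ 3)]].
Proof.
move=> M0 L0 h0; exists (4 * M / h ^+ 2), (4 * L / h ^+ 2); split.
- by rewrite divr_ge0 ?sqr_ge0// mulr_ge0.
- by rewrite divr_ge0 ?sqr_ge0// mulr_ge0.
move=> g gL; have aL := lip1_average gL h0.
pose G := average (average g h) h.
pose G1 x := (average g h (x + h) - average g h x) / h.
pose G2 x := ((g (x + h + h) - g (x + h)) / h - (g (x + h) - g x) / h) / h.
have h2 : 0 < h ^+ 2 by rewrite exprn_gt0.
have hn : h != 0 by rewrite gt_eqF.
have E2 x : G2 x = (g (x + h + h) - g (x + h) - g (x + h) + g x) / h ^+ 2.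
  by rewrite /G2; field.
exists G, G1, G2; split.
- exact: lip1_average.
- move=> x; have -> : 2 * L * h = L * h + L * h by ring.
  apply: (le_trans (ler_distD (average g h x) _ _)).
  by apply: lerD; [exact: (average_dist aL h0 L0)|exact: (average_dist gL h0 L0)].
- move=> x; rewrite E2 normrM [X in _ * X]gtr0_norm ?invr_gt0// ler_pM2r ?invr_gt0//.
  have := gL.1 (x + h + h); have := gL.1 (x + h); have := gL.1 x.
  by rewrite !ler_norml; lra.
apply: taylor2.
- by move=> x; exact: (is_derive_average aL h0).
- move=> x; rewrite /G1 /G2.
  have d1 := is_derive_average gL h0 (x + h); have d2 := is_derive_average gL h0 x.
  have d3 : is_derive x 1 (fun y => y + h) (1 : R).
    by apply: is_derive_eq; rewrite addr0.
  have d4 := @is_derive1_comp _ (average g h) (fun y => y + h) x _ _ d1 d3.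
  apply: (@is_derive_eq _ _ _ (fun x : R => (average g h (x + h) - average g h x) / h)).
  by rewrite /GRing.scale/=; field.
- move=> x; rewrite E2 normrM [X in _ * X]gtr0_norm ?invr_gt0// ler_pM2r ?invr_gt0//.
  have := gL.1 (x + h + h); have := gL.1 (x + h); have := gL.1 x.
  by rewrite !ler_norml; lra.
- move=> x y; rewrite !E2 -mulrBl normrM [X in _ * X]gtr0_norm ?invr_gt0//.
  rewrite [leRHS]mulrAC ler_pM2r ?invr_gt0//.
  have := gL.2 (x + h + h) (y + h + h); have := gL.2 (x + h) (y + h); have := gL.2 x y.
  have -> : x + h + h - (y + h + h) = x - y by ring.
  have -> : x + h - (y + h) = x - y by ring.
  by rewrite !ler_norml; set d := L * _; rewrite -mulrA -/d; lra.
- by rewrite divr_ge0 ?sqr_ge0// mulr_ge0.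
Qed.

End taylor.

(** * Moments of the normal law *)

Section normal_moments.
Context {R : realType}.
Local Notation mu := (@lebesgue_measure R).

(** The change of variables is made with the Radon-Nikodym derivative, which equals the density
    almost everywhere because both have the same integral over every measurable set. *)
Lemma ge0_integral_normal_prob (m s : R) (f : R -> \bar R) :
  measurable_fun setT f -> (forall x, 0 <= f x)%E ->
  (\int[normal_prob m s]_x f x = \int[mu]_x (f x * (normal_pdf m s x)%:E))%E.
Proof.
move=> mf f0; have dom := @normal_prob_dominates R m s.
rewrite -(Radon_Nikodym_SigmaFinite.change_of_variables dom)//.
have iRN := Radon_Nikodym_SigmaFinite.f_integrable dom.
have mpdf : measurable_fun setT (fun x => (normal_pdf m s x)%:E).
  by apply/measurable_EFinP; exact: measurable_normal_pdf.
apply: ae_eq_integral => //.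
- by apply: emeasurable_funM => //; exact: measurable_int iRN.
- exact: emeasurable_funM.
apply: ae_eqe_mul2l; apply: integral_ae_eq => //.
by move=> E _ mE; rewrite -Radon_Nikodym_SigmaFinite.f_integral.
Qed.

Context {d : measure_display} {T : measurableType d}.
Variables (Q : probability T R) (V : T -> R) (s : R).
Hypotheses (mV : measurable_fun setT V) (s0 : 0 < s).
Hypothesis VN : forall B, measurable B -> Q (V @^-1` B) = normal_prob 0 s B.

(* completing the square: tilting the N(0, s^2) density gives a multiple of the
   N(t r^2, r^2) density, whose integral is 1 *)
Lemma normal_tilted (t r : R) : 0 < r ->
  (\int[Q]_w (expR ((s ^- 2 - r ^- 2) / 2 * V w ^+ 2 + t * V w))%:E =
   (r / s * expR (t ^+ 2 * r ^+ 2 / 2))%:E)%E.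
Proof.
move=> r0.
set g := fun x : R => (expR ((s ^- 2 - r ^- 2) / 2 * x ^+ 2 + t * x))%:E.
have mg : measurable_fun setT g.
  apply/measurable_EFinP; apply: measurableT_comp => //.
  apply: measurable_funD; apply: measurable_funM => //.
have := @ge0_integral_law _ _ _ Q _ (measurableTypeR R) V (normal_prob 0 s) g mV VN mg.
rewrite /g => ->; last by move=> y; rewrite lee_fin expR_ge0.
rewrite ge0_integral_normal_prob//.
set C := _ * expR _.
have C0 : 0 <= C by rewrite mulr_ge0 ?expR_ge0// divr_ge0 ?ltW.
have E x : (g x * (normal_pdf 0 s x)%:E = C%:E * (normal_pdf (t * r ^+ 2) r x)%:E)%E.
  rewrite !normal_pdfE ?gt_eqF// -!EFinM; congr EFin.
  rewrite /normal_peak /normal_fun /C.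
  have spi (u : R) : 0 < u -> (Num.sqrt (u ^+ 2 * pi *+ 2))^-1 = u^-1 * (Num.sqrt (pi *+ 2))^-1.
    by move=> u0; rewrite -mulrnAr sqrtrM ?sqr_ge0// sqrtr_sqr gtr0_norm// invfM.
  rewrite !spi//.
  set k := (Num.sqrt _)^-1.
  transitivity (s^-1 * k * (expR ((s ^- 2 - r ^- 2) / 2 * x ^+ 2 + t * x) *
     expR (- (x - 0) ^+ 2 / (s ^+ 2 *+ 2)))); first by ring.
  transitivity (s^-1 * k * (expR (t ^+ 2 * r ^+ 2 / 2) *
     expR (- (x - t * r ^+ 2) ^+ 2 / (r ^+ 2 *+ 2)))); last first.
    by field; rewrite !gt_eqF.
  rewrite -!expRD; congr (_ * expR _); field.
  by rewrite !gt_eqF.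
transitivity (\int[mu]_x (C%:E * (normal_pdf (t * r ^+ 2) r x)%:E))%E.
  by apply: eq_integral => x _; exact: E.
have mp : measurable_fun setT (fun x => (normal_pdf (t * r ^+ 2) r x)%:E).
  by apply/measurable_EFinP; exact: measurable_normal_pdf.
rewrite ge0_integralZl//; first by rewrite integral_normal_pdf mule1.
by move=> x _; rewrite lee_fin normal_pdf_ge0.
Qed.

Let iQ1 : Q.-integrable setT (EFin \o (fun=> 1 : R)).
Proof. exact: finite_measure_integrable_cst. Qed.

Let measurable_expquad (a t : R) : measurable_fun setT (fun w => expR (a * V w ^+ 2 + t * V w)).
Proof.
apply: measurableT_comp => //; apply: measurable_funD; apply: measurable_funM => //.
exact: measurable_funX.
Qed.

Lemma normal_tilted_integrable (t r : R) : 0 < r ->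
  Q.-integrable setT (EFin \o (fun w => expR ((s ^- 2 - r ^- 2) / 2 * V w ^+ 2 + t * V w))).
Proof.
move=> r0; apply/integrableP; split; first exact/measurable_EFinP.
under eq_integral do rewrite /= ger0_norm ?expR_ge0//.
by rewrite normal_tilted// ltry.
Qed.

Lemma normal_tilted_Rintegral (t r : R) : 0 < r ->
  \int[Q]_w expR ((s ^- 2 - r ^- 2) / 2 * V w ^+ 2 + t * V w) =
  r / s * expR (t ^+ 2 * r ^+ 2 / 2).
Proof. by move=> r0; rewrite /Rintegral normal_tilted. Qed.

(** The tilt with [r = 2 * s] and [t = 0] has exponent [3/8 * (V/s)^2] and expectation 2. Since
    [y^4 <= 64 * exp (3/8 * y^2)], the product [64 * 2] gives 128; any constant would do in place of
    the exact 3. *)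
Lemma normal_fourth_moment : Q.-integrable setT (EFin \o (fun w => V w ^+ 4)) /\
  \int[Q]_w V w ^+ 4 <= 128 * s ^+ 4.
Proof.
have r0 : 0 < 2 * s by rewrite mulr_gt0.
have I := normal_tilted_integrable 0 r0.
have E := normal_tilted_Rintegral 0 r0.
set h := fun w => expR ((s ^- 2 - (2 * s) ^- 2) / 2 * V w ^+ 2 + 0 * V w) in E.
have I64 : Q.-integrable setT (EFin \o (fun w => 64 * s ^+ 4 * h w)).
  by have := integrableZl measurableT (64 * s ^+ 4) I.
have le w : V w ^+ 4 <= 64 * s ^+ 4 * h w.
  rewrite /h mul0r addr0.
  have -> : (s ^- 2 - (2 * s) ^- 2) / 2 * V w ^+ 2 = (3 / 8 * (V w / s) ^+ 2).
    by field; rewrite gt_eqF.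
  set y := V w / s.
  have -> : V w ^+ 4 = s ^+ 4 * y ^+ 4 by rewrite /y -exprMn mulrCA divff ?mulr1// gt_eqF.
  have -> : 64 * s ^+ 4 * expR (3 / 8 * y ^+ 2) = s ^+ 4 * (64 * expR (3 / 8 * y ^+ 2)) by ring.
  rewrite ler_pM2l ?exprn_gt0//.
  have -> : expR (3 / 8 * y ^+ 2) = expR (3 / 16 * y ^+ 2) ^+ 2.
    by rewrite -expRM_natl; congr expR; field.
  have h1 := expR_ge1Dx (3 / 16 * y ^+ 2); have y2 := sqr_ge0 y.
  have h2 : 3 / 16 * y ^+ 2 <= expR (3 / 16 * y ^+ 2) by lra.
  have h3 : (3 / 16 * y ^+ 2) ^+ 2 <= expR (3 / 16 * y ^+ 2) ^+ 2.
    by rewrite lerXn2r// nnegrE ?expR_ge0// mulr_ge0.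
  have -> : y ^+ 4 = (y ^+ 2) ^+ 2 by rewrite -exprM.
  by have := sqr_ge0 (y ^+ 2); rewrite exprMn in h3; lra.
have I4 : Q.-integrable setT (EFin \o (fun w => V w ^+ 4)).
  apply: le_integrable I64 => //; first by apply/measurable_EFinP; exact: measurable_funX.
  move=> w _ /=; rewrite lee_fin ger0_norm; last by rewrite (exprM _ 2 2) sqr_ge0.
  exact: le_trans (le w) (ler_norm _).
split=> //.
apply: (le_trans (le_expectation I4 I64 le)).
rewrite RintegralZl// E expr0n/= mul0r mul0r expR0 mulr1 -mulrA.
by rewrite mulfK ?gt_eqF//; have := exprn_gt0 4 s0; lra.
Qed.

Lemma normal_integrable2 : Q.-integrable setT (EFin \o (fun w => V w ^+ 2)).
Proof.
have [I4 _] := normal_fourth_moment.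
have I : Q.-integrable setT (EFin \o (fun w => 1 + V w ^+ 4)).
  by have := integrableD measurableT iQ1 I4.
apply: le_integrable I => //; first by apply/measurable_EFinP; exact: measurable_funX.
move=> w _ /=; rewrite lee_fin (exprM _ 2 2) !ger0_norm ?addr_ge0 ?sqr_ge0//.
have := sqr_ge0 (V w ^+ 2 - 1); have := sqr_ge0 (V w ^+ 2); nra.
Qed.

Lemma normal_integrable1 : Q.-integrable setT (EFin \o V).
Proof.
have I : Q.-integrable setT (EFin \o (fun w => 1 + V w ^+ 2)).
  by have := integrableD measurableT iQ1 normal_integrable2.
apply: le_integrable I => //; first exact/measurable_EFinP.
move=> w _ /=; rewrite lee_fin [leRHS]ger0_norm ?addr_ge0 ?sqr_ge0//.
rewrite ler_norml; apply/andP; split.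
  have := sqr_ge0 (V w + 1); nra.
have := sqr_ge0 (V w - 1); nra.
Qed.

(** By [1 + x <= exp x] the exponential identity becomes an inequality linear in the first two
    moments. It is an equality at [t = 0], [r = s], so varying the parameters to both sides of that
    point determines the moments. *)
Let tilted_ge (t r : R) : 0 < r ->
  1 + ((s ^- 2 - r ^- 2) / 2 * (\int[Q]_w V w ^+ 2) + t * \int[Q]_w V w) <=
  r / s * expR (t ^+ 2 * r ^+ 2 / 2).
Proof.
move=> r0; rewrite -normal_tilted_Rintegral//.
set a := _ / 2.
have i1 : Q.-integrable setT (EFin \o (fun w => a * V w ^+ 2)).
  exact: (integrableZl measurableT a normal_integrable2).
have i2 : Q.-integrable setT (EFin \o (fun w => t * V w)).
  exact: (integrableZl measurableT t normal_integrable1).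
have i12 : Q.-integrable setT (EFin \o (fun w => a * V w ^+ 2 + t * V w)).
  by have := integrableD measurableT i1 i2.
have i : Q.-integrable setT (EFin \o (fun w => 1 + (a * V w ^+ 2 + t * V w))).
  by have := integrableD measurableT iQ1 i12.
have -> : 1 + (a * (\int[Q]_w V w ^+ 2) + t * \int[Q]_w V w) =
    \int[Q]_w (1 + (a * V w ^+ 2 + t * V w)).
  have j1 := normal_integrable1; have j2 := normal_integrable2.
  by rewrite !RintegralD// Rintegral_prob_cst !RintegralZl.
apply: le_expectation => //; first exact: normal_tilted_integrable.
by move=> w; exact: expR_ge1Dx.
Qed.

Lemma normal_mean : \int[Q]_w V w = 0.
Proof.
set m := Rintegral _ _ _.
have h t : t * m <= expR (t ^+ 2 * s ^+ 2 / 2) - 1.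
  have := tilted_ge t s0; rewrite subrr !mul0r add0r divff ?gt_eqF// mul1r -/m; lra.
have h' t : t ^+ 2 * s ^+ 2 <= 1 -> t * m <= t ^+ 2 * s ^+ 2.
  move=> t1; apply: (le_trans (h t)).
  have := expR_ge1Dx (- (t ^+ 2 * s ^+ 2 / 2)); rewrite expRN.
  have e0 := expR_gt0 (t ^+ 2 * s ^+ 2 / 2); move: e0; set e := expR _ => e0.
  have y0 : 0 <= t ^+ 2 * s ^+ 2 by rewrite mulr_ge0 ?sqr_ge0.
  move=> h1; have : e * (1 - t ^+ 2 * s ^+ 2 / 2) <= 1.
    by rewrite -ler_pdivlMl// mulr1.
  nra.
apply/eqP; rewrite -normr_le0; apply/ler_addgt0Pl => e e0; rewrite addr0.
(* [t <= 1 / s] makes [h'] applicable to [t] and [- t], and [t <= e / s ^+ 2] brings its bound,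
   divided by [t], below [e]. *)
pose t := Num.min (s^-1) (e / s ^+ 2).
have t0 : 0 < t by rewrite lt_min invr_gt0 s0 divr_gt0// exprn_gt0.
have ts : t ^+ 2 * s ^+ 2 <= 1.
  rewrite -exprMn expr_le1//; last by rewrite mulr_ge0 ?ltW.
  by rewrite -ler_pdivlMr// div1r ge_min lexx.
have te : t * s ^+ 2 <= e by rewrite -ler_pdivlMr ?exprn_gt0// ge_min lexx orbT.
have m1 := h' t ts; have m2 := h' (- t); rewrite sqrrN in m2; have {}m2 := m2 ts.
rewrite ler_norml; apply/andP; split; rewrite -(ler_pM2l t0); nra.
Qed.

(** With [t = 0] and [r = u * s], the inequality changes direction when divided by [u - 1] as [u]
    crosses 1: values just above 1 bound the variance from above, values just below 1 from below. *)
Lemma normal_variance : \int[Q]_w V w ^+ 2 = s ^+ 2.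
Proof.
set m := Rintegral _ _ _; have s2 : 0 < s ^+ 2 by rewrite exprn_gt0.
have h u : 0 < u -> (1 - u ^- 2) * (m / s ^+ 2) <= 2 * (u - 1).
  move=> u0; have us : 0 < u * s by rewrite mulr_gt0.
  have := tilted_ge 0 us.
  rewrite expr0n/= !mul0r addr0 expR0 mulr1 mulfK ?gt_eqF// -/m.
  have -> : (s ^- 2 - (u * s) ^- 2) / 2 * m = (1 - u ^- 2) * (m / s ^+ 2) / 2.
    by field; rewrite !gt_eqF.
  lra.
have {}h u : 0 < u -> (u - 1) * ((u + 1) * (m / s ^+ 2)) <= (u - 1) * (2 * u ^+ 2).
  move=> u0; have u2 : 0 < u ^+ 2 by rewrite exprn_gt0.
  have := h u u0; rewrite -(ler_pM2l u2).
  have -> : u ^+ 2 * ((1 - u ^- 2) * (m / s ^+ 2)) = (u ^+ 2 - 1) * (m / s ^+ 2).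
    by field; rewrite !gt_eqF.
  lra.
suff : m / s ^+ 2 = 1 by move=> /(congr1 (fun x => x * s ^+ 2)); rewrite divfK ?gt_eqF// mul1r.
move: (m / s ^+ 2) h => r h; apply/eqP; rewrite eq_le; apply/andP; split.
  apply/ler_addgt0Pl => e e0; pose u := 1 + Num.min 1 (e / 3).
  have [v0 v1 ve] : [/\ 0 < Num.min 1 (e / 3), Num.min 1 (e / 3) <= 1 & Num.min 1 (e / 3) <= e / 3].
    by rewrite lt_min ltr01 divr_gt0// !ge_min !lexx orbT.
  have u0 : 0 < u by rewrite /u; lra.
  have := h u u0; rewrite ler_pM2l; last by rewrite /u; lra.
  rewrite /u; move: (Num.min _ _) v0 v1 ve => v v0 v1 ve hv; nra.
apply/ler_addgt0Pl => e e0; pose v := Num.min (1/2) (e / 2).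
have [v0 v1 ve] : [/\ 0 < v, v <= 1/2 & v <= e / 2].
  by rewrite lt_min !divr_gt0// !ge_min !lexx orbT.
have u0 : 0 < 1 - v by lra.
have := h (1 - v) u0; rewrite ler_nM2l; last by lra.
move=> hv; nra.
Qed.

End normal_moments.

Lemma Rintegral_dominated_cvg {R : realType} {d : measure_display} {T : measurableType d}
  (P : probability T R) (f_ : nat -> T -> R) (f g : T -> R) :
  (forall n, measurable_fun setT (f_ n)) ->
  (forall x, f_ ^~ x @ \oo --> f x) ->
  P.-integrable setT (EFin \o g) -> (forall n x, `|f_ n x| <= g x) ->
  (fun n => \int[P]_w f_ n w) @ \oo --> \int[P]_w f w.
Proof.
move=> mf_ f_f ig fg.
have mf : measurable_fun setT f by apply: (measurable_fun_cvg mf_) => x _; exact: f_f.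
have fgle x : `|f x| <= g x.
  have : `|f_ n x| @[n --> \oo] --> `|f x| by apply: cvg_norm; exact: f_f.
  by move/cvg_lim => <- //; apply: limr_le; [apply/cvg_ex; exists `|f x|; apply: cvg_norm; exact: f_f|exact: nearW].
have if_ (h : T -> R) : measurable_fun setT h -> (forall x, `|h x| <= g x) ->
    P.-integrable setT (EFin \o h).
  move=> mh hg; apply: le_integrable ig => //; first exact/measurable_EFinP.
  by move=> x _ /=; rewrite lee_fin (le_trans (hg x))// ler_norm.
have [] := @dominated_convergence _ _ _ P setT measurableT (fun n => EFin \o f_ n)
  (EFin \o f) (EFin \o g) _ _ _ ig _.
- by move=> n; exact/measurable_EFinP.
- exact/measurable_EFinP.
- by apply: aeW => x _; apply: cvg_EFin; [exact: nearW|exact: f_f].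
- by apply: aeW => x n _ /=; rewrite lee_fin.
move=> _ _ h; apply: fine_cvg; rewrite /Rintegral fineK//.
by apply: integrable_fin_num => //; exact: if_.
Qed.

(** * Replacing the steps of a walk one at a time *)

Section trotter.
Context {R : realType} {d d' : measure_display} {T : measurableType d} {T' : measurableType d'}.
Variables (P : probability T R) (Q : probability T' R) (X : T -> R) (Y : T' -> R).
Hypotheses (mX : measurable_fun setT X) (mY : measurable_fun setT Y).

Lemma lip1_Fubini (g : R -> R) (M L x : R) : lip1 M L g ->
  \int[P]_w \int[Q]_w' g (x + X w + Y w') = \int[Q]_w' \int[P]_w g (x + Y w' + X w).
Proof.
move=> gL; have mg := lip1_measurable gL.
have mX1 : measurable_fun setT (fun z : T * T' => x + X z.1).
  by apply: measurable_funD => //; exact: (measurableT_comp mX measurable_fst).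
have mh : measurable_fun setT (fun z : T * T' => g (x + X z.1 + Y z.2)).
  apply: (measurableT_comp mg); apply: measurable_funD => //.
  exact: (measurableT_comp mY measurable_snd).
have ih : (P \x Q)%E.-integrable setT (EFin \o (fun z : T * T' => g (x + X z.1 + Y z.2))).
  by apply: (@bounded_integrable _ _ _ (P \x Q)%E _ M) => // z; exact: gL.1.
have fin d0 (T0 : measurableType d0) (p : probability T0 R) (f : T0 -> R) :
    measurable_fun setT f -> (forall x, `|f x| <= M) ->
    (\int[p]_x (f x)%:E)%E = (\int[p]_x f x)%:E.
  move=> mf fM; rewrite /Rintegral fineK//.
  by apply: integrable_fin_num => //; exact: (bounded_integrable _ mf fM).
have gM := gL.1.
have := Fubini ih; rewrite /=.
have E1 w : (\int[Q]_w' (g (x + X w + Y w'))%:E = (\int[Q]_w' g (x + X w + Y w'))%:E)%E.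
  by apply: fin => //; apply: (measurableT_comp mg); exact: measurable_funD.
have E2 w' : (\int[P]_w (g (x + X w + Y w'))%:E = (\int[P]_w g (x + Y w' + X w))%:E)%E.
  rewrite -fin//; first by apply: eq_integral => w _; rewrite addrAC.
  by apply: (measurableT_comp mg); exact: measurable_funD.
under eq_integral do rewrite E1.
under [X in _ = X -> _]eq_integral do rewrite E2.
by rewrite /Rintegral => ->.
Qed.

Local Notation sumg g x := (fun s => g (x + \sum_(y <- s) y)).

Lemma sumg_cons (g : R -> R) (x y : R) :
  (fun s => sumg g x (y :: s)) = (sumg g (x + y) : seq R -> R).
Proof. by apply/funext => s; rewrite big_cons addrA. Qed.

Lemma lip1_shift (M L c : R) (g : R -> R) : lip1 M L g -> lip1 M L (fun y => g (c + y)).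
Proof.
move=> [gM gL]; split=> [x|x y]; first exact: gM.
by apply: (le_trans (gL _ _)); rewrite opprD addrACA subrr add0r.
Qed.

Lemma iterE_sumg_lip1 {d0 : measure_display} {T0 : measurableType d0}
  (p : probability T0 R) (V : T0 -> R) (M L : R) (g : R -> R) n :
  measurable_fun setT V -> 0 <= L -> lip1 M L g ->
  lip1 M L (fun x => iterE p V n (sumg g x)).
Proof.
move=> mV L0 gL; split=> [x|x y].
  rewrite -[X in `|X|]subr0 -[X in _ - X](iterE_cst p V n 0).
  apply: (iterE_dist p mV (lip1_seqlip n x L0 gL) (M' := 0) (L' := 0)).
    by split=> *; rewrite ?subrr normr0 ?mul0r.
  by move=> s sn; rewrite subr0; exact: gL.1.
apply: (iterE_dist p mV (lip1_seqlip n x L0 gL) (lip1_seqlip n y L0 gL)) => s _.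
by apply: (le_trans (gL.2 _ _)); rewrite opprD addrACA subrr addr0.
Qed.

Variables (M L delta : R) (g : R -> R).
Hypotheses (L0 : 0 <= L) (gL : lip1 M L g).
Hypothesis gdelta : forall x, `|\int[P]_w g (x + X w) - \int[Q]_w g (x + Y w)| <= delta.

Let v n x := iterE Q Y n (sumg g x).

Let vL n : lip1 M L (v n). Proof. exact: iterE_sumg_lip1. Qed.

Let vS n x : v n.+1 x = \int[Q]_w v n (x + Y w).
Proof. by rewrite /v /=; apply: eq_Rintegral => w _; rewrite sumg_cons. Qed.

(* the one-step operators of X and Y are convolutions, hence commute *)
Let vdelta n x : `|\int[P]_w v n (x + X w) - \int[Q]_w v n (x + Y w)| <= delta.
Proof.
elim: n x => [|n IH] x.
  rewrite /v /=; under eq_Rintegral do rewrite big_nil addr0.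
  by under [X in _ - X]eq_Rintegral do rewrite big_nil addr0.
under eq_Rintegral do rewrite vS.
under [X in _ - X]eq_Rintegral do rewrite vS.
rewrite (lip1_Fubini x (vL n)).
have i1 : lip1 M L (fun y => \int[P]_w v n (y + X w)).
  split=> [y|y z].
    apply: expectation_bound => [|w]; last exact: (vL n).1.
    apply: (measurableT_comp (lip1_measurable (vL n))).
    exact: measurable_funD.
  apply: expectation_dist => [||w].
  - exact: (lip1_integrable P mX (lip1_shift y (vL n))).
  - exact: (lip1_integrable P mX (lip1_shift z (vL n))).
  by apply: (le_trans ((vL n).2 _ _)); rewrite opprD addrACA subrr addr0.
have i2 : lip1 M L (fun y => \int[Q]_w v n (y + Y w)).
  have := vL n.+1; congr (lip1 _ _ _); apply/funext => y; exact: vS.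
apply: expectation_dist => [||w].
- exact: (lip1_integrable Q mY (lip1_shift x i1)).
- exact: (lip1_integrable Q mY (lip1_shift x i2)).
exact: IH.
Qed.

(** In the telescoping sum each swapped step acts on some [v n], which inherits the one-step error
    of [g] through [vdelta]. A Taylor estimate is thus needed for [g] only, not for the intermediate
    functions. *)
Lemma trotter n x :
  `|iterE P X n (sumg g x) - iterE Q Y n (sumg g x)| <= n%:R * delta.
Proof.
elim: n x => [|n IH] x; first by rewrite /= subrr normr0 mul0r.
have u1 : iterE P X n.+1 (sumg g x) = \int[P]_w iterE P X n (sumg g (x + X w)).
  by apply: eq_Rintegral => w _; rewrite -sumg_cons.
have uL : lip1 M L (fun x => iterE P X n (sumg g x)) by exact: iterE_sumg_lip1.
rewrite u1 -/(v n.+1 x) vS.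
apply: (le_trans (ler_distD (\int[P]_w v n (x + X w)) _ _)).
rewrite -natr1 mulrDl mul1r lerD//.
apply: expectation_dist => [||w].
- exact: (lip1_integrable P mX (lip1_shift x uL)).
- exact: (lip1_integrable P mX (lip1_shift x (vL n))).
exact: IH.
Qed.

End trotter.

Lemma expectation_dist_le {R : realType} {d : measure_display} {T : measurableType d}
  (P : probability T R) (f g h : T -> R) : P.-integrable setT (EFin \o f) ->
  P.-integrable setT (EFin \o g) -> P.-integrable setT (EFin \o h) ->
  (forall x, `|f x - g x| <= h x) ->
  `|\int[P]_w f w - \int[P]_w g w| <= \int[P]_w h w.
Proof.
move=> fi gi hi fgh; rewrite -RintegralB//.
have I : P.-integrable setT (EFin \o (fun w => f w - g w)).
  by have := integrableB measurableT fi gi.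
apply: (le_trans (le_normr_Rintegral measurableT I)).
by apply: le_expectation => //; have := integrable_abse I.
Qed.

Section quadratic.
Context {R : realType} {d : measure_display} {T : measurableType d}.
Variables (P : probability T R) (V : T -> R) (a b c : R).
Hypotheses (i1 : P.-integrable setT (EFin \o V))
  (i2 : P.-integrable setT (EFin \o (fun w => V w ^+ 2))).

Lemma integrable_quadratic :
  P.-integrable setT (EFin \o (fun w => a + (V w * b + V w ^+ 2 * c))).
Proof.
have j0 : P.-integrable setT (EFin \o (fun=> a)) by exact: finite_measure_integrable_cst.
have j1 := integrableZr measurableT b i1.
have j2 := integrableZr measurableT c i2.
exact: (integrableD measurableT j0 (integrableD measurableT j1 j2)).
Qed.

Lemma expectation_quadratic :
  \int[P]_w (a + (V w * b + V w ^+ 2 * c)) =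
  a + ((\int[P]_w V w) * b + (\int[P]_w V w ^+ 2) * c).
Proof.
have j0 : P.-integrable setT (EFin \o (fun=> a)) by exact: finite_measure_integrable_cst.
have j1 : P.-integrable setT (EFin \o (fun w => V w * b)).
  exact: (integrableZr measurableT b i1).
have j2 : P.-integrable setT (EFin \o (fun w => V w ^+ 2 * c)).
  exact: (integrableZr measurableT c i2).
have j12 : P.-integrable setT (EFin \o (fun w => V w * b + V w ^+ 2 * c)).
  exact: (integrableD measurableT j1 j2).
by rewrite !RintegralD// Rintegral_prob_cst !RintegralZr.
Qed.

End quadratic.

(** * One-step estimate and the uniform limit theorem *)

Section clt.
Context {R : realType} {d d' : measure_display} {T : measurableType d} {T' : measurableType d'}.
Variables (P : probability T R) (Q : probability T' R) (b : T -> R).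
Hypotheses (mb : measurable_fun setT b) (ib : P.-integrable setT (EFin \o b))
  (Eb : \int[P]_w b w = 0) (ib2 : P.-integrable setT (EFin \o (fun w => b w ^+ 2)))
  (Eb2 : \int[P]_w b w ^+ 2 = 1).

Lemma lindeberg_integrable (K K' s : R) : 0 <= K -> 0 <= K' -> 0 <= s ->
  P.-integrable setT (EFin \o (fun w => Num.min (2 * K * b w ^+ 2) (K' * s * `|b w| ^+ 3))).
Proof.
move=> K0 K'0 s0.
have I := integrableZl measurableT (2 * K) ib2.
apply: le_integrable I => //.
  apply/measurable_EFinP; apply: measurable_minr; apply: measurable_funM => //.
    exact: measurable_funX.
  by apply: measurable_funX; exact: measurableT_comp.
move=> w _ /=; rewrite lee_fin.
have h0 : 0 <= 2 * K * b w ^+ 2 by rewrite mulr_ge0 ?sqr_ge0// mulr_ge0.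
rewrite [leRHS]ger0_norm// ger0_norm ?ge_min ?lexx//.
by rewrite le_min h0 mulr_ge0// mulr_ge0.
Qed.

(** This is Lindeberg's condition for a single law: the cubic branch tends to 0 pointwise with
    [s n], and the quadratic branch is an integrable bound, so no third moment of [b] is
    required. *)
Lemma lindeberg_cvg (K K' : R) (s : nat -> R) : 0 <= K -> 0 <= K' ->
  (forall n, 0 <= s n) -> s @ \oo --> 0 ->
  (fun n => \int[P]_w Num.min (2 * K * b w ^+ 2) (K' * s n * `|b w| ^+ 3)) @ \oo --> (0 : R).
Proof.
move=> K0 K'0 s0 sc; rewrite -[X in _ --> X](Rintegral_prob_cst P 0).
have h0 w : 0 <= 2 * K * b w ^+ 2 by rewrite mulr_ge0 ?sqr_ge0// mulr_ge0.
apply: (@Rintegral_dominated_cvg _ _ _ _ _ _ (fun w => 2 * K * b w ^+ 2)).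
- by move=> n; have /measurable_int/measurable_EFinP := lindeberg_integrable K0 K'0 (s0 n).
- move=> w.
  have c1 : (fun n => K' * s n * `|b w| ^+ 3) @ \oo --> (0 : R).
    have := cvgM (cvgM (cvg_cst K') sc) (cvg_cst (`|b w| ^+ 3)).
    by rewrite mulr0 mul0r; exact.
  apply: (@squeeze_cvgr _ _ _ _ (fun=> 0) (fun n => K' * s n * `|b w| ^+ 3)) => //.
    apply: nearW => n; rewrite le_min h0 ge_min lexx orbT andbT.
    by rewrite mulr_ge0// mulr_ge0.
  exact: cvg_cst.
- exact: (integrableZl measurableT (2 * K) ib2).
move=> n w; rewrite ger0_norm ?ge_min ?lexx//.
by rewrite le_min h0 mulr_ge0// mulr_ge0.
Qed.

(** The quadratic Taylor polynomials have equal expectations, because [s * b] and [V] share mean 0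
    and variance [s ^+ 2]. For [V] the cubic remainder is at most [K' * (1 + 128) / 2 * s ^+ 3],
    rounded up to [65 * K' * s ^+ 3]. *)
Lemma one_step (V : T' -> R) (s K K' M L : R) (G G1 G2 : R -> R) x :
  measurable_fun setT V -> 0 < s ->
  (forall B, measurable B -> Q (V @^-1` B) = normal_prob 0 s B) ->
  0 <= K -> 0 <= K' -> lip1 M L G ->
  (forall x u, `|G (x + u) - (G x + u * G1 x + u ^+ 2 / 2 * G2 x)| <=
         Num.min (2 * K * u ^+ 2) (K' * `|u| ^+ 3)) ->
  `|\int[P]_w G (x + s * b w) - \int[Q]_w G (x + V w)| <=
  s ^+ 2 * (\int[P]_w Num.min (2 * K * b w ^+ 2) (K' * s * `|b w| ^+ 3) + 65 * K' * s).
Proof.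
move=> mV s0 VN K0 K'0 GL taylor.
have s2 : 0 < s ^+ 2 by rewrite exprn_gt0.
have iV := normal_integrable1 mV s0 VN; have iV2 := normal_integrable2 mV s0 VN.
have [iV4 EV4] := normal_fourth_moment mV s0 VN.
have EV := normal_mean mV s0 VN; have EV2 := normal_variance mV s0 VN.
have msb : measurable_fun setT (fun w => s * b w) by exact: measurable_funM.
have isb : P.-integrable setT (EFin \o (fun w => s * b w)).
  exact: (integrableZl measurableT s ib).
have isb2 : P.-integrable setT (EFin \o (fun w => (s * b w) ^+ 2)).
  have := integrableZl measurableT (s ^+ 2) ib2; congr (_.-integrable _ _).
  by apply/funext => w /=; rewrite exprMn EFinM.
have quadE (u : R) : G x + u * G1 x + u ^+ 2 / 2 * G2 x =
    G x + (u * G1 x + u ^+ 2 * (G2 x / 2)) by ring.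
have iR := lindeberg_integrable K0 K'0 (ltW s0).
set rho := Rintegral _ _ (fun w => Num.min _ _).
have EP : `|\int[P]_w G (x + s * b w) - (G x + s ^+ 2 * (G2 x / 2))| <= s ^+ 2 * rho.
  have -> : G x + s ^+ 2 * (G2 x / 2) =
      \int[P]_w (G x + ((s * b w) * G1 x + (s * b w) ^+ 2 * (G2 x / 2))).
    rewrite expectation_quadratic// RintegralZl// Eb mulr0 mul0r add0r.
    by under eq_Rintegral do rewrite exprMn; rewrite RintegralZl// Eb2 mulr1.
  rewrite /rho -RintegralZl//.
  apply: expectation_dist_le.
  - exact: (lip1_integrable P msb (lip1_shift x GL)).
  - exact: integrable_quadratic.
  - exact: (integrableZl measurableT (s ^+ 2) iR).
  move=> w; rewrite -quadE; apply: (le_trans (taylor _ _)).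
  rewrite [leRHS]minr_pMr; last exact: ltW.
  rewrite exprMn normrM exprMn (gtr0_norm s0).
  rewrite -[leRHS]/(Num.min _ _) le_eqVlt; apply/orP; left; apply/eqP.
  by congr Num.min; ring.
have EQ : `|\int[Q]_w G (x + V w) - (G x + s ^+ 2 * (G2 x / 2))| <= s ^+ 2 * (65 * K' * s).
  have -> : G x + s ^+ 2 * (G2 x / 2) =
      \int[Q]_w (G x + (V w * G1 x + V w ^+ 2 * (G2 x / 2))).
    by rewrite expectation_quadratic// EV mul0r add0r EV2.
  have j2 : Q.-integrable setT (EFin \o (fun w => s * V w ^+ 2)).
    exact: (integrableZl measurableT s iV2).
  have j4 : Q.-integrable setT (EFin \o (fun w => s^-1 * V w ^+ 4)).
    exact: (integrableZl measurableT s^-1 iV4).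
  have j24 : Q.-integrable setT (EFin \o (fun w => s * V w ^+ 2 + s^-1 * V w ^+ 4)).
    exact: (integrableD measurableT j2 j4).
  have i24 : Q.-integrable setT (EFin \o (fun w => (s * V w ^+ 2 + s^-1 * V w ^+ 4) * (K' / 2))).
    exact: (integrableZr measurableT (K' / 2) j24).
  apply: (@le_trans _ _ (\int[Q]_w ((s * V w ^+ 2 + s^-1 * V w ^+ 4) * (K' / 2)))).
    apply: expectation_dist_le => //.
    - exact: (lip1_integrable Q mV (lip1_shift x GL)).
    - exact: integrable_quadratic.
    move=> w; rewrite -quadE; apply: (le_trans (taylor _ _)).
    rewrite ge_min; apply/orP; right.
    (* The arithmetic-geometric inequality, with weight [s] matched to the scale of [V], reduces the
       third absolute moment to the second and fourth. *)
    have h : `|V w| ^+ 3 <= (s * V w ^+ 2 + s^-1 * V w ^+ 4) / 2.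
      have e2 : V w ^+ 2 = `|V w| ^+ 2 by rewrite real_normK ?num_real.
      have e4 : V w ^+ 4 = `|V w| ^+ 4 by rewrite (exprM _ 2 2) e2 -exprM.
      rewrite e2 e4; move: (`|V w|) (normr_ge0 (V w)) => y y0.
      rewrite -subr_ge0.
      have -> : (s * y ^+ 2 + s^-1 * y ^+ 4) / 2 - y ^+ 3 = s^-1 * (y ^+ 2 * (s - y) ^+ 2) / 2.
        by field; rewrite gt_eqF.
      rewrite divr_ge0//; apply: mulr_ge0; first by rewrite invr_ge0 ltW.
      by apply: mulr_ge0; exact: sqr_ge0.
    by have := ler_wpM2l K'0 h; lra.
  rewrite RintegralZr// RintegralD// !RintegralZl// EV2.
  have h : s^-1 * \int[Q]_w V w ^+ 4 <= 128 * s ^+ 3.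
    by rewrite mulrC ler_pdivrMr// -mulrA -exprSr.
  have s3 : 0 <= s ^+ 3 by rewrite exprn_ge0// ltW.
  have : (s * s ^+ 2 + s^-1 * \int[Q]_w V w ^+ 4) * (K' / 2) <= (s ^+ 3 + 128 * s ^+ 3) * (K' / 2).
    by rewrite ler_wpM2r ?divr_ge0// -exprS lerD2l.
  have := mulr_ge0 K'0 s3; rewrite !exprS expr0; nra.
have -> : s ^+ 2 * (rho + 65 * K' * s) = s ^+ 2 * rho + s ^+ 2 * (65 * K' * s) by ring.
by move: EP EQ; rewrite !ler_norml; lra.
Qed.

Variable eta : nat -> T' -> R.
Hypothesis meta : forall n, measurable_fun setT (eta n).
Hypothesis eta_normal : forall n, (0 < n)%N -> forall B, measurable B ->
  Q (eta n @^-1` B) = normal_prob 0 (Num.sqrt n%:R^-1) B.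

Lemma cvg_sqrt_inv : (fun n : nat => Num.sqrt (n%:R^-1 : R)) @ \oo --> (0 : R).
Proof.
rewrite -[X in _ --> X](sqrtr0 R); apply: continuous_cvg; first exact: sqrt_continuous.
apply/gtr0_cvgV0; last exact: cvgr_idn.
by exists 1%N => // n /= n1; rewrite ltr0n.
Qed.

(** A step costs [o(1/n)] and there are at most [n] of them. The threshold [n0] precedes [N], [g]
    and [x]: block lengths vary with [n], and [g] will be a hull functional with the other blocks
    fixed or integrated out. *)
Lemma clt (M L e : R) : 0 <= M -> 0 <= L -> 0 < e ->
  exists n0 : nat, forall n, (n0 <= n)%N -> forall N, (N <= n)%N ->
  forall (g : R -> R) x, lip1 M L g ->
  `|iterE P (fun w => Num.sqrt n%:R^-1 * b w) N (fun s => g (x + \sum_(y <- s) y)) -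
    iterE Q (eta n) N (fun s => g (x + \sum_(y <- s) y))| <= e.
Proof.
move=> M0 L0 e0.
(* With this width, passing from [g] to its smooth approximation costs at most [e / 4] on each side;
   [L + 1] avoids division by 0. *)
pose h := e / (8 * (L + 1)).
have L1 : 0 < L + 1 by lra.
have h0 : 0 < h by rewrite divr_gt0// mulr_gt0.
have hL : 2 * L * h <= e / 4.
  have -> : e / 4 = 2 * (L + 1) * h by rewrite /h; field; rewrite gt_eqF.
  by rewrite ler_pM2r//; lra.
have [K [K' [K0 K'0 smooth]]] := smooth_approximation M0 L0 h0.
pose s n : R := Num.sqrt n%:R^-1.
have s0 n : 0 <= s n by exact: sqrtr_ge0.
have c1 := lindeberg_cvg K0 K'0 s0 cvg_sqrt_inv.
have c2 : (fun n => 65 * K' * s n) @ \oo --> (0 : R).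
  by have := cvgM (cvg_cst (65 * K')) cvg_sqrt_inv; rewrite mulr0; exact.
have c3 : (fun n => \int[P]_w Num.min (2 * K * b w ^+ 2) (K' * s n * `|b w| ^+ 3) +
    65 * K' * s n) @ \oo --> (0 : R).
  by rewrite -[X in _ --> X](addr0 (0 : R)); exact: cvgD.
have /cvgrPdist_le/(_ (e / 4)) := c3.
move=> /(_ (divr_gt0 e0 (ltr0n _ 4)))[n0 _ n0P].
exists n0.+1 => n n0n N Nn g x gL.
have n1 : (0 < n)%N by exact: leq_ltn_trans n0n.
have n1R : (0 : R) < n%:R by rewrite ltr0n.
have sn0 : 0 < s n by rewrite sqrtr_gt0 invr_gt0.
have sn2 : s n ^+ 2 = n%:R^-1 by rewrite sqr_sqrtr// invr_ge0 ltW.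
have [G [G1 [G2 [GL Gg _ taylor]]]] := smooth g gL.
set X := fun w => Num.sqrt n%:R^-1 * b w.
have mX : measurable_fun setT X by exact: measurable_funM.
have Tr := @trotter _ _ _ _ _ P Q X (eta n) mX (meta n) M L (e / 4 / n%:R) G L0 GL.
have {}Tr : `|iterE P X N (fun s => G (x + \sum_(y <- s) y)) -
    iterE Q (eta n) N (fun s => G (x + \sum_(y <- s) y))| <= e / 4.
  apply: (le_trans (Tr _ N x)).
    move=> y; apply: (le_trans (one_step y (meta n) sn0 (eta_normal n1) K0 K'0 GL taylor)).
    rewrite -/(s n) sn2 mulrC ler_pM2r ?invr_gt0//.
    have := n0P n (ltnW n0n); rewrite /= sub0r normrN; exact: le_trans (ler_norm _).
  by rewrite mulrCA ler_piMr ?divr_ge0 ?(ltW e0)// ler_pdivrMr// mul1r ler_nat.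
have close (d0 : measure_display) (T0 : measurableType d0) (p : probability T0 R) (W : T0 -> R) :
  measurable_fun setT W -> `|iterE p W N (fun s => g (x + \sum_(y <- s) y)) -
     iterE p W N (fun s => G (x + \sum_(y <- s) y))| <= e / 4.
  move=> mW; apply: (iterE_dist p mW (lip1_seqlip N x L0 gL) (lip1_seqlip N x L0 GL)) => t _.
  by rewrite distrC; exact: le_trans (Gg _) hL.
move: (close _ _ P X mX) (close _ _ Q (eta n) (meta n)) Tr.
by rewrite !ler_norml; lra.
Qed.

End clt.

(** * Block sums *)

Section blocks.
Context {R : realType}.
Implicit Types (s t : seq R).

Fixpoint blocksums (N m : nat) s : seq R :=
  if m is m'.+1 then (\sum_(y <- take N s) y) :: blocksums N m' (drop N s) else [::].

Lemma size_blocksums N m s : size (blocksums N m s) = m.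
Proof. by elim: m s => //= m IH s; rewrite IH. Qed.

Lemma blocksums_dist N m s t : size s = size t ->
  l1dist (blocksums N m s) (blocksums N m t) <= l1dist s t.
Proof.
elim: m s t => [|m IH] s t st /=; first exact: l1dist_ge0.
have st1 : size (take N s) = size (take N t) by rewrite !size_take st.
have st2 : size (drop N s) = size (drop N t) by rewrite !size_drop st.
rewrite -[in leRHS](cat_take_drop N s) -[in leRHS](cat_take_drop N t) l1dist_cat//.
by rewrite lerD ?IH// l1dist_sum.
Qed.

Lemma blocksums_cat N m s t : size s = N ->
  blocksums N m.+1 (s ++ t) = (\sum_(y <- s) y) :: blocksums N m t.
Proof. by move=> <- /=; rewrite take_size_cat// drop_size_cat. Qed.

Lemma seqlip_blocksums N m (M L : R) F : 0 <= L -> seqlip m M L F ->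
  seqlip (m * N) M L (fun s => F (blocksums N m s)).
Proof.
move=> L0 [FM FL]; split=> [s _|s t sn tn]; first by rewrite FM// size_blocksums.
apply: (le_trans (FL _ _ _ _)); rewrite ?size_blocksums//.
by rewrite ler_wpM2l// blocksums_dist// sn tn.
Qed.

Context {d d' : measure_display} {T : measurableType d} {T' : measurableType d'}.
Variables (P : probability T R) (Q : probability T' R) (X : T -> R) (Y : T' -> R).
Hypotheses (mX : measurable_fun setT X) (mY : measurable_fun setT Y).

(** Induction swaps the later blocks with the first one fixed. The first block then meets [gQ], in
    which all later blocks are integrated out; it still has constants [M] and [L], so the one-block
    hypothesis applies. *)
Lemma iterE_blocksums (N m : nat) (M L e : R) (F : seq R -> R) : 0 <= L ->
  (forall g : R -> R, lip1 M L g ->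
    `|iterE P X N (fun s => g (\sum_(y <- s) y)) -
      iterE Q Y N (fun s => g (\sum_(y <- s) y))| <= e) ->
  seqlip m M L F ->
  `|iterE P X (m * N) (fun s => F (blocksums N m s)) -
    iterE Q Y (m * N) (fun s => F (blocksums N m s))| <= m%:R * e.
Proof.
move=> L0 one; elim: m F => [|m IH] F FL; first by rewrite /= subrr normr0 mul0r.
have E (d0 : measure_display) (T0 : measurableType d0) (p : probability T0 R) (W : T0 -> R) :
    iterE p W (m.+1 * N) (fun s => F (blocksums N m.+1 s)) =
    iterE p W N (fun s => iterE p W (m * N)
      (fun t => F (\sum_(y <- s) y :: blocksums N m t))).
  rewrite mulSn iterE_cat; apply: eq_iterE => s sN; apply: eq_iterE => t _.
  by rewrite blocksums_cat.
have GL (d0 : measure_display) (T0 : measurableType d0) (p : probability T0 R) (W : T0 -> R) :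
    measurable_fun setT W ->
    lip1 M L (fun x => iterE p W (m * N) (fun t => F (x :: blocksums N m t))).
  move=> mW; have sl x := seqlip_blocksums N L0 (seqlip_cons x FL).
  split=> [x|x y].
    rewrite -[X in `|X|]subr0 -[X in _ - X](iterE_cst p W (m * N) 0).
    apply: (iterE_dist p mW (sl x) (M' := 0) (L' := 0)).
      by split=> *; rewrite ?subrr normr0 ?mul0r.
    by move=> s sn; rewrite subr0; apply: FL.1; rewrite /= size_blocksums.
  apply: (iterE_dist p mW (sl x) (sl y)) => s sn.
  apply: (le_trans (FL.2 _ _ _ _)); rewrite /= ?size_blocksums//.
  by rewrite l1distxx addr0.
rewrite !E.
set gP := fun x => iterE P X (m * N) (fun t => F (x :: blocksums N m t)).
set gQ := fun x => iterE Q Y (m * N) (fun t => F (x :: blocksums N m t)).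
have gPL : lip1 M L gP by exact: GL.
have gQL : lip1 M L gQ by exact: GL.
apply: (le_trans (ler_distD (iterE P X N (fun s => gQ (\sum_(y <- s) y))) _ _)).
rewrite -natr1 mulrDl mul1r lerD//; last exact: one.
have sl g : lip1 M L g -> seqlip N M L (fun s => g (\sum_(y <- s) y)).
  move=> gL; have := lip1_seqlip N 0 L0 gL; congr (seqlip _ _ _ _).
  by apply/funext => s; rewrite add0r.
apply: (iterE_dist P mX (sl _ gPL) (sl _ gQL)) => s _.
by apply: (IH (fun t => F (\sum_(y <- s) y :: t))); exact: seqlip_cons.
Qed.

End blocks.

(** * Convex hulls and the Hausdorff distance *)

Section caratheodory.
Context {R : realType}.
Implicit Types A C : set (R * R).

Lemma convex2_hull2 A : convex2 (hull2 A).
Proof. by move=> x y hx hy t t0 t1 C Cc sAC; exact: (Cc _ _ (hx _ Cc sAC) (hy _ Cc sAC)). Qed.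

Lemma sub_hull2 A : A `<=` hull2 A.
Proof. by move=> x Ax C _; apply. Qed.

Lemma hull2_sub A C : convex2 C -> A `<=` C -> hull2 A `<=` C.
Proof. by move=> Cc sAC z; apply. Qed.

Definition combination n A : set (R * R) :=
  [set z | exists (l : 'I_n -> R) (p : 'I_n -> R * R),
    [/\ forall i, 0 <= l i, \sum_i l i = 1, forall i, A (p i) &
        z = (\sum_i l i * (p i).1, \sum_i l i * (p i).2)]].

(** The points form a matrix with more rows than its three columns, so its left kernel is not zero;
    the column of ones makes the coefficients sum to 0. As they are not all zero, one is
    positive. *)
Lemma affine_dependence n (p : 'I_n.+4 -> R * R) : exists c : 'I_n.+4 -> R,
  [/\ \sum_i c i = 0, \sum_i c i * (p i).1 = 0, \sum_i c i * (p i).2 = 0 &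
      exists i, 0 < c i].
Proof.
pose M : 'M[R]_(n.+4, 3) := \matrix_(i, j) [:: 1; (p i).1; (p i).2]`_j.
have : kermx M != 0.
  rewrite kermx_eq0 /row_free; apply: contraTneq (rank_leq_col M) => ->.
  by rewrite -ltnNge.
case/rowV0Pn => u /sub_kermxP uM u0.
have E j : \sum_i u 0 i * M i j = 0.
  by have := congr1 (fun B : 'rV_3 => B 0 j) uM; rewrite !mxE.
have S0 : \sum_i u 0 i = 0.
  by rewrite -[RHS](E (inord 0)); apply: eq_bigr => i _; rewrite mxE inordK ?mulr1.
have S1 : \sum_i u 0 i * (p i).1 = 0.
  by rewrite -[RHS](E (inord 1)); apply: eq_bigr => i _; rewrite mxE inordK.
have S2 : \sum_i u 0 i * (p i).2 = 0.
  by rewrite -[RHS](E (inord 2)); apply: eq_bigr => i _; rewrite mxE inordK.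
exists (fun i => u 0 i); split=> //.
apply: contrapT => /forallNP neg; move/eqP: u0; apply; apply/rowP => i; rewrite mxE.
have le0 j : u 0 j <= 0 by rewrite leNgt; exact/negP.
have : \sum_j - u 0 j = 0 by rewrite sumrN S0 oppr0.
move/eqP; rewrite psumr_eq0 => [/allP/(_ i)|j _]; last by rewrite oppr_ge0.
by rewrite mem_index_enum oppr_eq0 => /(_ isT) /eqP.
Qed.

(* moving the weights along an affine dependence until one of them vanishes *)
Lemma combination_pred n A : combination n.+4 A `<=` combination n.+3 A.
Proof.
move=> z [l [p [l0 l1 Ap ->]]].
have [c [c0 c1 c2 [i1 ci1]]] := affine_dependence p.
have [i0 ci0 imin] : exists2 i0, 0 < c i0 & forall j, 0 < c j -> l i0 / c i0 <= l j / c j.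
  by case: (@Order.TotalTheory.arg_minP _ _ _ i1 (fun i => 0 < c i) (fun i => l i / c i) ci1) => i ? ?; exists i.
pose tau := l i0 / c i0; pose l' i := l i - tau * c i.
have tau0 : 0 <= tau by rewrite divr_ge0// ltW.
have l'0 i : 0 <= l' i.
  rewrite subr_ge0; have [ci|ci] := ltP 0 (c i).
    by rewrite -ler_pdivlMr//; exact: imin.
  by apply: le_trans (l0 i); rewrite mulr_ge0_le0.
have l'i0 : l' i0 = 0 by rewrite /l' /tau divfK ?subrr// gt_eqF.
have E (f : 'I_n.+4 -> R) : \sum_i c i * f i = 0 ->
    \sum_j l' (lift i0 j) * f (lift i0 j) = \sum_i l i * f i.
  move=> cf; transitivity (\sum_i l' i * f i).
    by rewrite (bigD1_ord i0)//= l'i0 mul0r add0r.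
  under eq_bigr do rewrite mulrBl -mulrA.
  by rewrite sumrB -mulr_sumr cf mulr0 subr0.
exists (fun j => l' (lift i0 j)), (fun j => p (lift i0 j)); split=> //.
- rewrite -l1; have := E (fun=> 1).
  under eq_bigr do rewrite mulr1; move=> /(_ c0).
  under eq_bigr do rewrite mulr1; move=> ->.
  by under eq_bigr do rewrite mulr1.
- by rewrite (E (fun i => (p i).1))// (E (fun i => (p i).2)).
Qed.

Lemma combination3 n A : combination n.+3 A `<=` combination 3 A.
Proof. by elim: n => [//|n IH]; apply: subset_trans IH; exact: combination_pred. Qed.

Lemma combination_convex n m A x y (t : R) : 0 <= t -> t <= 1 ->
  combination n A x -> combination m A y ->
  combination (n + m) A (t * x.1 + (1 - t) * y.1, t * x.2 + (1 - t) * y.2).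
Proof.
move=> t0 t1 [l [p [l0 l1 Ap ->]]] [k [q [k0 k1 Aq ->]]].
pose w (i : 'I_(n + m)) := match fintype.split i with inl j => t * l j | inr j => (1 - t) * k j end.
pose r (i : 'I_(n + m)) := match fintype.split i with inl j => p j | inr j => q j end.
have S (f : R * R -> R) : \sum_i w i * f (r i) =
    t * (\sum_i l i * f (p i)) + (1 - t) * \sum_i k i * f (q i).
  rewrite big_split_ord/= !mulr_sumr; congr (_ + _); apply: eq_bigr => i _.
    by rewrite /w /r (unsplitK (inl _ i : 'I_n + 'I_m)) mulrA.
  by rewrite /w /r (unsplitK (inr _ i : 'I_n + 'I_m)) mulrA.
exists w, r; split.
- by move=> i; rewrite /w; case: (fintype.split i) => j; rewrite mulr_ge0// subr_ge0.
- have := S (fun=> 1); under eq_bigr do rewrite mulr1; move=> ->.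
  under eq_bigr do rewrite mulr1; rewrite l1.
  by under eq_bigr do rewrite mulr1; rewrite k1; ring.
- by move=> i; rewrite /r; case: (fintype.split i).
- by rewrite (S fst) (S snd).
Qed.

(** Carathéodory's theorem in the plane: combinations of three points form a convex set, because
    joining two of them uses six points and these reduce to three again. *)
Lemma hull2_combination A : hull2 A `<=` combination 3 A.
Proof.
apply: hull2_sub => [x y hx hy t t0 t1|x Ax].
  by apply: (@combination3 3); exact: (combination_convex t0 t1 hx hy).
exists (fun i => (i == ord0)%:R), (fun=> x); split=> //.
  by rewrite big_ord_recl/= big1 ?addr0.
by rewrite -!mulr_suml big_ord_recl/= big1 ?addr0// !mul1r; case: x Ax.
Qed.

(** The union of all segments from [A] to [C], written as a continuous image of a product so that
    compactness is inherited. *)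
Definition join2 A C : set (R * R) :=
  (fun z : R * ((R * R) * (R * R)) => (z.1 * z.2.1.1 + (1 - z.1) * z.2.2.1,
    z.1 * z.2.1.2 + (1 - z.1) * z.2.2.2)) @` (`[0, 1] `*` (A `*` C)).

Lemma join2_compact A C : compact A -> compact C -> compact (join2 A C).
Proof.
move=> cA Cc; apply: continuous_compact; last first.
  by apply: compact_setX; [exact: segment_compact|exact: compact_setX].
apply: continuous_subspaceT => z.
pose T := (R * ((R * R) * (R * R)))%type.
have c0 : {for z, continuous (fun z : T => z.1)} by exact: cvg_fst.
have c1 : {for z, continuous (fun z : T => z.2.1)}.
  by apply: continuous_comp; [exact: cvg_snd|exact: cvg_fst].
have c2 : {for z, continuous (fun z : T => z.2.2)}.
  by apply: continuous_comp; [exact: cvg_snd|exact: cvg_snd].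
have c3 : {for z, continuous (fun z : T => 1 - z.1)}.
  by apply: cvgB; [exact: cvg_cst|exact: c0].
have d1 : {for z, continuous (fun z : T => z.2.1.1)}.
  by apply: (@continuous_comp _ _ _ (fun z : T => z.2.1) fst); [exact: c1|exact: cvg_fst].
have d2 : {for z, continuous (fun z : T => z.2.2.1)}.
  by apply: (@continuous_comp _ _ _ (fun z : T => z.2.2) fst); [exact: c2|exact: cvg_fst].
have e1 : {for z, continuous (fun z : T => z.2.1.2)}.
  by apply: (@continuous_comp _ _ _ (fun z : T => z.2.1) snd); [exact: c1|exact: cvg_snd].
have e2 : {for z, continuous (fun z : T => z.2.2.2)}.
  by apply: (@continuous_comp _ _ _ (fun z : T => z.2.2) snd); [exact: c2|exact: cvg_snd].
have f1 : {for z, continuous (fun z : T => z.1 * z.2.1.1 + (1 - z.1) * z.2.2.1)}.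
  by apply: cvgD; apply: cvgM.
have f2 : {for z, continuous (fun z : T => z.1 * z.2.1.2 + (1 - z.1) * z.2.2.2)}.
  by apply: cvgD; apply: cvgM.
exact: (cvg_pair f1 f2).
Qed.

Lemma hull2_join A : A !=set0 -> hull2 A = join2 A (join2 A A).
Proof.
move=> [x0 Ax0]; apply/seteqP; split=> [z /hull2_combination|].
  move=> [l [p [l0 l1 Ap ->]]].
  move: l1; rewrite !big_ord_recl !big_ord0 !addr0 /=.
  set i1 := lift _ _; set i2 := lift _ _ => l1.
  have [h|h] := eqVneq (l i1 + l i2) 0.
    have [h1 h2] : l i1 = 0 /\ l i2 = 0 by have := l0 i1; have := l0 i2; lra.
    have h3 : l ord0 = 1 by lra.
    exists (1, (p ord0, x0)) => /=; last by rewrite h1 h2 h3; congr pair; ring.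
    split; first by rewrite /= in_itv/= lexx ler01.
    split=> //=; exists (1, (x0, x0)); last by case: (x0) => a b /=; congr pair; ring.
    by split=> //=; rewrite in_itv/= lexx ler01.
  have hp : 0 < l i1 + l i2 by rewrite lt_neqAle eq_sym h addr_ge0.
  pose t := l i1 / (l i1 + l i2).
  have t0 : 0 <= t by rewrite divr_ge0// ltW.
  have t1 : t <= 1 by rewrite ler_pdivrMr// mul1r lerDl.
  exists (l ord0, (p ord0, (t * (p i1).1 + (1 - t) * (p i2).1, t * (p i1).2 + (1 - t) * (p i2).2))).
    split; first by rewrite /= in_itv/= l0/=; lra.
    split=> //=; exists (t, (p i1, p i2)) => //; split=> //=.
    by rewrite in_itv/= t0 t1.
  have e1 : (1 - l ord0) * t = l i1.
    have -> : 1 - l ord0 = l i1 + l i2 by lra.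
    by rewrite mulrC divfK.
  have e2 : (1 - l ord0) * (1 - t) = l i2 by lra.
  by rewrite /= -e1 -e2; congr pair; ring.
move=> _ [[s [x _]] [/= s01 [Ax [[t [y u]] [/= t01 [Ay Au]] <-]]] <-] /=.
move: s01 t01; rewrite /= !in_itv/= => /andP[s0 s1] /andP[t0 t1].
have hyu := @convex2_hull2 A _ _ (@sub_hull2 A y Ay) (@sub_hull2 A u Au) t t0 t1.
exact: (@convex2_hull2 A _ _ (@sub_hull2 A x Ax) hyu s s0 s1).
Qed.

Lemma hull2_compact A : A !=set0 -> compact A -> compact (hull2 A).
Proof. by move=> A0 cA; rewrite hull2_join//; do 2 apply: join2_compact => //. Qed.

Lemma K20_hull2 A : compact A -> A (0, 0) -> K20 (hull2 A).
Proof.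
move=> cA A0; split; first by apply: hull2_compact => //; exists (0, 0).
by split; [exact: convex2_hull2|exact: sub_hull2].
Qed.

Lemma image_hull2 (f : R * R -> R * R) A :
  (forall x y (t : R), f (t * x.1 + (1 - t) * y.1, t * x.2 + (1 - t) * y.2) =
     (t * (f x).1 + (1 - t) * (f y).1, t * (f x).2 + (1 - t) * (f y).2)) ->
  f @` hull2 A = hull2 (f @` A).
Proof.
move=> fc; apply/seteqP; split.
  move=> _ [z hz <-] C Cc fAC.
  suff : (f @^-1` C) z by [].
  apply: hz => [x y /= Cx Cy t t0 t1|x Ax /=]; last by apply: fAC; exists x.
  by rewrite fc; exact: Cc.
have := @hull2_sub (f @` A) (f @` hull2 A); apply => [_ _ [x hx <-] [y hy <-] t t0 t1|_ [x Ax <-]].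
  by exists (t * x.1 + (1 - t) * y.1, t * x.2 + (1 - t) * y.2) => //; exact: convex2_hull2.
by exists x => //; exact: sub_hull2.
Qed.

End caratheodory.

(** * Euclidean and Hausdorff distances *)

Section euclidean.
Context {R : realType}.
Implicit Types (x y z : R * R) (A B C : set (R * R)).

Lemma enorm2_ge0 x : 0 <= enorm2 x. Proof. exact: sqrtr_ge0. Qed.

Lemma enorm2_sqr x : enorm2 x ^+ 2 = x.1 ^+ 2 + x.2 ^+ 2.
Proof. by rewrite sqr_sqrtr ?addr_ge0 ?sqr_ge0// -!expr2. Qed.

Lemma enorm2_scale (t : R) x : 0 <= t -> enorm2 (t * x.1, t * x.2) = t * enorm2 x.
Proof.
move=> t0; rewrite /enorm2 /dot2 /=.
have -> : t * x.1 * (t * x.1) + t * x.2 * (t * x.2) = t ^+ 2 * (x.1 * x.1 + x.2 * x.2) by ring.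
by rewrite sqrtrM ?sqr_ge0// sqrtr_sqr ger0_norm.
Qed.

Lemma enorm2_triangle x y : enorm2 (x.1 + y.1, x.2 + y.2) <= enorm2 x + enorm2 y.
Proof.
have nx := enorm2_ge0 x; have ny := enorm2_ge0 y.
rewrite -(@ler_pXn2r _ 2)// ?nnegrE ?addr_ge0 ?enorm2_ge0//.
rewrite sqrrD !enorm2_sqr /=.
have h : x.1 * y.1 + x.2 * y.2 <= enorm2 x * enorm2 y.
  apply: le_trans (ler_norm _) _.
  rewrite -(@ler_pXn2r _ 2)// ?nnegrE ?mulr_ge0// real_normK ?num_real// exprMn !enorm2_sqr.
  by have := sqr_ge0 (x.1 * y.2 - x.2 * y.1); nra.
lra.
Qed.

Lemma enorm2_le x : enorm2 x <= `|x.1| + `|x.2|.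
Proof.
rewrite -(@ler_pXn2r _ 2)// ?nnegrE ?addr_ge0 ?enorm2_ge0//.
rewrite enorm2_sqr sqrrD !real_normK ?num_real//.
by have := mulr_ge0 (normr_ge0 x.1) (normr_ge0 x.2); lra.
Qed.

Lemma edist2_ge0 x y : 0 <= edist2 x y. Proof. exact: enorm2_ge0. Qed.

Lemma edist2_le x y : edist2 x y <= `|x.1 - y.1| + `|x.2 - y.2|.
Proof. exact: enorm2_le. Qed.

Lemma edist2xx x : edist2 x x = 0.
Proof. by rewrite /edist2 /enorm2 /dot2 /= !subrr !mul0r addr0 sqrtr0. Qed.

Lemma edist2C x y : edist2 x y = edist2 y x.
Proof. by rewrite /edist2 /enorm2 /dot2 /= -!expr2 -[(x.1 - _) ^+ 2]sqrrN -[(x.2 - _) ^+ 2]sqrrN !opprB. Qed.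

Lemma edist2_triangle y x z : edist2 x z <= edist2 x y + edist2 y z.
Proof.
have := enorm2_triangle (sub2 x y) (sub2 y z).
by rewrite /sub2 /= !addrA !subrK.
Qed.

Lemma edist2_convex x y x' y' (t : R) : 0 <= t -> t <= 1 ->
  edist2 (t * x.1 + (1 - t) * y.1, t * x.2 + (1 - t) * y.2)
    (t * x'.1 + (1 - t) * y'.1, t * x'.2 + (1 - t) * y'.2) <=
  t * edist2 x x' + (1 - t) * edist2 y y'.
Proof.
move=> t0 t1; have t1' : 0 <= 1 - t by lra.
rewrite -!enorm2_scale//; apply: le_trans (enorm2_triangle _ _).
rewrite /edist2 /sub2 /= le_eqVlt; apply/orP; left; apply/eqP.
by congr enorm2; congr pair; ring.
Qed.

Lemma dist_set_le x A y : A y -> dist_set x A <= edist2 x y.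
Proof.
by move=> Ay; apply: ge_inf; [exists 0 => _ [z _ <-]; exact: edist2_ge0|exists y].
Qed.

Lemma le_dist_set x A (r : R) : A !=set0 -> (forall y, A y -> r <= edist2 x y) ->
  r <= dist_set x A.
Proof.
move=> [a Aa] h; apply: lb_le_inf; first by exists (edist2 x a), a.
by move=> _ [y Ay <-]; exact: h.
Qed.

Lemma dist_set_ge0 x A : A !=set0 -> 0 <= dist_set x A.
Proof. by move=> A0; apply: le_dist_set => // y _; exact: edist2_ge0. Qed.

Lemma dist_set_triangle x y A : A !=set0 -> dist_set x A <= edist2 x y + dist_set y A.
Proof.
move=> A0; rewrite -lerBlDl; apply: le_dist_set => // z Az.
rewrite lerBlDl; exact: le_trans (dist_set_le x Az) (edist2_triangle y x z).
Qed.

Lemma hausdorffC A B : hausdorff A B = hausdorff B A.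
Proof. exact: maxC. Qed.

Lemma hausdorff_le A B (r : R) : A !=set0 -> B !=set0 ->
  (forall x, B x -> dist_set x A <= r) -> (forall y, A y -> dist_set y B <= r) ->
  hausdorff A B <= r.
Proof.
move=> [a Aa] [b Bb] h1 h2; rewrite ge_max; apply/andP; split.
  by apply: ge_sup => [|_ [x Bx <-]]; [exists (dist_set b A), b|exact: h1].
by apply: ge_sup => [|_ [x Bx <-]]; [exists (dist_set a B), a|exact: h2].
Qed.

Lemma K20_neq0 A : K20 A -> A !=set0.
Proof. by move=> [_ [_ A0]]; exists (0, 0). Qed.

Lemma K20_bounded A : K20 A -> exists r : R, forall x, A x -> edist2 x (0, 0) <= r.
Proof.
move=> [/compact_bounded[M [_ /(_ (`|M| + 1))h]] _].
have {}h : forall x, A x -> `|x| <= `|M| + 1.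
  by apply: h; rewrite (le_lt_trans (ler_norm M))// ltrDl.
exists ((`|M| + 1) + (`|M| + 1)) => x Ax; apply: (le_trans (edist2_le _ _)).
rewrite /= !subr0; have := h x Ax; rewrite prod_normE ge_max => /andP[h1 h2].
by rewrite lerD.
Qed.

(** The supremum has to be over a bounded set: [B] is bounded, and the distance to [A] is at most
    the distance to the origin, which lies in [A]. *)
Lemma dist_le_hausdorff A B x : K20 A -> K20 B -> B x -> dist_set x A <= hausdorff A B.
Proof.
move=> KA KB Bx; rewrite le_max; apply/orP; left.
have [r hr] := K20_bounded KB.
apply: ub_le_sup; last by exists x.
exists r => _ [y By <-]; apply: le_trans (hr y By).
by apply: dist_set_le; case: KA => _ [].
Qed.

Lemma hausdorff_ge0 A B : K20 A -> K20 B -> 0 <= hausdorff A B.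
Proof.
move=> KA KB; have B0 : B (0, 0) by case: KB => _ [].
apply: le_trans (dist_le_hausdorff KA KB B0).
exact: dist_set_ge0 (K20_neq0 KA).
Qed.

Lemma hausdorffxx A : K20 A -> hausdorff A A = 0.
Proof.
move=> KA; apply/eqP; rewrite eq_le hausdorff_ge0// andbT.
have h x : A x -> dist_set x A <= 0 by move=> Ax; rewrite -(edist2xx x); exact: dist_set_le.
by apply: hausdorff_le => //; exact: K20_neq0.
Qed.

Lemma hausdorff_triangle B A C : K20 A -> K20 B -> K20 C ->
  hausdorff A C <= hausdorff A B + hausdorff B C.
Proof.
move=> KA KB KC.
have h A1 C1 x : K20 A1 -> K20 C1 -> C1 x -> dist_set x A1 <= hausdorff A1 B + hausdorff B C1.
  move=> KA1 KC1 Cx; rewrite -lerBlDl; apply: le_trans (dist_le_hausdorff KB KC1 Cx).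
  apply: le_dist_set => [|b Bb]; first exact: K20_neq0.
  rewrite lerBlDl addrC; apply: (le_trans (dist_set_triangle x b (K20_neq0 KA1))).
  by rewrite lerD2l dist_le_hausdorff.
apply: hausdorff_le; [exact: K20_neq0|exact: K20_neq0|move=> x Cx; exact: h|].
move=> y Ay; rewrite addrC (hausdorffC A) (hausdorffC B C); exact: h.
Qed.

(** The points within [r] of some point of a convex set form a convex set, so this set contains a
    hull as soon as it contains the generating points. *)
Lemma hausdorff_hull2 A B (r : R) : A !=set0 -> B !=set0 ->
  (forall a, A a -> exists2 b, B b & edist2 a b <= r) ->
  (forall b, B b -> exists2 a, A a & edist2 a b <= r) ->
  hausdorff (hull2 A) (hull2 B) <= r.
Proof.
move=> [a0 Aa0] [b0 Bb0] AB BA.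
have h A1 B1 : (forall a, A1 a -> exists2 b, B1 b & edist2 a b <= r) ->
    forall x, hull2 A1 x -> dist_set x (hull2 B1) <= r.
  move=> AB1 x hx.
  suff [y By xy] : exists2 y, hull2 B1 y & edist2 x y <= r.
    exact: le_trans (dist_set_le x By) xy.
  suff : [set x | exists2 y, hull2 B1 y & edist2 x y <= r] x by [].
  apply: hx => [u v /= [u' hu uu'] [v' hv vv'] t t0 t1|a /= /AB1[b Bb ab]].
    exists (t * u'.1 + (1 - t) * v'.1, t * u'.2 + (1 - t) * v'.2).
      exact: convex2_hull2.
    apply: (le_trans (edist2_convex _ _ _ _ t0 t1)).
    have -> : r = t * r + (1 - t) * r by ring.
    by rewrite lerD// ler_wpM2l// subr_ge0.
  by exists b => //; exact: sub_hull2.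
apply: hausdorff_le.
- by exists a0; exact: sub_hull2.
- by exists b0; exact: sub_hull2.
- apply: h => b Bb; have [a Aa ab] := BA b Bb.
  by exists a => //; rewrite edist2C.
- exact: h.
Qed.

End euclidean.

(** * Discretised walks and Brownian paths *)

Section polygon.
Context {R : realType}.
Implicit Types (p q : nat -> R * R).

Definition polygon (n : nat) p : set (R * R) :=
  hull2 [set p k | k in [set k : nat | (k <= n)%N]].

Lemma polygon_neq0 n p : [set p k | k in [set k : nat | (k <= n)%N]] !=set0.
Proof. by exists (p 0%N), 0%N. Qed.

Lemma K20_polygon n p : p 0%N = (0, 0) -> K20 (polygon n p).
Proof.
move=> p0; apply: K20_hull2; last by exists 0%N.
by apply: finite_compact; apply: finite_image; exact: (finite_II n.+1).
Qed.

Lemma polygon_dist n p q (r : R) : (forall k, (k <= n)%N -> edist2 (p k) (q k) <= r) ->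
  hausdorff (polygon n p) (polygon n q) <= r.
Proof.
move=> pq; apply: hausdorff_hull2; [exact: polygon_neq0|exact: polygon_neq0| |].
  by move=> _ [k kn <-]; exists (q k); [exists k|exact: pq].
by move=> _ [k kn <-]; exists (p k); [exists k|exact: pq].
Qed.

Definition K20_lip (M L : R) (f : set (R * R) -> R) : Prop :=
  (forall A, K20 A -> `|f A| <= M) /\
  (forall A B, K20 A -> K20 B -> `|f A - f B| <= L * hausdorff A B).

Variables (M L : R) (f : set (R * R) -> R).
Hypotheses (L0 : 0 <= L) (fL : K20_lip M L f).

Lemma seqlip_polygon l m (p : seq R -> nat -> R * R) :
  (forall s, p s 0%N = (0, 0)) ->
  (forall s t, size s = l -> size t = l -> forall j, (j <= m)%N ->
     edist2 (p s j) (p t j) <= l1dist s t) ->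
  seqlip l M L (fun s => f (polygon m (p s))).
Proof.
move=> p0 pl; split=> [s _|s t sm tm]; first by apply: fL.1; exact: K20_polygon.
apply: (le_trans (fL.2 _ _ (K20_polygon _ _) (K20_polygon _ _))) => //.
by rewrite ler_wpM2l// polygon_dist// => k km; exact: pl.
Qed.

Lemma seqlip_partial_sums m (t_ : nat -> R) : t_ 0%N = 0 ->
  seqlip m M L (fun s => f (polygon m (fun j => (t_ j, \sum_(y <- take j s) y)))).
Proof.
move=> t0; apply: seqlip_polygon => [s|s t sm tm j jm].
  by rewrite take0 big_nil t0.
apply: (le_trans (edist2_le _ _)); rewrite /= subrr normr0 add0r.
have st : size (take j s) = size (take j t) by rewrite !size_take sm tm.
apply: (le_trans (l1dist_sum st)).
rewrite -{2}(cat_take_drop j s) -{2}(cat_take_drop j t) l1dist_cat// lerDl.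
exact: l1dist_ge0.
Qed.

Lemma l1dist_nth (s t : seq R) i : size s = size t -> `|s`_i - t`_i| <= l1dist s t.
Proof.
elim: s t i => [|x s IH] [|y t] [|i] //=; rewrite ?subrr ?normr0//.
  by move=> _; rewrite lerDl l1dist_ge0.
by move=> [st]; rewrite (le_trans (IH t i st))// lerDr.
Qed.

Lemma seqlip_points m (t_ : nat -> R) : t_ 0%N = 0 ->
  seqlip m M L (fun s => f (polygon m (fun j => (t_ j, nth 0 (0 :: s) j)))).
Proof.
move=> t0; apply: seqlip_polygon => [s|s t sm tm j jm]; first by rewrite t0.
apply: (le_trans (edist2_le _ _)); rewrite /= subrr normr0 add0r.
have := @l1dist_nth (0 :: s) (0 :: t) j; rewrite /= subrr normr0 add0r; apply.
by rewrite sm tm.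
Qed.

End polygon.

Section discretization.
Context {R : realType}.
Variables (alpha beta : nat -> R) (m n N : nat) (r : R).

Definition fine_path (k : nat) : R * R :=
  (k%:R / n%:R + \sum_(i < k) alpha i, \sum_(i < k) beta i).

Definition coarse_path (j : nat) : R * R :=
  ((j * N)%:R / n%:R, \sum_(i < j * N) beta i).

Hypotheses (n0 : (0 < n)%N) (Nm : (m * N <= n)%N) (nN : (n < m.+1 * N)%N).
Hypothesis alpha_small : forall k, (k <= n)%N -> `|\sum_(i < k) alpha i| <= r.
Hypothesis beta_small : forall j k, (j <= m)%N -> (k <= N)%N ->
  `|\sum_(i < k) beta (j * N + i)%N| <= r.

(** Time [k] is compared with the start of its block [k %/ N]. The possibly incomplete block after
    the last full one has index [m], so oscillations of [m + 1] blocks are controlled although only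
    [m] increments are kept. *)
Lemma fine_coarse_dist :
  hausdorff (polygon n fine_path) (polygon m coarse_path) <= N%:R / n%:R + (r + r).
Proof.
have n0R : (0 : R) < n%:R by rewrite ltr0n.
have N0 : (0 < N)%N by move: (leq_ltn_trans (leq0n n) nN); rewrite muln_gt0 => /andP[].
have r0 : 0 <= r by apply: le_trans (alpha_small (leq0n n)).
apply: hausdorff_hull2; [exact: polygon_neq0|exact: polygon_neq0| |].
  move=> _ [k /= kn <-].
  have km : (k %/ N <= m)%N by rewrite -ltnS ltn_divLR//; exact: leq_ltn_trans kn nN.
  exists (coarse_path (k %/ N)); first by exists (k %/ N)%N.
  have kE := divn_eq k N; set j := (k %/ N)%N in km kE *.
  apply: (le_trans (edist2_le _ _)); rewrite /=.
  have -> : \sum_(i < k) beta i - \sum_(i < j * N) beta i =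
      \sum_(i < k %% N) beta (j * N + i)%N.
    have -> : \sum_(i < k) beta i = \sum_(i < j * N + k %% N) beta i by rewrite -kE.
    by rewrite big_split_ord/= addrAC subrr add0r.
  have -> : k%:R / n%:R + \sum_(i < k) alpha i - (j * N)%:R / n%:R =
      (k %% N)%:R / n%:R + \sum_(i < k) alpha i :> R.
    have -> : k%:R = (j * N)%:R + (k %% N)%:R :> R by rewrite -natrD -kE.
    by ring.
  have h1 : `|(k %% N)%:R / n%:R| <= N%:R / n%:R :> R.
    by rewrite ger0_norm ?divr_ge0// ler_pM2r ?invr_gt0// ler_nat ltnW// ltn_mod.
  have h2 := alpha_small kn; have h3 := beta_small km (ltnW (ltn_pmod k N0)).
  have := ler_normD ((k %% N)%:R / n%:R : R) (\sum_(i < k) alpha i); lra.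
move=> _ [j /= jm <-]; exists (fine_path (j * N)).
  by exists (j * N)%N => //=; rewrite (leq_trans _ Nm)// leq_mul2r jm orbT.
apply: (le_trans (edist2_le _ _)); rewrite /= subrr normr0 addr0 addrAC subrr add0r.
have jN : (j * N <= n)%N by rewrite (leq_trans _ Nm)// leq_mul2r jm orbT.
have := alpha_small jN; have : 0 <= N%:R / n%:R :> R by rewrite divr_ge0.
lra.
Qed.

End discretization.

Lemma sum_mkseq {R : realType} (f : nat -> R) n : \sum_(y <- mkseq f n) y = \sum_(i < n) f i.
Proof. by rewrite /mkseq big_map -[iota 0 n]/(iota 0 n) -{1}(subn0 n) big_mkord. Qed.

Lemma take_blocksums {R : realType} (f : nat -> R) (N m j : nat) : (j <= m)%N ->
  \sum_(y <- take j (blocksums N m (mkseq f (m * N)))) y = \sum_(i < j * N) f i.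
Proof.
elim: m j f => [|m IH] [|j] f //=; rewrite ?big_nil ?big_ord0//.
move=> jm; rewrite big_cons mulSn.
have -> : mkseq f (N + m * N) = mkseq f N ++ mkseq (fun i => f (N + i)%N) (m * N).
  rewrite /mkseq iotaD map_cat add0n; congr (_ ++ _).
  by rewrite -{1}(addn0 N) iotaDl -map_comp.
rewrite take_size_cat ?drop_size_cat ?size_mkseq// IH// sum_mkseq.
by rewrite mulSn big_split_ord.
Qed.

(** * Error of keeping only the block times *)

Section far.
Context {R : realType}.
Variable c : R.
Hypothesis c0 : 0 < c.

Lemma far_lt1 (y : R) : far (c * y) < 1 -> `|y| <= 3 / c.
Proof.
rewrite ltNge => h; rewrite ler_pdivlMr// mulrC -[X in X * _](gtr0_norm c0) -normrM.
apply: contrapT => /negP; rewrite -ltNge => h2.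
by move: h; rewrite /far clamp_eq1 ?lexx//; lra.
Qed.

Definition maxfar (f : nat -> R) n : R := maxwalk (fun x => far (c * x)) 0 (mkseq f n).

Lemma maxfar_ge0 f n : 0 <= maxfar f n.
Proof. by apply: maxwalk_ge0 => y; exact: clamp_ge0. Qed.

Lemma maxfar_lt1 f n k : (k <= n)%N -> maxfar f n < 1 -> `|\sum_(i < k) f i| <= 3 / c.
Proof.
move=> kn h; apply: far_lt1; apply: le_lt_trans h.
have := le_maxwalk (fun x => far (c * x)) 0 (mkseq f n) k.
rewrite add0r; have -> : take k (mkseq f n) = mkseq f k; last by rewrite sum_mkseq.
by rewrite /mkseq -map_take take_iota (minn_idPl kn).
Qed.

Variables (M L : R) (f : set (R * R) -> R).
Hypotheses (L0 : 0 <= L) (fL : K20_lip M L f).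

(** If the sum of the maxima reaches 1, the trivial bound [2 * M] suffices. Otherwise each maximum
    is below 1, no partial sum exceeds [3 / c], and the geometric estimate applies with [r = 3 / c].
    No indicator function is needed. *)
Lemma fine_coarse_error (alpha beta : nat -> R) (m n N : nat) :
  (0 < n)%N -> (m * N <= n)%N -> (n < m.+1 * N)%N ->
  `|f (polygon n (fine_path alpha beta n)) - f (polygon m (coarse_path beta n N))| <=
  L * (N%:R / n%:R + 6 / c) +
  2 * M * (maxfar alpha n + \sum_(j < m.+1) maxfar (fun i => beta (j * N + i)%N) N).
Proof.
move=> n0 Nm nN.
have K1 : K20 (polygon n (fine_path alpha beta n)).
  by apply: K20_polygon; rewrite /fine_path !big_ord0 mul0r addr0.
have K2 : K20 (polygon m (coarse_path beta n N)).
  by apply: K20_polygon; rewrite /coarse_path mul0n big_ord0 mul0r.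
have b1 := fL.1 _ K1; have b2 := fL.1 _ K2.
have M0 : 0 <= M by apply: le_trans b1.
set S := \sum_(j < m.+1) _.
have S0 : 0 <= S by apply: sumr_ge0 => j _; exact: maxfar_ge0.
have A0 := maxfar_ge0 alpha n.
have LL : 0 <= L * (N%:R / n%:R + 6 / c) by rewrite mulr_ge0// addr_ge0 ?divr_ge0// ltW.
have [h1|h1] := leP 1 (maxfar alpha n + S).
  have := ler_wpM2l (mulr_ge0 (ler0n _ 2) M0) h1.
  by have := ler_normB (f (polygon n (fine_path alpha beta n))) (f (polygon m (coarse_path beta n N))); lra.
have S1 j : (j <= m)%N -> maxfar (fun i => beta (j * N + i)%N) N < 1.
  move=> jm; apply: le_lt_trans h1.
  rewrite -[leLHS]add0r lerD// /S (bigD1 (Ordinal (jm : (j < m.+1)%N)))//= lerDl.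
  by apply: sumr_ge0 => i _; exact: maxfar_ge0.
have D : hausdorff (polygon n (fine_path alpha beta n)) (polygon m (coarse_path beta n N)) <=
    N%:R / n%:R + (3 / c + 3 / c).
  apply: fine_coarse_dist => // [k kn|j k jm kN].
    by apply: (@maxfar_lt1 alpha n k kn); lra.
  exact: (@maxfar_lt1 (fun i => beta (j * N + i)%N) N k kN (S1 j jm)).
apply: (le_trans (fL.2 _ _ K1 K2)).
have E : 6 / c = 3 / c + 3 / c by ring.
rewrite E; have := ler_wpM2l L0 D.
have P0 : 0 <= 2 * M * (maxfar alpha n + S).
  by apply: mulr_ge0; [exact: mulr_ge0|exact: addr_ge0].
lra.
Qed.

End far.

Section iid_facts.
Context {R : realType} {d : measure_display} {T : measurableType d}.
Variable P : probability T R.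

Lemma iid_map {d2 : measure_display} {U : measurableType d2} (Z : nat -> T -> U) (g : U -> R) :
  (forall k, measurable_fun setT (Z k)) ->
  (forall n, mutually_indep P (fun i : 'I_n => Z i)) ->
  (forall k (B : set U), measurable B -> P (Z k @^-1` B) = P (Z 0%N @^-1` B)) ->
  measurable_fun setT g -> iid P (fun k w => g (Z k w)).
Proof.
move=> mZ iZ lZ mg.
have mB (B : set R) : measurable B -> measurable (g @^-1` B).
  by move=> mB; rewrite -[X in measurable X]setTI; exact: mg.
split; first by move=> k; exact: measurableT_comp.
split=> [n B mBi|k B mB']; last exact: (lZ k (g @^-1` B) (mB _ mB')).
exact: (iZ n (fun i => g @^-1` (B i)) (fun i => mB _ (mBi i))).
Qed.

Lemma iid_scale (X : nat -> T -> R) (c : R) : iid P X -> iid P (fun k w => c * X k w).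
Proof. by move=> [mX [iX lX]]; apply: (iid_map mX iX lX); exact: measurable_funM. Qed.

(** The later variables are seen as a function of the first [j + n] that ignores the first [j];
    integrating over ignored samples changes nothing. *)
Lemma iid_shift (X : nat -> T -> R) (j n : nat) (M L : R) H : 0 <= L -> iid P X ->
  seqlip n M L H -> \int[P]_w H (mkseq (fun i => X (j + i)%N w) n) = iterE P (X 0%N) n H.
Proof.
move=> L0 XP [HM HL].
have HL' : seqlip (j + n) M L (fun s => H (drop j s)).
  split=> [s sn|s t sn tn]; first by apply: HM; rewrite size_drop sn addKn.
  apply: (le_trans (HL _ _ _ _)); rewrite ?size_drop ?sn ?tn ?addKn//.
  rewrite ler_wpM2l// -[in leRHS](cat_take_drop j s) -[in leRHS](cat_take_drop j t).
  by rewrite l1dist_cat ?size_take ?sn ?tn// lerDr l1dist_ge0.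
transitivity (\int[P]_w H (drop j (mkseq (X ^~ w) (j + n)))).
  apply: eq_Rintegral => w _; congr H.
  rewrite /mkseq iotaD map_cat drop_size_cat ?size_map ?size_iota// add0n.
  by rewrite -[in RHS](addn0 j) iotaDl -map_comp.
rewrite (iid_iterE XP HL') iterE_cat.
rewrite -[RHS](iterE_cst P (X 0%N) j); apply: eq_iterE => s sj; apply: eq_iterE => t _.
by rewrite drop_size_cat.
Qed.

Lemma Rintegral_sum_ord n (F : nat -> T -> R) :
  (forall i, P.-integrable setT (EFin \o F i)) ->
  P.-integrable setT (EFin \o (fun w => \sum_(i < n) F i w)) /\
  \int[P]_w (\sum_(i < n) F i w) = \sum_(i < n) \int[P]_w F i w.
Proof.
move=> iF; elim: n => [|n [IHi IH]].
  split; first by under eq_fun do rewrite big_ord0; exact: finite_measure_integrable_cst.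
  by under eq_Rintegral do rewrite big_ord0; rewrite Rintegral_prob_cst big_ord0.
have E : (fun w => \sum_(i < n.+1) F i w) = (fun w => \sum_(i < n) F i w + F n w).
  by apply/funext => w; rewrite big_ord_recr.
split; first by rewrite E; exact: (integrableD measurableT IHi (iF n)).
by under eq_Rintegral do rewrite big_ord_recr; rewrite RintegralD// IH big_ord_recr.
Qed.

End iid_facts.

Section maximal.
Context {R : realType} {d : measure_display} {T : measurableType d}.
Variables (P : probability T R) (X : nat -> T -> R) (v c : R).
Hypotheses (XP : iid P X) (iX : P.-integrable setT (EFin \o X 0%N))
  (EX : \int[P]_w X 0%N w = 0)
  (iX2 : P.-integrable setT (EFin \o (fun w => X 0%N w ^+ 2)))
  (EX2 : \int[P]_w X 0%N w ^+ 2 = v).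

Let farL n x : seqlip n 1 `|c| (maxwalk (fun x => far (c * x)) x).
Proof. by apply: seqlip_maxwalk => // [y|]; [exact: clamp_ge0|exact: lip1_far]. Qed.

Lemma maxfar_integrable j n :
  P.-integrable setT (EFin \o (fun w => maxfar c (fun i => X (j + i)%N w) n)).
Proof.
apply: (@bounded_integrable _ _ _ P (fun w => maxfar c (fun i => X (j + i)%N w) n) 1).
  by apply: (measurable_seqlip (X := fun i => X (j + i)%N) (farL n 0)) => i _; exact: XP.1.
by move=> w; apply: (farL n 0).1; rewrite size_mkseq.
Qed.

Lemma expectation_maxfar j n : n%:R * (c ^+ 2 * v) <= 1/4 ->
  \int[P]_w maxfar c (fun i => X (j + i)%N w) n <=
  2 * iterE P (X 0%N) n (fun s => medium (c * \sum_(y <- s) y)).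
Proof.
move=> h; rewrite /maxfar (iid_shift j _ XP (farL n 0))//.
have := ottaviani (XP.1 0%N) iX EX iX2 EX2 0 h.
by under [X in _ <= 2 * X -> _]eq_iterE do rewrite add0r.
Qed.

(** This cruder bound suffices for the drift error, whose [n] steps of size [1/n] have total
    variance of order [1/n]. *)
Lemma expectation_maxfar_variance n : n%:R * (c ^+ 2 * v) <= 1/4 ->
  \int[P]_w maxfar c (X ^~ w) n <= 10 * (n%:R * (c ^+ 2 * v)).
Proof.
move=> h; apply: (le_trans (expectation_maxfar 0 h)).
by have := iterE_medium c (XP.1 0%N) iX EX iX2 EX2 n; lra.
Qed.

End maximal.

(** * Brownian increments *)

Section brownian.
Context {R : realType} {d : measure_display} {T : measurableType d}.
Variables (Q : probability T R) (w : T -> R -> R).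
Hypothesis hw : std_brownian Q w.

Definition increment (n i : nat) (o : T) : R := w o (i.+1%:R / n%:R) - w o (i%:R / n%:R).

Lemma iid_increment n : (0 < n)%N -> iid Q (increment n) /\
  forall B, measurable B -> Q (increment n 0 @^-1` B) = normal_prob 0 (Num.sqrt n%:R^-1) B.
Proof.
move=> n0; have n0R : (0 : R) < n%:R by rewrite ltr0n.
have [mw [w0 [_ inc]]] := hw.
pose t (i : nat) : R := i%:R / n%:R.
have t0 : 0 <= t 0%N by rewrite /t mul0r.
have tt i : t i < t i.+1 by rewrite ltr_pM2r ?invr_gt0// ltr_nat.
have tE i : t i.+1 - t i = n%:R^-1 by rewrite /t -natr1; field; rewrite gt_eqF.
have law k B : measurable B -> Q (increment n k @^-1` B) = normal_prob 0 (Num.sqrt n%:R^-1) B.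
  by move=> mB; have [_ /(_ k (ltnSn k) B mB)] := inc k.+1 t t0 (fun i _ => tt i); rewrite tE.
split; last exact: law.
split; first by move=> k; apply: measurable_funB; exact: mw.
split=> [k|k B mB]; last by rewrite !law.
exact: (inc k t t0 (fun i _ => tt i)).1.
Qed.

Lemma sum_increment n k o : \sum_(i < k) increment n i o = w o (k%:R / n%:R).
Proof.
elim: k => [|k IH]; first by rewrite big_ord0 mul0r; have [_ [-> _]] := hw.
by rewrite big_ord_recr/= IH /increment addrC subrK.
Qed.

(** [medium] vanishes for [|y| <= 1/2] and [16 * y ^+ 4] is at least 1 beyond. *)
Lemma medium_le4 (y : R) : medium y <= 16 * y ^+ 4.
Proof.
have y4 : 0 <= y ^+ 4 by rewrite (exprM _ 2 2) sqr_ge0.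
have [h|h] := leP `|y| (1/2).
  rewrite /medium clamp_eq0; first by rewrite mulr_ge0.
  lra.
apply: (le_trans (clamp_le1 _)).
have : 1/4 <= y ^+ 2 by rewrite -real_normK ?num_real//; nra.
rewrite (exprM _ 2 2); nra.
Qed.

(* the fourth moment gives the square of N / n, so the sum over n / N blocks vanishes with N / n *)
Lemma brownian_medium (n N : nat) (c : R) : (0 < n)%N -> (0 < N)%N ->
  iterE Q (increment n 0) N (fun s => medium (c * \sum_(y <- s) y)) <=
  2048 * c ^+ 4 * (N%:R / n%:R) ^+ 2.
Proof.
move=> n0 N0; have [XP _] := iid_increment n0.
have [mw [w0 [_ inc]]] := hw.
have ml : seqlip N 1 (2 * `|c|) (fun s => medium (c * (0 + \sum_(y <- s) y))).
  by apply: (lip1_seqlip _ _ _ (lip1_medium c)); rewrite mulr_ge0.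
under eq_iterE do rewrite -[X in c * X]add0r.
rewrite -(iid_iterE XP ml).
under eq_Rintegral do rewrite add0r sum_mkseq sum_increment.
set t := N%:R / n%:R; have t0 : 0 < t by rewrite divr_gt0// ltr0n.
pose tt (i : nat) : R := i%:R * t.
have tt0 : 0 <= tt 0%N by rewrite /tt mul0r.
have ttS i : tt i < tt i.+1 by rewrite ltr_pM2r// ltr_nat.
have law B : measurable B -> Q ((fun o => w o t) @^-1` B) = normal_prob 0 (Num.sqrt t) B.
  move=> mB; have [_ /(_ 0%N isT B mB)] := inc 1%N tt tt0 (fun i _ => ttS i).
  rewrite /tt mul0r mul1r subr0 => <-; congr (Q _); apply/seteqP; split=> o /=; rewrite w0 subr0//.
have st : 0 < Num.sqrt t by rewrite sqrtr_gt0.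
have [i4 E4] := normal_fourth_moment (mw t) st law.
have ic : Q.-integrable setT (EFin \o (fun o => 16 * c ^+ 4 * w o t ^+ 4)).
  exact: (integrableZl measurableT (16 * c ^+ 4) i4).
apply: (@le_trans _ _ (\int[Q]_o (16 * c ^+ 4 * w o t ^+ 4))).
  apply: le_expectation => //.
    exact: (lip1_integrable Q (mw t) (lip1_medium c)).
  by move=> o; apply: (le_trans (medium_le4 _)); rewrite exprMn mulrA.
rewrite RintegralZl//.
have -> : 2048 * c ^+ 4 * t ^+ 2 = 16 * c ^+ 4 * (128 * Num.sqrt t ^+ 4).
  by rewrite (exprM (Num.sqrt t) 2 2) sqr_sqrtr; [ring|exact: ltW].
by rewrite ler_wpM2l// mulr_ge0// (exprM c 2 2) sqr_ge0.
Qed.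

End brownian.

(** * Continuous paths and the hulls of their graphs *)

Section paths.
Context {R : realType}.
Implicit Types (g : R -> R).

(** Heine-Cantor on [[0, 1]]: the covering form of compactness, applied along [dl] tending to 0 from
    the right, turns local moduli into a common one. Halving the radius and the tolerance leaves
    room for the triangle inequality. *)
Lemma uniform_modulus g (e : R) : {within [set t : R | 0 <= t], continuous g} -> 0 < e ->
  exists2 dl : R, 0 < dl & forall s t, 0 <= s <= 1 -> 0 <= t <= 1 -> `|s - t| <= dl ->
    `|g s - g t| <= e.
Proof.
move=> /subspace_continuousP gc e0.
have := @compact_near_coveringP R `[(0:R), 1]; case=> + _.
move=> /(_ (@segment_compact _ 0 1)) /(_ R (0^'+)%R
  (fun dl s => 0 <= s -> forall t, 0 <= t -> `|s - t| <= dl -> `|g s - g t| <= e)).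
move=> H.
have {}H : \forall i \near 0^'+, `[0, 1] `<=` (fun s => 0 <= s -> forall t, 0 <= t -> `|s - t| <= i -> `|g s - g t| <= e).
  apply: H => x; rewrite /= in_itv/= => /andP[x0 x1].
  have /cvgrPdist_le/(_ (e / 2)) := gc x x0.
  rewrite divr_gt0// => /(_ isT).
  rewrite nearE /within/= => /nbhs_ballP[eta /= eta0 heta].
  exists (ball x (eta / 2), [set dl | dl < eta / 2]).
    split; first by apply: nbhsx_ballx; rewrite divr_gt0.
    by apply: nbhs_right_lt; rewrite divr_gt0.
  move=> [s dl] [/= xs dls] s0 t t0 st.
  have h1 : `|g x - g s| <= e / 2.
    by apply: heta => //=; apply: lt_trans xs _; lra.
  have h2 : `|g x - g t| <= e / 2.
    apply: heta => //=; rewrite /ball/= in xs *.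
    by have := ler_normD (x - s) (s - t); rewrite addrA subrK; lra.
  by have := ler_normB (g x - g t) (g x - g s); rewrite opprB addrC addrA subrK; lra.
have [dl [Hdl dl0]] := filter_ex (filterI H (nbhs_right_gt (0 : R))).
exists dl => // s t /andP[s0 s1] /andP[t0 _] st.
by apply: (Hdl s _ s0 t t0 st); rewrite /= in_itv/= s0 s1.
Qed.

Lemma eq_polygon m (p q : nat -> R * R) : (forall j, (j <= m)%N -> p j = q j) ->
  polygon m p = polygon m q.
Proof.
move=> pq; congr hull2; apply/seteqP; split=> _ [k km <-]; exists k => //.
  by rewrite pq.
by rewrite pq.
Qed.

(** [htilde1 w o] is convertible to [graph_hull (w o)]; this form isolates the arguments about one
    fixed path. *)
Definition graph_hull g : set (R * R) := hull2 [set (s, g s) | s in [set s : R | 0 <= s <= 1]].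

Lemma K20_graph_hull g : {within [set t : R | 0 <= t], continuous g} -> g 0 = 0 ->
  K20 (graph_hull g).
Proof.
move=> gc g0; apply: K20_hull2; last by exists 0; rewrite /= ?lexx ?ler01 ?g0.
have gc' : {within `[0, 1], continuous g}.
  by apply: continuous_subspaceW gc => t /=; rewrite in_itv/= => /andP[].
have -> : [set (s, g s) | s in [set s : R | 0 <= s <= 1]] = (fun s => (s, g s)) @` `[0, 1].
  by apply/seteqP; split=> _ [s s01 <-]; exists s => //; move: s01; rewrite /= in_itv.
apply: continuous_compact; last exact: segment_compact.
have h : {within `[0, 1], continuous (id : R -> R)}.
  by apply: continuous_subspaceT => ?; exact: cvg_id.
by move=> s; exact: (cvg_pair (h s) (gc' s)).
Qed.

Lemma graph_polygon_dist g (m : nat) (e dl : R) (t_ : nat -> R) : (0 < m)%N ->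
  (forall j, (j <= m)%N -> 0 <= t_ j <= 1) ->
  (forall s, 0 <= s <= 1 -> exists2 j, (j <= m)%N & `|s - t_ j| <= dl) ->
  (forall s t, 0 <= s <= 1 -> 0 <= t <= 1 -> `|s - t| <= dl -> `|g s - g t| <= e) ->
  0 <= dl -> 0 <= e ->
  hausdorff (polygon m (fun j => (t_ j, g (t_ j)))) (graph_hull g) <= dl + e.
Proof.
move=> m0 t01 tcov gdl dl0 e0.
apply: hausdorff_hull2.
- exact: polygon_neq0.
- by exists (0, g 0), 0 => //=; rewrite lexx ler01.
- move=> _ [j jm <-]; exists (t_ j, g (t_ j)).
    by exists (t_ j) => //; exact: t01.
  by rewrite edist2xx addr_ge0.
move=> _ [s /= s01 <-]; have [j jm sj] := tcov s s01.
exists (t_ j, g (t_ j)); first by exists j.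
apply: (le_trans (edist2_le _ _)); rewrite /= distrC [X in _ + X]distrC lerD//.
by apply: gdl => //; exact: t01.
Qed.

Lemma grid01 (m j : nat) : (j <= m)%N -> 0 <= (j%:R / m%:R : R) <= 1.
Proof.
move=> jm; rewrite divr_ge0//=; have [->|m0] := posnP m; first by rewrite invr0 mulr0.
by rewrite ler_pdivrMr ?ltr0n// mul1r ler_nat.
Qed.

Lemma grid_cover (m : nat) (s : R) : (0 < m)%N -> 0 <= s <= 1 ->
  exists2 j, (j <= m)%N & `|s - j%:R / m%:R| <= m%:R^-1.
Proof.
move=> m0 /andP[s0 s1]; have m0R : (0 : R) < m%:R by rewrite ltr0n.
have /andP[h1 h2] := truncn_itv (mulr_ge0 s0 (ltW m0R)).
exists (Num.trunc (s * m%:R)).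
  by rewrite -(ler_nat R); apply: (le_trans h1); rewrite ler_piMl// ltW.
rewrite -(ler_pM2r m0R) mulVf ?gt_eqF// -[X in _ * X](gtr0_norm m0R) -normrM mulrBl.
rewrite divfK ?gt_eqF//; move: h1 h2; rewrite -natr1; set k := _%:R => h1 h2.
by rewrite ger0_norm; lra.
Qed.

End paths.

(** * Hulls of sampled Brownian paths *)

Section brownian_limits.
Context {R : realType} {d : measure_display} {T : measurableType d}.
Variables (Q : probability T R) (w : T -> R -> R).
Hypothesis hw : std_brownian Q w.
Variables (M L : R) (f : set (R * R) -> R).
Hypotheses (L0 : 0 <= L) (fL : K20_lip M L f).

Let mw t : measurable_fun setT (w^~ t). Proof. by case: hw => mw _; exact: mw. Qed.
Let w0 o : w o 0 = 0. Proof. by case: hw => _ [w0 _]; exact: w0. Qed.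
Let wc o : {within [set t : R | 0 <= t], continuous (w o)}.
Proof. by case: hw => _ [_ [wc _]]; exact: wc. Qed.

Definition brownian_polygon (m : nat) (t_ : nat -> R) (o : T) : set (R * R) :=
  polygon m (fun j => (t_ j, w o (t_ j))).

Lemma K20_brownian_polygon m t_ o : t_ 0%N = 0 -> K20 (brownian_polygon m t_ o).
Proof. by move=> t0; apply: K20_polygon; rewrite t0 w0. Qed.

Lemma measurable_brownian_polygon m t_ : t_ 0%N = 0 ->
  measurable_fun setT (fun o => f (brownian_polygon m t_ o)).
Proof.
move=> t0.
have := @measurable_seqlip _ _ _ (fun i o => w o (t_ i.+1)) m _ _ _
  (seqlip_points L0 fL m t0) (fun i _ => mw _).
congr (measurable_fun _ _); apply/funext => o; congr f; apply: eq_polygon => -[|j] jm.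
  by rewrite /= t0 w0.
by rewrite /= nth_mkseq.
Qed.

(** When [m] does not divide [n], block ends fall at [j * (n %/ m) / n] instead of [j / m]. The gap
    is at most [m / n], and uniform continuity of each path absorbs it. *)
Lemma brownian_polygon_cvg_n (m : nat) : (0 < m)%N ->
  (fun n => \int[Q]_o f (brownian_polygon m (fun j => (j * (n %/ m))%:R / n%:R) o)) @ \oo -->
  \int[Q]_o f (brownian_polygon m (fun j => j%:R / m%:R) o).
Proof.
move=> m0; have m0R : (0 : R) < m%:R by rewrite ltr0n.
have t0 n : ((0 * (n %/ m))%:R / n%:R : R) = 0 by rewrite mul0n mul0r.
have t0' : (0%:R / m%:R : R) = 0 by rewrite mul0r.
apply: (@Rintegral_dominated_cvg _ _ _ _ _ _ (cst M)).
- by move=> n; apply: measurable_brownian_polygon; exact: t0.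
- move=> o; apply/cvgrPdist_le => /= e e0.
  have L1 : 0 < L + 1 by rewrite ltr_wpDl.
  have e1 : 0 < e / (2 * (L + 1)) by rewrite divr_gt0// mulr_gt0.
  have [dl dl0 wdl] := uniform_modulus (@wc o) e1.
  pose u := Num.min dl (e / (2 * (L + 1))).
  have u0 : 0 < u by rewrite lt_min dl0 e1.
  exists (Num.truncn (m%:R / u)).+1 => // n /= hn.
  have n0 : (0 < n)%N by exact: leq_ltn_trans (leq0n _) hn.
  have n0R : (0 : R) < n%:R by rewrite ltr0n.
  have mn : m%:R / n%:R <= u.
    rewrite ler_pdivrMr// mulrC -ler_pdivrMr// ltW// (lt_le_trans (truncnS_gt _))//.
    by rewrite ler_nat.
  have mnN : (m * (n %/ m) <= n)%N by rewrite mulnC leq_trunc_div.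
  have close j : (j <= m)%N ->
      `|j%:R / m%:R - (j * (n %/ m))%:R / n%:R| <= u :> R.
    move=> jm; apply: le_trans mn.
    have -> : j%:R / m%:R - (j * (n %/ m))%:R / n%:R =
        (j%:R / m%:R) * ((n %% m)%:R / n%:R) :> R.
      have nE : n%:R = (n %/ m)%:R * m%:R + (n %% m)%:R :> R.
        by rewrite -natrM -natrD -divn_eq.
      rewrite natrM; have -> : (n %% m)%:R = n%:R - (n %/ m)%:R * m%:R :> R by rewrite nE addrAC subrr add0r.
      by field; rewrite !gt_eqF.
    have /andP[j0 j1] := @grid01 R m j jm.
    rewrite ger0_norm ?mulr_ge0 ?divr_ge0//.
    apply: (le_trans (ler_piMl _ j1)); first by rewrite divr_ge0.
    by rewrite ler_pM2r ?invr_gt0// ler_nat ltnW// ltn_mod.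
  have D : hausdorff (brownian_polygon m (fun j => j%:R / m%:R) o)
     (brownian_polygon m (fun j => (j * (n %/ m))%:R / n%:R) o) <= e / (L + 1).
    apply: polygon_dist => j jm; apply: (le_trans (edist2_le _ _)) => /=.
    have -> : e / (L + 1) = e / (2 * (L + 1)) + e / (2 * (L + 1)).
      by field; rewrite gt_eqF.
    have := close j jm; rewrite le_min => /andP[c1 c2].
    rewrite lerD//; apply: wdl => //; first exact: grid01.
    by apply: grid01; apply: leq_trans mnN; rewrite leq_mul2r jm orbT.
  have K1 := K20_brownian_polygon m o (t0' : (fun j => j%:R / m%:R) 0%N = 0).
  have K2 := K20_brownian_polygon m o (t0 n : (fun j => (j * (n %/ m))%:R / n%:R) 0%N = 0).
  apply: (le_trans (fL.2 _ _ K1 K2)); apply: (le_trans (ler_wpM2l L0 D)).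
  by rewrite mulrCA ler_piMr ?(ltW e0)// ler_pdivrMr// mul1r; lra.
- exact: finite_measure_integrable_cst.
by move=> n o; apply: fL.1; apply: K20_brownian_polygon.
Qed.

Lemma brownian_polygon_cvg_graph o :
  (fun m => f (brownian_polygon m.+1 (fun j => j%:R / m.+1%:R) o)) @ \oo -->
  f (graph_hull (w o)).
Proof.
apply/cvgrPdist_le => /= e e0.
have L1 : 0 < L + 1 by rewrite ltr_wpDl.
have e1 : 0 < e / (2 * (L + 1)) by rewrite divr_gt0// mulr_gt0.
have [dl dl0 wdl] := uniform_modulus (@wc o) e1.
pose u := Num.min dl (e / (2 * (L + 1))).
have u0 : 0 < u by rewrite lt_min dl0 e1.
exists (Num.truncn u^-1) => // m /= hm.
have mu : m.+1%:R^-1 <= u.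
  rewrite invf_ple ?posrE ?ltr0n// ltW// (lt_le_trans (truncnS_gt _))//.
  by rewrite ler_nat.
move: (mu); rewrite le_min => /andP[c1 c2].
have K1 := K20_graph_hull (@wc o) (w0 o).
have K2 : K20 (brownian_polygon m.+1 (fun j => j%:R / m.+1%:R) o).
  by apply: K20_brownian_polygon; rewrite mul0r.
have D : hausdorff (brownian_polygon m.+1 (fun j => j%:R / m.+1%:R) o) (graph_hull (w o)) <=
    m.+1%:R^-1 + e / (2 * (L + 1)).
  apply: graph_polygon_dist => //.
  - by move=> j jm; exact: grid01.
  - by move=> s s01; exact: grid_cover.
  - by move=> s t s01 t01 st; apply: wdl => //; exact: le_trans st c1.
  exact: ltW.
rewrite distrC; apply: (le_trans (fL.2 _ _ K2 K1)); apply: (le_trans (ler_wpM2l L0 D)).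
apply: (@le_trans _ _ (L * (e / (L + 1)))).
  rewrite ler_wpM2l//.
  have -> : e / (L + 1) = e / (2 * (L + 1)) + e / (2 * (L + 1)).
    by field; rewrite gt_eqF.
  by rewrite lerD2r.
by rewrite mulrCA ler_piMr ?(ltW e0)// ler_pdivrMr// mul1r; lra.
Qed.

Lemma measurable_graph_hull : measurable_fun setT (fun o => f (graph_hull (w o))).
Proof.
apply: (@measurable_fun_cvg _ _ _ setT
  (fun m o => f (brownian_polygon m.+1 (fun j => j%:R / m.+1%:R) o))) => [m|o _].
  by apply: measurable_brownian_polygon; rewrite mul0r.
exact: brownian_polygon_cvg_graph.
Qed.

Lemma brownian_polygon_cvg_m :
  (fun m => \int[Q]_o f (brownian_polygon m.+1 (fun j => j%:R / m.+1%:R) o)) @ \oo -->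
  \int[Q]_o f (graph_hull (w o)).
Proof.
apply: (@Rintegral_dominated_cvg _ _ _ _ _ _ (cst M)).
- by move=> m; apply: measurable_brownian_polygon; rewrite mul0r.
- exact: brownian_polygon_cvg_graph.
- exact: finite_measure_integrable_cst.
by move=> m o; apply: fL.1; apply: K20_brownian_polygon; rewrite mul0r.
Qed.

End brownian_limits.

(** The chain leads from the walk to its block skeleton, to Brownian motion at the same times, to
    Brownian motion on the regular grid, and to the full path; the orientations are those of the
    four estimates. *)
Lemma dist_chain4 {R : realType} (x0 x1 x2 x3 x4 e1 e2 e3 e4 : R) :
  `|x0 - x1| <= e1 -> `|x1 - x2| <= e2 -> `|x3 - x2| <= e3 -> `|x4 - x3| <= e4 ->
  `|x4 - x0| <= e1 + e2 + e3 + e4.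
Proof. by rewrite !ler_norml; lra. Qed.

(** * Convergence for Lipschitz functions of the hull *)

Section walk_limit.
Context {R : realType} {d d' : measure_display} {T : measurableType d} {T' : measurableType d'}.
Variables (P : probability T R) (a b : nat -> T -> R) (v : R).
Hypotheses (aP : iid P a) (ia : P.-integrable setT (EFin \o a 0%N))
  (Ea : \int[P]_w a 0%N w = 0)
  (ia2 : P.-integrable setT (EFin \o (fun w => a 0%N w ^+ 2)))
  (Ea2 : \int[P]_w a 0%N w ^+ 2 = v).
Hypotheses (bP : iid P b) (ib : P.-integrable setT (EFin \o b 0%N))
  (Eb : \int[P]_w b 0%N w = 0)
  (ib2 : P.-integrable setT (EFin \o (fun w => b 0%N w ^+ 2)))
  (Eb2 : \int[P]_w b 0%N w ^+ 2 = 1).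
Variables (Q : probability T' R) (w : T' -> R -> R).
Hypothesis hw : std_brownian Q w.
Variables (M L : R) (f : set (R * R) -> R).
Hypotheses (L0 : 0 <= L) (fL : K20_lip M L f).

Let alpha (n i : nat) (o : T) : R := n%:R^-1 * a i o.
Let beta (n i : nat) (o : T) : R := Num.sqrt n%:R^-1 * b i o.

Definition walk_polygon (n : nat) (o : T) : set (R * R) :=
  polygon n (fine_path (alpha n ^~ o) (beta n ^~ o) n).

Lemma K20_walk_polygon n o : K20 (walk_polygon n o).
Proof. by apply: K20_polygon; rewrite /fine_path !big_ord0 mul0r addr0. Qed.

Let alphaP n : iid P (alpha n). Proof. exact: iid_scale. Qed.
Let betaP n : iid P (beta n). Proof. exact: iid_scale. Qed.

Lemma measurable_walk_polygon n : measurable_fun setT (fun o => f (walk_polygon n o)).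
Proof.
(* Both coordinates of the walk are packed into one sequence of length [n + n], so that
   measurability of Lipschitz functions of a sequence applies. *)
pose X i := if (i < n)%N then alpha n i else beta n (i - n).
pose p (s : seq R) (k : nat) : R * R :=
  (k%:R / n%:R + \sum_(y <- take k (take n s)) y, \sum_(y <- take k (drop n s)) y).
have pl : seqlip (n + n) M L (fun s => f (polygon n (p s))).
  apply: (seqlip_polygon L0 fL) => [s|s t sn tn k kn].
    by rewrite /p !take0 !big_nil mul0r addr0.
  apply: (le_trans (edist2_le _ _)); rewrite /= opprD addrACA subrr add0r.
  have h (s' t' : seq R) : size s' = size t' ->
      `|\sum_(y <- take k s') y - \sum_(y <- take k t') y| <= l1dist s' t'.
    move=> st; have st' : size (take k s') = size (take k t') by rewrite !size_take st.
    apply: (le_trans (l1dist_sum st')).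
    rewrite -{2}(cat_take_drop k s') -{2}(cat_take_drop k t') l1dist_cat// lerDl.
    exact: l1dist_ge0.
  rewrite -[in leRHS](cat_take_drop n s) -[in leRHS](cat_take_drop n t).
  by rewrite l1dist_cat ?size_take ?sn ?tn// lerD// h// ?size_take ?size_drop sn tn.
have mX i : (i < n + n)%N -> measurable_fun setT (X i).
  by move=> _; rewrite /X; case: ifP => _; [exact: (alphaP n).1|exact: (betaP n).1].
have := measurable_seqlip pl mX; congr (measurable_fun _ _); apply/funext => o.
congr f; apply: eq_polygon => k kn.
have -> : mkseq (X ^~ o) (n + n) = mkseq (alpha n ^~ o) n ++ mkseq (beta n ^~ o) n.
  rewrite /mkseq iotaD map_cat add0n; congr (_ ++ _).
    apply: (@eq_from_nth _ 0); rewrite !size_map// size_iota => i ni.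
    by rewrite !(nth_map 0%N) ?size_iota// nth_iota// add0n /X ni.
  rewrite -[X in iota X _]addn0 iotaDl -map_comp; apply: eq_map => i /=.
  by rewrite /X ltnNge leq_addr/= addKn.
rewrite /p take_size_cat ?drop_size_cat ?size_mkseq//.
have tk (F : nat -> R) : \sum_(y <- take k (mkseq F n)) y = \sum_(i < k) F i.
  by rewrite /mkseq -map_take take_iota (minn_idPl kn) sum_mkseq.
by rewrite !tk.
Qed.

Let coarseP (m n : nat) (o : T) := polygon m (coarse_path (beta n ^~ o) n (n %/ m)).
Let F (m n : nat) (s : seq R) : R :=
  f (polygon m (fun j => ((j * (n %/ m))%:R / n%:R, \sum_(y <- take j s) y))).

Let FL m n : seqlip m M L (F m n).
Proof. by apply: (seqlip_partial_sums L0 fL); rewrite mul0n mul0r. Qed.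

Let coarseE m n o : f (coarseP m n o) =
  F m n (blocksums (n %/ m) m (mkseq (beta n ^~ o) (m * (n %/ m)))).
Proof.
by congr f; apply: eq_polygon => j jm; rewrite /coarse_path take_blocksums.
Qed.

Lemma expectation_coarse m n :
  \int[P]_o f (coarseP m n o) = iterE P (beta n 0%N) (m * (n %/ m))
     (fun s => F m n (blocksums (n %/ m) m s)).
Proof.
under eq_Rintegral do rewrite coarseE.
exact: (iid_iterE (betaP n) (seqlip_blocksums _ L0 (FL m n))).
Qed.

Lemma expectation_brownian_coarse m n : (0 < n)%N ->
  \int[Q]_o f (brownian_polygon w m (fun j => (j * (n %/ m))%:R / n%:R) o) =
  iterE Q (increment w n 0) (m * (n %/ m)) (fun s => F m n (blocksums (n %/ m) m s)).
Proof.
move=> n0; have [XP _] := iid_increment hw n0.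
rewrite -(iid_iterE XP (seqlip_blocksums _ L0 (FL m n))).
apply: eq_Rintegral => o _; congr f; apply: eq_polygon => j jm.
by rewrite take_blocksums// (sum_increment hw).
Qed.

Let M0 : 0 <= M.
Proof. by have := fL.1 _ (K20_walk_polygon 0 point); exact: le_trans. Qed.

Lemma coarse_clt (m : nat) (e : R) : 0 < e -> \forall n \near \oo,
  `|\int[P]_o f (coarseP m n o) -
    \int[Q]_o f (brownian_polygon w m (fun j => (j * (n %/ m))%:R / n%:R) o)| <= e.
Proof.
move=> e0; have e1 : 0 < e / m.+1%:R by rewrite divr_gt0.
have meta n : measurable_fun setT (increment w n 0).
  by case: hw => mw _; apply: measurable_funB; exact: mw.
have etaN n : (0 < n)%N -> forall B, measurable B ->
    Q (increment w n 0 @^-1` B) = normal_prob 0 (Num.sqrt n%:R^-1) B.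
  by move=> n0; have [_] := iid_increment hw n0.
have [n0 n0P] := clt (bP.1 0%N) ib Eb ib2 Eb2 meta etaN M0 L0 e1.
exists n0.+1 => // n /= hn.
have n_gt0 : (0 < n)%N by exact: leq_ltn_trans (leq0n _) hn.
rewrite expectation_coarse expectation_brownian_coarse//.
apply: (@le_trans _ _ (m%:R * (e / m.+1%:R))); last first.
  by rewrite mulrCA ler_piMr ?(ltW e0)// ler_pdivrMr// mul1r ler_nat.
apply: (iterE_blocksums _ _ L0 _ (FL m n)).
- exact: (betaP n).1.
- exact: meta.
move=> g gL; have := n0P n (ltnW hn) (n %/ m)%N (leq_div _ _) g 0 gL.
under eq_iterE do rewrite add0r.
by under [X in _ - X]eq_iterE do rewrite add0r.
Qed.

(** The two bounds by [1/4] are the hypotheses of Ottaviani's inequality: for the drift error over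
    all [n] steps, and for the perpendicular walk over one block, whose variance [N / n] is at most
    [1 / m]. *)
Lemma coarse_error (m n : nat) (c : R) : (0 < m)%N -> (m * m <= n)%N -> 0 < c ->
  c ^+ 2 * v / n%:R <= 1/4 -> c ^+ 2 / m%:R <= 1/4 ->
  `|\int[P]_o f (walk_polygon n o) - \int[P]_o f (coarseP m n o)| <=
  L * (m%:R^-1 + 6 / c) + 2 * M * (10 * (c ^+ 2 * v / n%:R) + m.+1%:R *
    (2 * iterE P (beta n 0%N) (n %/ m) (fun s => medium (c * \sum_(y <- s) y)))).
Proof.
move=> m0 mmn c0 cv cm; set N := (n %/ m)%N; set I := iterE _ _ _ _.
have n0 : (0 < n)%N by apply: leq_trans mmn; rewrite muln_gt0 m0.
have n0R : (0 : R) < n%:R by rewrite ltr0n.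
have m0R : (0 : R) < m%:R by rewrite ltr0n.
have Nm : (m * N <= n)%N by rewrite mulnC leq_trunc_div.
have mN : (m <= N)%N by rewrite leq_divRL.
(* From [m * m <= n] follows [m <= N], so the remainder [n %% m] is shorter than one block. *)
have nN : (n < m.+1 * N)%N.
  rewrite {1}(divn_eq n m) -/N mulSn addnC mulnC ltn_add2r.
  by apply: leq_trans mN; rewrite ltn_mod.
have NnR : N%:R / n%:R <= m%:R^-1 :> R.
  rewrite ler_pdivrMr// ler_pdivlMl// -natrM ler_nat//.
have ialpha : P.-integrable setT (EFin \o alpha n 0%N) by exact: (integrableZl measurableT n%:R^-1 ia).
have Ealpha : \int[P]_o alpha n 0%N o = 0 by rewrite RintegralZl// Ea mulr0.
have ialpha2 : P.-integrable setT (EFin \o (fun o => alpha n 0%N o ^+ 2)).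
  have := integrableZl measurableT (n%:R^-1 ^+ 2) ia2; congr (_.-integrable _ _).
  by apply/funext => o /=; rewrite exprMn EFinM.
have Ealpha2 : \int[P]_o alpha n 0%N o ^+ 2 = n%:R^-1 ^+ 2 * v.
  by under eq_Rintegral do rewrite exprMn; rewrite RintegralZl// Ea2.
have sn2 : Num.sqrt n%:R^-1 ^+ 2 = n%:R^-1 :> R by rewrite sqr_sqrtr// invr_ge0 ltW.
have ibeta : P.-integrable setT (EFin \o beta n 0%N) by exact: (integrableZl measurableT (Num.sqrt n%:R^-1) ib).
have Ebeta : \int[P]_o beta n 0%N o = 0 by rewrite RintegralZl// Eb mulr0.
have ibeta2 : P.-integrable setT (EFin \o (fun o => beta n 0%N o ^+ 2)).
  have := integrableZl measurableT n%:R^-1 ib2; congr (_.-integrable _ _).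
  by apply/funext => o /=; rewrite exprMn sn2 EFinM.
have Ebeta2 : \int[P]_o beta n 0%N o ^+ 2 = n%:R^-1.
  by under eq_Rintegral do rewrite exprMn sn2; rewrite RintegralZl// Eb2 mulr1.
have hA : n%:R * (c ^+ 2 * (n%:R^-1 ^+ 2 * v)) = c ^+ 2 * v / n%:R.
  by field; rewrite gt_eqF.
have hA' : n%:R * (c ^+ 2 * (n%:R^-1 ^+ 2 * v)) <= 1/4 by rewrite hA.
have hB : N%:R * (c ^+ 2 * n%:R^-1) <= 1/4.
  apply: le_trans cm; rewrite mulrCA ler_pM2l ?exprn_gt0//.
have TA := expectation_maxfar_variance (alphaP n) ialpha Ealpha ialpha2 Ealpha2 hA'.
have TB j := expectation_maxfar (betaP n) ibeta Ebeta ibeta2 Ebeta2 j hB.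
have iA := maxfar_integrable c (alphaP n) 0 n.
have iB j := maxfar_integrable c (betaP n) (j * N) N.
have [iS ES] := Rintegral_sum_ord m.+1 iB.
pose K := L * (m%:R^-1 + 6 / c).
have iK : P.-integrable setT (EFin \o (fun=> K)) by exact: finite_measure_integrable_cst.
pose S o := maxfar c (alpha n ^~ o) n + \sum_(j < m.+1) maxfar c (fun i => beta n (j * N + i)%N o) N.
have iSS : P.-integrable setT (EFin \o S) by exact: (integrableD measurableT iA iS).
have iMS : P.-integrable setT (EFin \o (fun o => 2 * M * S o)).
  exact: (integrableZl measurableT (2 * M) iSS).
have iKS : P.-integrable setT (EFin \o (fun o => K + 2 * M * S o)).
  exact: (integrableD measurableT iK iMS).
apply: (@le_trans _ _ (\int[P]_o (K + 2 * M * S o))).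
  apply: expectation_dist_le => //.
  - apply: (@bounded_integrable _ _ _ P (fun o => f (walk_polygon n o)) M).
      exact: measurable_walk_polygon.
    by move=> o; apply: fL.1; exact: K20_walk_polygon.
  - apply: (@bounded_integrable _ _ _ P (fun o => f (coarseP m n o)) M).
      under eq_fun do rewrite coarseE.
      apply: (measurable_seqlip (seqlip_blocksums _ L0 (FL m n))) => i _.
      exact: (betaP n).1.
    move=> o; apply: fL.1; apply: K20_polygon.
    by rewrite /coarse_path mul0n big_ord0 mul0r.
  move=> o; apply: (le_trans (fine_coarse_error c0 L0 fL (alpha n ^~ o) (beta n ^~ o) n0 Nm nN)).
  by rewrite lerD2r ler_wpM2l// lerD2r.
rewrite RintegralD// Rintegral_prob_cst lerD2l RintegralZl// ler_wpM2l ?mulr_ge0//.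
rewrite /S RintegralD// lerD//; first by apply: (le_trans TA); rewrite hA.
rewrite ES.
apply: (@le_trans _ _ (\sum_(j < m.+1) 2 * I)); first by apply: ler_sum => j _; exact: TB.
by rewrite sumr_const card_ord (mulr_natl _ m.+1).
Qed.

(** This moves the bound on the oscillation of a block to Brownian increments, where fourth moments
    exist. *)
Lemma medium_clt (c e : R) : 0 < e -> \forall n \near \oo, forall N, (N <= n)%N ->
  `|iterE P (beta n 0%N) N (fun s => medium (c * \sum_(y <- s) y)) -
    iterE Q (increment w n 0) N (fun s => medium (c * \sum_(y <- s) y))| <= e.
Proof.
move=> e0; have meta n : measurable_fun setT (increment w n 0).
  by case: hw => mw _; apply: measurable_funB; exact: mw.
have etaN n : (0 < n)%N -> forall B, measurable B ->
    Q (increment w n 0 @^-1` B) = normal_prob 0 (Num.sqrt n%:R^-1) B.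
  by move=> n0; have [_] := iid_increment hw n0.
have c2 : 0 <= 2 * `|c| by rewrite mulr_ge0.
have [n0 n0P] := clt (bP.1 0%N) ib Eb ib2 Eb2 meta etaN ler01 c2 e0.
exists n0 => // n /= hn N Nn.
have := n0P n hn N Nn _ 0 (lip1_medium c).
under eq_iterE do rewrite add0r.
by under [X in _ - X]eq_iterE do rewrite add0r.
Qed.

Lemma near_harmonic_le (C e : R) : 0 < e -> \forall n \near \oo, C / n.+1%:R <= e.
Proof.
move=> e0; exists (Num.truncn (`|C| / e)) => // n /= hn.
have h1 : `|C| / e <= n.+1%:R.
  by apply: (le_trans (ltW (truncnS_gt _))); rewrite ler_nat.
rewrite ler_pdivrMr ?ltr0n// mulrC; move: h1; rewrite ler_pdivrMr//.
exact: le_trans (ler_norm _).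
Qed.

(** The parameters are chosen in the order [c], [m], [n]. The eight parts of [e0] go to the
    geometric error (two), the drift (one), the oscillation in the blocks (two), the central limit
    theorem and the two Brownian limits (one each). *)
Lemma walk_polygon_cvg : (fun n => \int[P]_o f (walk_polygon n o)) @ \oo -->
  \int[Q]_o f (graph_hull (w o)).
Proof.
apply/cvgrPdist_le => /= e0 e00; pose e := e0 / 8.
have e8 : e0 = 8 * e by rewrite /e; field.
have e_gt0 : 0 < e by rewrite divr_gt0.
have v0 : 0 <= v by rewrite -Ea2; apply: Rintegral_ge0 => o _; exact: sqr_ge0.
have L1 : 0 < L + 1 by rewrite ltr_wpDl.
have M1 : 0 < M + 1 by rewrite ltr_wpDl.
(* This cutoff scale makes the term [L * (6 / c)] of the geometric error at most [e]. *)
pose c := 6 * (L + 1) / e.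
have c0 : 0 < c by rewrite divr_gt0// mulr_gt0.
have Lc : L * (6 / c) <= e.
  have -> : L * (6 / c) = e * (L / (L + 1)) by rewrite /c; field; rewrite !gt_eqF.
  by rewrite ler_piMr ?(ltW e_gt0)// ler_pdivrMr// mul1r lerDl.
clearbody c e.
have /cvgrPdist_le/(_ e e_gt0) mQ := brownian_polygon_cvg_m hw L0 fL.
have [K [K0 BM]] : exists K : R, 0 <= K /\ forall n N : nat, (0 < n)%N -> (0 < N)%N ->
    iterE Q (increment w n 0) N (fun s => medium (c * \sum_(y <- s) y)) <=
    K * c ^+ 4 * (N%:R / n%:R) ^+ 2.
  by exists 2048; split=> [|n N n0 N0]; [exact: ler0n|exact: brownian_medium].
have quarter : (0 : R) < 1/4 by rewrite divr_gt0.
(* The factor 8 is [2 * 2 * 2]: from [2 * M], from the constant in Ottaviani's inequality, and from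
   [m + 1 <= 2 * m] blocks. *)
have [k [[hk1 hk2] [hk3 hk4]]] := filter_ex (filterI
  (filterI (near_harmonic_le L e_gt0) (near_harmonic_le (c ^+ 2) quarter))
  (filterI (near_harmonic_le (8 * K * M * c ^+ 4) e_gt0) mQ)).
set m := k.+1 in hk1 hk2 hk3 hk4.
have m0 : (0 < m)%N by [].
have m0R : (0 : R) < m%:R by rewrite ltr0n.
(* The comparison error [dl] of one block is later multiplied by [4 * M * m.+1]. *)
pose dl := e / (4 * (M + 1) * m.+1%:R).
have dl0 : 0 < dl by rewrite divr_gt0// !mulr_gt0.
have /cvgrPdist_le/(_ e e_gt0) nQ := brownian_polygon_cvg_n hw L0 fL m0.
have nA (C r : R) : 0 < r -> \forall n \near \oo, C / n%:R <= r.
  by move=> r0; have [n1 _ n1P] := near_harmonic_le C r0; exists n1.+1 => // -[|n] //= /n1P.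
apply: filter_app (nQ); apply: filter_app (coarse_clt m e_gt0).
apply: filter_app (medium_clt c dl0); apply: filter_app (nA (c ^+ 2 * v) _ quarter).
apply: filter_app (nA (20 * M * (c ^+ 2 * v)) _ e_gt0).
exists (m * m)%N => // n /= mmn h1 h2 h3 h4 h5.
have n0 : (0 < n)%N by apply: leq_trans mmn; rewrite muln_gt0.
have n0R : (0 : R) < n%:R by rewrite ltr0n.
have CE := coarse_error m0 mmn c0 h2 hk2.
have N0 : (0 < n %/ m)%N by rewrite divn_gt0// (leq_trans _ mmn)// leq_pmulr.
have {}BM := BM _ _ n0 N0.
have h3' := h3 _ (leq_div n m).
move: CE h3' BM; set IP := iterE P _ _ _; set IQ := iterE Q _ _ _ => CE h3' BM.
have Nn : (n %/ m)%:R / n%:R <= m%:R^-1 :> R.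
  by rewrite ler_pdivrMr// ler_pdivlMl// -natrM ler_nat mulnC leq_trunc_div.
have Nn2 : ((n %/ m)%:R / n%:R) ^+ 2 <= m%:R^-1 ^+ 2 :> R.
  by rewrite lerXn2r// nnegrE ?divr_ge0 ?invr_ge0.
have IPle : IP <= K * c ^+ 4 * m%:R^-1 ^+ 2 + dl.
  have c4 : 0 <= K * c ^+ 4 by apply: mulr_ge0 => //; exact: exprn_ge0 (ltW c0).
  apply: (le_trans (ler_distlDr h3')); rewrite lerD2r (le_trans BM)//.
  exact: ler_wpM2l.
have T3 : 2 * M * (m.+1%:R * (2 * IP)) <= e + e.
  have pm : 0 <= 2 * M * (m.+1%:R * 2) by rewrite !mulr_ge0.
  have -> : 2 * M * (m.+1%:R * (2 * IP)) = 2 * M * (m.+1%:R * 2) * IP by ring.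
  apply: (le_trans (ler_wpM2l pm IPle)); rewrite mulrDr lerD//.
    apply: le_trans hk3.
    have m2 : m.+1%:R <= 2 * m%:R :> R by rewrite -natrM ler_nat mul2n -addnn -[m.+1]addn1 leq_add2l.
    have q0 : 0 <= 4 * K * M * c ^+ 4 * m%:R^-1 ^+ 2.
      by rewrite !mulr_ge0// ?exprn_ge0// ?invr_ge0// ltW.
    have := ler_wpM2l q0 m2.
    have -> : 4 * K * M * c ^+ 4 * m%:R^-1 ^+ 2 * (2 * m%:R) = 8 * K * M * c ^+ 4 / m%:R.
      by field; rewrite gt_eqF.
    by apply: le_trans; rewrite le_eqVlt; apply/orP; left; apply/eqP; ring.
  have -> : 2 * M * (m.+1%:R * 2) * dl = e * (M / (M + 1)).
    by rewrite /dl; field; rewrite !gt_eqF// ltr0n.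
  by rewrite ler_piMr ?(ltW e_gt0)// ler_pdivrMr// mul1r lerDl.
have T1 : L * (m%:R^-1 + 6 / c) <= e + e by rewrite mulrDr lerD.
have T2 : 2 * M * (10 * (c ^+ 2 * v / n%:R)) <= e.
  by apply: le_trans h1; rewrite le_eqVlt; apply/orP; left; apply/eqP; ring.
apply: (le_trans (dist_chain4 CE h4 h5 hk4)); rewrite e8.
have -> : 8 * e = (e + e) + (e + (e + e)) + e + e + e by ring.
by rewrite !lerD2r lerD// mulrDr lerD.
Qed.

End walk_limit.

(** * From Lipschitz to continuous test functions *)

Section portmanteau.
Context {R : realType}.
Implicit Types (A B : set (R * R)).

(* the largest k-Lipschitz minorant of f on K20 *)
Definition inf_convolution (f : set (R * R) -> R) (k : R) A : R :=
  inf [set f B + k * hausdorff A B | B in K20].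

Variables (M : R) (f : set (R * R) -> R).
Hypothesis fM : forall A, K20 A -> `|f A| <= M.

Let lower k A : 0 <= k -> K20 A -> forall B, K20 B -> - M <= f B + k * hausdorff A B.
Proof.
move=> k0 KA B KB; have := fM KB; rewrite ler_norml => /andP[h _].
by rewrite -[leLHS]addr0 lerD// mulr_ge0// hausdorff_ge0.
Qed.

Lemma inf_convolution_le k A B : 0 <= k -> K20 A -> K20 B ->
  inf_convolution f k A <= f B + k * hausdorff A B.
Proof.
move=> k0 KA KB; apply: ge_inf; last by exists B.
by exists (- M) => _ [C KC <-]; exact: lower.
Qed.

Lemma le_inf_convolution k A (r : R) : K20 A ->
  (forall B, K20 B -> r <= f B + k * hausdorff A B) -> r <= inf_convolution f k A.
Proof.
move=> KA h; apply: lb_le_inf; first by exists (f A + k * hausdorff A A), A.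
by move=> _ [B KB <-]; exact: h.
Qed.

Lemma inf_convolution_le_id k A : 0 <= k -> K20 A -> inf_convolution f k A <= f A.
Proof.
by move=> k0 KA; have := inf_convolution_le k0 KA KA; rewrite hausdorffxx// mulr0 addr0.
Qed.

Lemma K20_lip_inf_convolution k : 0 <= k -> K20_lip M k (inf_convolution f k).
Proof.
move=> k0; split=> [A KA|A B KA KB].
  rewrite ler_norml le_inf_convolution//=; last exact: lower.
  apply: (le_trans (inf_convolution_le_id k0 KA)).
  exact: le_trans (ler_norm _) (fM KA).
have h A1 B1 : K20 A1 -> K20 B1 ->
    inf_convolution f k A1 - k * hausdorff A1 B1 <= inf_convolution f k B1.
  move=> KA1 KB1; apply: le_inf_convolution => // C KC.
  rewrite lerBlDr -addrA -mulrDr; apply: (le_trans (inf_convolution_le k0 KA1 KC)).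
  by rewrite lerD2l ler_wpM2l// addrC hausdorff_triangle.
have h1 := h A B KA KB; have := h B A KB KA; rewrite (hausdorffC B A) => h2.
by rewrite ler_norml; apply/andP; split; lra.
Qed.

(** A competitor [B] within [d] of [A] gains less than [e] by continuity; one farther away pays at
    least [k * d], which exceeds the oscillation [2 * M] of [f] once [k] is large. Only continuity
    at [A] is used. *)
Lemma inf_convolution_cvg A : K20 A ->
  (forall e : R, 0 < e -> exists2 d : R, 0 < d &
     forall B, K20 B -> hausdorff A B < d -> `|f A - f B| < e) ->
  (fun k : nat => inf_convolution f k%:R A) @ \oo --> f A.
Proof.
move=> KA fc; apply/cvgrPdist_le => /= e e0; have [d d0 fd] := fc e e0.
exists (Num.truncn (2 * M / d)).+1 => // k /= hk.
have le1 : inf_convolution f k%:R A <= f A by exact: inf_convolution_le_id.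
rewrite ger0_norm ?subr_ge0// lerBlDl -lerBlDr; apply: le_inf_convolution => // B KB.
have h0 := hausdorff_ge0 KA KB.
have [hd|hd] := ltP (hausdorff A B) d.
  have := fd B KB hd; rewrite ltr_norml => /andP[_ h].
  by have := mulr_ge0 (ler0n R k) h0; lra.
have kd : 2 * M <= k%:R * d.
  rewrite -ler_pdivrMr//; apply: (le_trans (ltW (truncnS_gt _))).
  by rewrite ler_nat.
have : k%:R * d <= k%:R * hausdorff A B by rewrite ler_wpM2l.
by have := fM KA; have := fM KB; rewrite !ler_norml; lra.
Qed.

End portmanteau.

Section weak_convergence.
Context {R : realType} {d d' : measure_display} {T : measurableType d} {T' : measurableType d'}.
Variables (P : probability T R) (X : nat -> T -> set (R * R))
  (Q : probability T' R) (Y : T' -> set (R * R)).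
Hypotheses (KX : forall n o, K20 (X n o)) (KY : forall o, K20 (Y o)).
Hypothesis lipX : forall M L (f : set (R * R) -> R) n, 0 <= L -> K20_lip M L f ->
  measurable_fun setT (fun o => f (X n o)).
Hypothesis lipY : forall M L (f : set (R * R) -> R), 0 <= L -> K20_lip M L f ->
  measurable_fun setT (fun o => f (Y o)).
Hypothesis lip_cvg : forall M L (f : set (R * R) -> R), 0 <= L -> K20_lip M L f ->
  (fun n => \int[P]_o f (X n o)) @ \oo --> \int[Q]_o f (Y o).

(** Measurability along the random sets is not part of the definition of weak convergence; it is
    inherited from the Lipschitz minorants, which converge pointwise on [K20]. *)
Lemma bounded_continuous_measurable f : bounded_continuous_K20 f ->
  (forall n, measurable_fun setT (fun o => f (X n o))) /\
  measurable_fun setT (fun o => f (Y o)).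
Proof.
move=> [[M fM] fc]; have lk (k : nat) := K20_lip_inf_convolution fM (ler0n R k).
split=> [n|].
  apply: (@measurable_fun_cvg _ _ _ setT (fun k o => inf_convolution f k%:R (X n o))) => [k|o _].
    exact: (lipX n (ler0n R k) (lk k)).
  by apply: (inf_convolution_cvg fM (KX n o)); exact: fc.
apply: (@measurable_fun_cvg _ _ _ setT (fun k o => inf_convolution f k%:R (Y o))) => [k|o _].
  exact: (lipY (ler0n R k) (lk k)).
by apply: (inf_convolution_cvg fM (KY o)); exact: fc.
Qed.

(** One Lipschitz minorant is fixed with nearly the same limiting expectation; its expectations
    converge and lie below those of [f]. The reverse inequality comes later from [- f]. *)
Lemma expectation_lower_semicontinuous f (e : R) : bounded_continuous_K20 f -> 0 < e ->
  \forall n \near \oo, \int[Q]_o f (Y o) - e <= \int[P]_o f (X n o).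
Proof.
move=> fbc e0; have [mX mY] := bounded_continuous_measurable fbc.
have [[M fM] fc] := fbc; have lk (k : nat) := K20_lip_inf_convolution fM (ler0n R k).
have e2 : 0 < e / 2 by rewrite divr_gt0.
have /cvgrPdist_le/(_ _ e2)[k _ /(_ k (leqnn k)) hk] :
    (fun k : nat => \int[Q]_o inf_convolution f k%:R (Y o)) @ \oo --> \int[Q]_o f (Y o).
  apply: (@Rintegral_dominated_cvg _ _ _ _ _ _ (cst M)) => [k|o||k o].
  - exact: (lipY (ler0n R k) (lk k)).
  - by apply: (inf_convolution_cvg fM (KY o)); exact: fc.
  - exact: finite_measure_integrable_cst.
  - exact: (lk k).1.
have /cvgrPdist_le/(_ _ e2) := lip_cvg (ler0n R k) (lk k).
apply: filterS => n hn.
have : \int[P]_o inf_convolution f k%:R (X n o) <= \int[P]_o f (X n o).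
  apply: le_expectation.
  - apply: (@bounded_integrable _ _ _ P (fun o => inf_convolution f k%:R (X n o)) M).
      exact: (lipX n (ler0n R k) (lk k)).
    by move=> o; exact: (lk k).1.
  - by apply: (@bounded_integrable _ _ _ P (fun o => f (X n o)) M) => // o; exact: fM.
  - by move=> o; exact: (inf_convolution_le_id fM (ler0n R k) (KX n o)).
by move: hk hn; rewrite !ler_norml; lra.
Qed.

Lemma weak_cvg_K20_lip : weak_cvg_K20 P X Q Y.
Proof.
move=> f fbc; have [mX mY] := bounded_continuous_measurable fbc.
have [[M fM] fc] := fbc.
have fbcN : bounded_continuous_K20 (fun A => - f A).
  split; first by exists M => A KA; rewrite normrN; exact: fM.
  move=> A KA e e0; have [dl dl0 h] := fc A KA e e0; exists dl => // B KB AB.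
  by rewrite opprK addrC distrC; exact: h.
have EX n : (\int[P]_o (f (X n o))%:E = (\int[P]_o f (X n o))%:E)%E.
  rewrite /Rintegral fineK//; apply: integrable_fin_num => //.
  by apply: (@bounded_integrable _ _ _ P (fun o => f (X n o)) M) => // o; exact: fM.
have iY : Q.-integrable setT (EFin \o (fun o => f (Y o))).
  by apply: (@bounded_integrable _ _ _ Q (fun o => f (Y o)) M) => // o; exact: fM.
have iX n : P.-integrable setT (EFin \o (fun o => f (X n o))).
  by apply: (@bounded_integrable _ _ _ P (fun o => f (X n o)) M) => // o; exact: fM.
have EY : (\int[Q]_o (f (Y o))%:E = (\int[Q]_o f (Y o))%:E)%E.
  by rewrite /Rintegral fineK//; exact: integrable_fin_num.
rewrite EY; under eq_fun do rewrite EX.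
apply: cvg_EFin; first exact: nearW.
apply/cvgrPdist_le => /= e e0.
have opp (d0 : measure_display) (T0 : measurableType d0) (p : probability T0 R) (g : T0 -> R) :
    p.-integrable setT (EFin \o g) -> \int[p]_o - g o = - \int[p]_o g o.
  by move=> ig; under eq_Rintegral do rewrite -mulN1r; rewrite RintegralZl// mulN1r.
have h1 := expectation_lower_semicontinuous fbc e0.
have h2 := expectation_lower_semicontinuous fbcN e0.
apply: filter_app h1; apply: filterS h2 => n; rewrite !opp// => h2 h1.
by rewrite ler_norml; apply/andP; split; lra.
Qed.

End weak_convergence.

(** * Moments of the projected steps *)

Lemma dot2_decomposition {R : realType} (z y : R * R) : y.1 ^+ 2 + y.2 ^+ 2 = 1 ->
  z.1 ^+ 2 + z.2 ^+ 2 = dot2 z y ^+ 2 + dot2 z (- y.2, y.1) ^+ 2.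
Proof.
move=> y1; transitivity ((z.1 ^+ 2 + z.2 ^+ 2) * (y.1 ^+ 2 + y.2 ^+ 2)).
  by rewrite y1 mulr1.
by rewrite /dot2 /=; ring.
Qed.

Section unit_vectors.
Context {R : realType}.
Variable x : R * R.
Hypothesis x0 : 0 < enorm2 x.

Lemma muhat_sqr : (muhat x).1 ^+ 2 + (muhat x).2 ^+ 2 = 1.
Proof.
rewrite /muhat /scale2 /= !exprMn -mulrDr -enorm2_sqr.
by rewrite -exprMn mulVf ?expr1n// gt_eqF.
Qed.

Lemma dot2_muhat : dot2 x (muhat x) = enorm2 x.
Proof.
rewrite /dot2 /muhat /scale2 /=.
have -> : x.1 * ((enorm2 x)^-1 * x.1) + x.2 * ((enorm2 x)^-1 * x.2) =
  (x.1 ^+ 2 + x.2 ^+ 2) / enorm2 x by ring.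
by rewrite -enorm2_sqr expr2 mulfK// gt_eqF.
Qed.

Lemma dot2_muhat_perp : dot2 x (muhat_perp x) = 0.
Proof. by rewrite /dot2 /muhat_perp /muhat /scale2 /=; ring. Qed.

End unit_vectors.

Section moments.
Context {R : realType} {d : measure_display} {T : measurableType d}.
Variables (P : probability T R) (Z : T -> R * R).
Hypothesis mZ : measurable_fun setT Z.
Hypothesis Z2 : ('E_P[fun w => ((Z w).1 ^+ 2 + (Z w).2 ^+ 2)%R] < +oo)%E.

Let mZ1 : measurable_fun setT (fun o => (Z o).1).
Proof. exact: (measurableT_comp measurable_fst mZ). Qed.

Let mZ2 : measurable_fun setT (fun o => (Z o).2).
Proof. exact: (measurableT_comp measurable_snd mZ). Qed.

Let iZ2 : P.-integrable setT (EFin \o (fun o => (Z o).1 ^+ 2 + (Z o).2 ^+ 2)).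
Proof.
apply/integrableP; split.
  by apply/measurable_EFinP; apply: measurable_funD; exact: measurable_funX.
move: Z2; rewrite unlock; congr (_ < _)%E; apply: eq_integral => o _ /=.
by rewrite ger0_norm// addr_ge0 ?sqr_ge0.
Qed.

(** Both rescaled coordinates of a step have this form, so one integrability lemma and one formula
    for the mean serve for both. *)
Let affine (p q r : R) (o : T) : R := p * (Z o).1 + q * (Z o).2 + r.

Let maffine p q r : measurable_fun setT (affine p q r).
Proof. by apply: measurable_funD => //; apply: measurable_funD; exact: measurable_funM. Qed.

Lemma affine_integrable2 p q r : P.-integrable setT (EFin \o (fun o => affine p q r o ^+ 2)).
Proof.
(* The square of a sum of three terms is at most 3 times the sum of their squares, and [(p x)^2 + (q
   y)^2 <= (p^2 + q^2) * (x^2 + y^2)]. *)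
pose K := 3 * (p ^+ 2 + q ^+ 2).
have i1 : P.-integrable setT (EFin \o (fun o => K * ((Z o).1 ^+ 2 + (Z o).2 ^+ 2))).
  exact: (integrableZl measurableT K iZ2).
have i0 : P.-integrable setT (EFin \o (fun=> 3 * r ^+ 2)) by exact: finite_measure_integrable_cst.
have i01 : P.-integrable setT (EFin \o (fun o => K * ((Z o).1 ^+ 2 + (Z o).2 ^+ 2) + 3 * r ^+ 2)).
  exact: (integrableD measurableT i1 i0).
apply: le_integrable i01 => //; first by apply/measurable_EFinP; exact: measurable_funX.
move=> o _ /=; rewrite lee_fin ger0_norm ?sqr_ge0//; apply: le_trans (ler_norm _).
rewrite /affine /K; move: (Z o).1 (Z o).2 => x y.
have := sqr_ge0 (p * x - q * y); have := sqr_ge0 (p * x - r); have := sqr_ge0 (q * y - r).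
have := sqr_ge0 (p * y); have := sqr_ge0 (q * x); nra.
Qed.

Lemma affine_integrable1 p q r : P.-integrable setT (EFin \o affine p q r).
Proof.
have i0 : P.-integrable setT (EFin \o (fun=> 1 : R)) by exact: finite_measure_integrable_cst.
have i1 : P.-integrable setT (EFin \o (fun o => 1 + affine p q r o ^+ 2)).
  exact: (integrableD measurableT i0 (affine_integrable2 p q r)).
apply: le_integrable i1 => //; first exact/measurable_EFinP.
move=> o _ /=; rewrite lee_fin [leRHS]ger0_norm ?addr_ge0 ?sqr_ge0//.
move: (affine _ _ _ _) => x; rewrite ler_norml; apply/andP; split.
  by have := sqr_ge0 (x + 1); nra.
by have := sqr_ge0 (x - 1); nra.
Qed.

Lemma affine_mean p q r : \int[P]_o affine p q r o =
  p * (mean2 P Z).1 + q * (mean2 P Z).2 + r.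
Proof.
have i1 : P.-integrable setT (EFin \o (fun o => (Z o).1)).
  have := affine_integrable1 1 0 0; congr (_.-integrable _ _); apply/funext => o /=.
  by rewrite /affine mul1r mul0r !addr0.
have i2 : P.-integrable setT (EFin \o (fun o => (Z o).2)).
  have := affine_integrable1 0 1 0; congr (_.-integrable _ _); apply/funext => o /=.
  by rewrite /affine mul1r mul0r add0r addr0.
have j1 : P.-integrable setT (EFin \o (fun o => p * (Z o).1)).
  exact: (integrableZl measurableT p i1).
have j2 : P.-integrable setT (EFin \o (fun o => q * (Z o).2)).
  exact: (integrableZl measurableT q i2).
have j12 : P.-integrable setT (EFin \o (fun o => p * (Z o).1 + q * (Z o).2)).
  exact: (integrableD measurableT j1 j2).
have jr : P.-integrable setT (EFin \o (fun=> r)) by exact: finite_measure_integrable_cst.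
rewrite /affine RintegralD// Rintegral_prob_cst RintegralD// !RintegralZl//.
by rewrite /mean2 /= !expectation.unlock.
Qed.

Hypothesis mean_neq0 : mean2 P Z <> (0, 0).
Local Notation m := (mean2 P Z).
Local Notation u := (muhat m).
Local Notation u' := (muhat_perp m).

Lemma enorm2_mean_gt0 : 0 < enorm2 m.
Proof.
rewrite lt_neqAle enorm2_ge0 andbT eq_sym; apply/eqP => h; apply: mean_neq0.
have /eqP : m.1 ^+ 2 + m.2 ^+ 2 = 0 by rewrite -enorm2_sqr h expr0n.
rewrite paddr_eq0 ?sqr_ge0// !sqrf_eq0 => /andP[/eqP h1 /eqP h2].
by rewrite [m]surjective_pairing h1 h2.
Qed.

(** Pythagoras in the rotated frame splits [sigma2]. No centring remains on the right, because the
    mean is orthogonal to [muhat_perp]. *)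
Lemma sigma2_perpE : sigma2_perp P Z = \int[P]_o dot2 (Z o) u' ^+ 2.
Proof.
have dE (o : T) (y : R * R) : dot2 (sub2 (Z o) m) y = affine y.1 y.2 (- dot2 m y) o.
  by rewrite /dot2 /sub2 /affine /=; ring.
have dE' o : dot2 (Z o) u' = affine u'.1 u'.2 (- dot2 m u') o.
  by rewrite /affine dot2_muhat_perp oppr0 addr0 /dot2; ring.
have E1 : sigma2 P Z = \int[P]_o (affine u.1 u.2 (- dot2 m u) o ^+ 2 + affine u'.1 u'.2 (- dot2 m u') o ^+ 2).
  rewrite /sigma2 unlock; apply: (@eq_Rintegral _ _ _ P setT) => o _.
  rewrite enorm2_sqr -!dE; move: (sub2 (Z o) m) => z.
  exact: dot2_decomposition (muhat_sqr enorm2_mean_gt0).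
have E2 : sigma2_mu P Z = \int[P]_o affine u.1 u.2 (- dot2 m u) o ^+ 2.
  by rewrite /sigma2_mu unlock; apply: (@eq_Rintegral _ _ _ P setT) => o _; rewrite dE.
rewrite /sigma2_perp E1 E2 RintegralD//; [|exact: affine_integrable2|exact: affine_integrable2].
by rewrite addrAC subrr add0r; apply: eq_Rintegral => o _; rewrite dE'.
Qed.

End moments.

(** * The scaling map and the assembly *)

Lemma psiE {R : realType} (mu : R * R) (s2 : R) n x y (t : R) :
  psi mu s2 n (t * x.1 + (1 - t) * y.1, t * x.2 + (1 - t) * y.2) =
  (t * (psi mu s2 n x).1 + (1 - t) * (psi mu s2 n y).1,
   t * (psi mu s2 n x).2 + (1 - t) * (psi mu s2 n y).2).
Proof. by rewrite /psi /dot2 /=; congr pair; ring. Qed.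

Lemma psi_walk {R : realType} {T : Type} (Z : nat -> T -> R * R) (mu : R * R) (s2 : R)
    (n k : nat) (o : T) : (0 < n)%N -> 0 < enorm2 mu -> 0 < s2 ->
  psi mu s2 n (walk Z k o) = fine_path
    (fun i => n%:R^-1 * (dot2 (Z i o) (muhat mu) / enorm2 mu - 1))
    (fun i => Num.sqrt n%:R^-1 * (dot2 (Z i o) (muhat_perp mu) / Num.sqrt s2)) n k.
Proof.
move=> n0 mu0 s20; have n0R : (0 : R) < n%:R by rewrite ltr0n.
have dotS y : dot2 (walk Z k o) y = \sum_(i < k) dot2 (Z i o) y.
  by rewrite /dot2 /walk /= !mulr_suml -big_split.
rewrite /psi /fine_path !dotS; congr pair.
  rewrite -mulr_sumr sumrB -mulr_suml sumr_const card_ord.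
  by field; rewrite !gt_eqF.
rewrite -mulr_sumr -mulr_suml sqrtrM ?ltW// sqrtrV ?ltW//.
by field; rewrite !gt_eqF// sqrtr_gt0.
Qed.

Theorem theorem2p7 (R : realType) (d : measure_display) (T : measurableType d)
  (P : probability T R) (Z : nat -> T -> R * R)
  (hZ : iid_R2 P Z)
  (h2 : ('E_P[fun w => ((Z 0%N w).1 ^+ 2 + (Z 0%N w).2 ^+ 2)%R] < +oo)%E)
  (hmu : mean2 P (Z 0%N) <> (0, 0))
  (hperp : 0 < sigma2_perp P (Z 0%N))
  (d' : measure_display) (T' : measurableType d') (Q : probability T' R)
  (w : T' -> R -> R) (hw : std_brownian Q w) :
  weak_cvg_K20 P
    (fun n o => psi (mean2 P (Z 0%N)) (sigma2_perp P (Z 0%N)) n @`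
                  hull2 [set walk Z k o | k in [set k : nat | (k <= n)%N]])
    Q (htilde1 w).
Proof.
have [mZ [iZ lZ]] := hZ.
set mu := mean2 P (Z 0%N); set s2 := sigma2_perp P (Z 0%N).
have mu0 : 0 < enorm2 mu by exact: enorm2_mean_gt0.
(* Subtracting 1 removes the drift: the projected mean is [enorm2 mu]. In [b] the division by
   [Num.sqrt s2] gives variance 1, by [sigma2_perpE]. *)
pose a (k : nat) (o : T) := dot2 (Z k o) (muhat mu) / enorm2 mu - 1.
pose b (k : nat) (o : T) := dot2 (Z k o) (muhat_perp mu) / Num.sqrt s2.
have mdot y : measurable_fun setT (fun z : R * R => dot2 z y).
  by apply: measurable_funD; apply: measurable_funM.
have aP : iid P a.
  apply: (iid_map (g := fun z => dot2 z (muhat mu) / enorm2 mu - 1) mZ iZ lZ).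
  by apply: measurable_funB => //; exact: measurable_funM.
have bP : iid P b.
  apply: (iid_map (g := fun z => dot2 z (muhat_perp mu) / Num.sqrt s2) mZ iZ lZ).
  exact: measurable_funM.
have aE o : a 0%N o = (muhat mu).1 / enorm2 mu * (Z 0%N o).1 +
    (muhat mu).2 / enorm2 mu * (Z 0%N o).2 + -1.
  by rewrite /a /dot2; ring.
have bE o : b 0%N o = (muhat_perp mu).1 / Num.sqrt s2 * (Z 0%N o).1 +
    (muhat_perp mu).2 / Num.sqrt s2 * (Z 0%N o).2 + 0.
  by rewrite /b /dot2; ring.
have aE' : a 0%N = _ := funext aE; have bE' : b 0%N = _ := funext bE.
have ia : P.-integrable setT (EFin \o a 0%N) by rewrite aE'; exact: affine_integrable1.
have ib : P.-integrable setT (EFin \o b 0%N) by rewrite bE'; exact: affine_integrable1.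
have ia2 : P.-integrable setT (EFin \o (fun o => a 0%N o ^+ 2)).
  by rewrite aE'; exact: affine_integrable2.
have ib2 : P.-integrable setT (EFin \o (fun o => b 0%N o ^+ 2)).
  by rewrite bE'; exact: affine_integrable2.
have Ea : \int[P]_o a 0%N o = 0.
  rewrite aE' affine_mean// -/mu.
  transitivity (dot2 mu (muhat mu) / enorm2 mu - 1); first by rewrite /dot2; ring.
  by rewrite dot2_muhat// divff ?subrr// gt_eqF.
have Eb : \int[P]_o b 0%N o = 0.
  rewrite bE' affine_mean// -/mu.
  transitivity (dot2 mu (muhat_perp mu) / Num.sqrt s2); first by rewrite /dot2; ring.
  by rewrite dot2_muhat_perp mul0r.
have s20 : 0 < Num.sqrt s2 by rewrite sqrtr_gt0.
have Eb2 : \int[P]_o b 0%N o ^+ 2 = 1.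
  have -> : (fun o => b 0%N o ^+ 2) = (fun o => s2^-1 * dot2 (Z 0%N o) (muhat_perp mu) ^+ 2).
    by apply/funext => o; rewrite /b exprMn exprVn sqr_sqrtr ?ltW// mulrC.
  rewrite RintegralZl//; last first.
    have := @affine_integrable2 _ _ _ P _ (mZ 0%N) h2 (muhat_perp mu).1 (muhat_perp mu).2 0.
    congr (_.-integrable _ _); apply/funext => o /=.
    by rewrite addr0 /dot2 mulrC [X in _ + X]mulrC.
  by rewrite -sigma2_perpE// mulVf// gt_eqF.
have W : weak_cvg_K20 P (walk_polygon a b) Q (htilde1 w).
  apply: weak_cvg_K20_lip.
  - by move=> n o; exact: K20_walk_polygon.
  - by move=> o; apply: K20_graph_hull; [case: hw => _ [_ [+ _]]; exact|case: hw => _ [+ _]; exact].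
  - by move=> M L f n L0 fL; exact: (measurable_walk_polygon aP bP L0 fL).
  - by move=> M L f L0 fL; exact: (measurable_graph_hull hw L0 fL).
  - move=> M L f L0 fL.
    (* [erefl] leaves the variance of [a] as its integral: its value does not affect the limit,
       since the drift error is scaled by [1/n]. *)
    exact: (walk_polygon_cvg aP ia Ea ia2 erefl bP ib Eb ib2 Eb2 hw L0 fL).
move=> f fbc; apply: cvg_trans (W f fbc).
(* The index [n = 0], where the divisors in [psi] vanish, is discarded; from 1 on, the affine map
   [psi] commutes with the hull and the two sets coincide. *)
apply: near_eq_cvg; exists 1%N => // n /= n0; apply: eq_integral => o _.
congr (f _)%:E; rewrite /walk_polygon /polygon image_hull2; last exact: psiE.
congr hull2; apply/seteqP; split=> [_ [k kn <-]|_ [_ [k kn <-] <-]].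
  by exists (walk Z k o); [exists k|rewrite psi_walk].
by exists k => //; rewrite psi_walk.
Qed.
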